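(* Let $n\ge1$ and let $D_0,D_1,\dots,D_n$ be domains of $\overline{\mathbb C}$ such that $D_0$ contains the point $z=0$ and $D_0\cap D_k=\emptyset$ for $k=1,\dots,n$, and such that for each $k=1,\dots,n$ the domain $D_k$ contains a point $z_k\in\mathbb C\setminus\{0\}$ with $\arg z_k=2\pi k/n$ (modulo $2\pi$); the domains $D_1,\dots,D_n$ are allowed to overlap. For $k=1,\dots,n$ let $g_k(z)$ be the Green function, with pole at $z_k$, of the connected component of $\bigcup_{j=1}^nD_j$ containing $z_k$, and put $g_k(z)=0$ outside this component. Then $$\exp\Bigl(2\sum_{1\le k<l\le n}g_k(z_l)\Bigr)\,\bigl(r(D_0,0)\bigr)^{n^2}\prod_{k=1}^nr(D_k,z_k)\ \le\ n^{-n}\prod_{k=1}^n|z_k|^{n+1}.$$ Moreover, for every $R>0$ equality is attained for the points $z_k^*=R\exp(2\pi ik/n)$, $k=1,\dots,n$, and the domains $D_0^*\ni0$ and $D_k^*\ni z_k^*$, $k=1,\dots,n$, bounded by the curves $z=\sqrt[n]{R^n/2+it}$, $-\infty<t<+\infty$ (all branches of the root); that is, $D_0^*=\{z:\operatorname{Re}z^n<R^n/2\}$ and $D_k^*$ is the connected component of $\{z:\operatorname{Re}z^n>R^n/2\}$ containing $z_k^*$.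
   Context: $\overline{\mathbb C}$ is the Riemann sphere. For a domain $G\subset\overline{\mathbb C}$ with Green function $g_G(z,z_0)$ (pole at the finite point $z_0\in G$), the inner radius of $G$ with respect to $z_0$ is $r(G,z_0)=\exp\{\lim_{z\to z_0}(g_G(z,z_0)+\log|z-z_0|)\}$. *)

(* Defs.v *)
From HB Require Import structures.
From mathcomp Require Import all_boot all_order all_algebra.
From mathcomp Require Import complex.
From mathcomp Require Import all_classical all_reals all_analysis.

Set Implicit Arguments.
Unset Strict Implicit.
Unset Printing Implicit Defensive.

Import Order.TTheory GRing.Theory Num.Theory.
Import numFieldNormedType.Exports.

Local Open Scope classical_set_scope.
Local Open Scope complex_scope.
Local Open Scope ring_scope.

(* [R[i]^o] carries the topology of the modulus; [None] is the point at
   infinity. *)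
Definition sphere (R : realType) : topologicalType :=
  one_point_compactification R[i]^o.

Definition fin_pt (R : realType) (z : R[i]) : sphere R := Some z.

Definition domain (R : realType) (G : set (sphere R)) : Prop :=
  [/\ G !=set0, open G & connected G].

Definition modulus (R : realType) (z : R[i]) : R := complex.Re `|z|.

Definition cis (R : realType) (t : R) : R[i] := cos t +i* sin t.

Definition circle_mean (R : realType) (v : sphere R -> R) (c : R[i]) (r : R)
    : R :=
  (2 * pi)^-1 * \int[lebesgue_measure]_(t in `[0, 2 * pi])
                  v (fin_pt (c + r%:C * cis t)).

(* In the chart w = 1/z the small circles |w| = 1/r about infinity are the large
   circles |z| = r. *)
Definition sub_mean_at (R : realType) (v : sphere R -> R) (x : sphere R)
    : Prop :=
  match x with
  | Some c => \forall r \near 0^'+, v (fin_pt c) <= circle_mean v c r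
  | None => \forall r \near +oo, v None <= circle_mean v 0 r
  end.

(* Continuous functions with the local sub-mean-value property: the usual class
   of subharmonic functions in Perron's method.  Allowing upper semicontinuous
   functions would not change the envelope below. *)
Definition subharmonic_on (R : realType) (A : set (sphere R))
    (v : sphere R -> R) : Prop :=
  forall x, A x -> {for x, continuous v} /\ sub_mean_at v x.

(* Perron family of the Green function: subharmonic in G \ {z0}, zero off a
   compact subset of G, at most a logarithmic pole at z0. *)
Definition green_family (R : realType) (G : set (sphere R)) (z0 : R[i])
    : set (sphere R -> R) :=
  [set v | [/\ subharmonic_on (G `\ fin_pt z0) v,
      exists K : set (sphere R),
        [/\ compact K, K `<=` G & forall x, ~ K x -> v x = 0] &
      exists M : R, \forall z \near (z0 : R[i]^o)^',
        v (fin_pt z) + ln (modulus (z - z0)) <= M]].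

(* Ahlfors' definition of the Green function (the upper envelope of its Perron
   family), valid with no regularity assumption on the boundary of G.  The
   domain G has a Green function iff the envelope is finite off z0, which is the
   case as soon as the complement of G has interior points.  The real [sup] is
   meaningful only then, and only at points other than z0. *)
Definition green (R : realType) (G : set (sphere R)) (z0 : R[i])
    (x : sphere R) : R :=
  sup [set v x | v in green_family G z0].

Definition inner_radius (R : realType) (G : set (sphere R)) (z0 : R[i]) : R :=
  expR (lim (green G z0 (fin_pt z) + ln (modulus (z - z0))
               @[z --> (z0 : R[i]^o)^'])).

(* D_1, ..., D_n and z_1, ..., z_n are indexed by 'I_n, where k : 'I_n stands
   for k + 1; hence arg (z k) is 2 pi (k + 1) / n. *)
Definition admissible (R : realType) (n : nat) (D0 : set (sphere R))
    (D : 'I_n -> set (sphere R)) (z : 'I_n -> R[i]) : Prop :=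
  [/\ domain D0 /\ D0 (fin_pt 0),
      forall k, domain (D k) /\ D k (fin_pt (z k)),
      forall k, D0 `&` D k = set0 &
      forall k, z k != 0 /\
        z k = (modulus (z k))%:C * cis (2 * pi * k.+1%:R / n%:R)].

Definition component (R : realType) (n : nat) (D : 'I_n -> set (sphere R))
    (z : 'I_n -> R[i]) (k : 'I_n) : set (sphere R) :=
  connected_component (\bigcup_(j in [set: 'I_n]) D j) (fin_pt (z k)).

Definition green_ext (R : realType) (n : nat) (D : 'I_n -> set (sphere R))
    (z : 'I_n -> R[i]) (k : 'I_n) (x : sphere R) : R :=
  if x \in component D z k then green (component D z k) (z k) x else 0.

Definition radii_product (R : realType) (n : nat) (D0 : set (sphere R))
    (D : 'I_n -> set (sphere R)) (z : 'I_n -> R[i]) : R :=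
  expR (2 * \sum_(k < n) \sum_(l < n | (k < l)%N)
              green_ext D z k (fin_pt (z l)))
  * inner_radius D0 0 ^+ (n ^ 2) * \prod_(k < n) inner_radius (D k) (z k).

Definition bound (R : realType) (n : nat) (z : 'I_n -> R[i]) : R :=
  n%:R ^- n * \prod_(k < n) modulus (z k) ^+ n.+1.

Definition zstar (R : realType) (n : nat) (rho : R) (k : 'I_n) : R[i] :=
  rho%:C * cis (2 * pi * k.+1%:R / n%:R).

Definition D0star (R : realType) (n : nat) (rho : R) : set (sphere R) :=
  [set fin_pt z | z in [set z : R[i] | complex.Re (z ^+ n) < rho ^+ n / 2]].

Definition Dstar (R : realType) (n : nat) (rho : R) (k : 'I_n)
    : set (sphere R) :=
  connected_component
    [set fin_pt z | z in [set z : R[i] | rho ^+ n / 2 < complex.Re (z ^+ n)]]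
    (fin_pt (zstar rho k)).

(* Main.v *)
Require Import Defs.
From HB Require Import structures.
From mathcomp Require Import all_boot all_order all_algebra.
From mathcomp Require Import complex ring lra zify.
From mathcomp Require Import all_classical all_reals all_analysis.

Set Implicit Arguments.
Unset Strict Implicit.
Unset Printing Implicit Defensive.

Import Order.TTheory GRing.Theory Num.Theory.
Import numFieldNormedType.Exports.

(* The inequality is a statement about the energy of the signed charge
   n delta_0 - sum_k delta_(z_k).  A member v of a Perron family, truncated near
   infinity and corrected at its pole, gives a potential f = v + ln |z - z_k|
   that is subharmonic in the whole plane, at least ln |z - z_k|, and equal to it
   off a compact subset of the domain.  For finitely many such potentials f_i
   and a neutral charge q, where potentials of opposite charge differ from the
   logarithm on sets at positive distance, the sum of q_i q_j f_i(p_j) is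
   nonpositive: this is the positivity of logarithmic energy, tested with
   circle averages of small radius instead of Laplacians, the mixed terms only
   increasing when ln |z - p_i| is replaced by f_i.  Passing to the suprema bounds
   n^2 log r(D_0, 0) + sum_k log r(D_k, z_k) + 2 sum_(k < l) g_k(z_l) by
   2 n sum_k log |z_k| - 2 sum_(k < l) log |z_k - z_l|, and the theorem follows
   from |z_k - z_l|^2 >= |z_k| |z_l| |zeta_k - zeta_l|^2 with
   prod_(l <> k) |zeta_k - zeta_l| = n for the n-th roots of unity.  In the
   extremal configuration the Green functions are (1/n) ln |(z^n - R^n) / z^n| and
   ln |z^n / (z^n - R^n)|, and the rays where z^n <= 0 separate the D_k^*. *)

(** Members of a Perron family are merely continuous, without an exact constant term at the pole,
    and nothing is known of the boundaries of the domains. Hence Laplacians give way to differences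
    [lap r F] of a circle mean and a value, and harmonic functions with given boundary values to
    finite sums of Poisson kernels. As the inner radius is defined by a [lim], its existence is
    proved too: it is the exponential of the supremum of [pole_mean] over the nonnegative members.
    The values [f i (p j)] and [f j (p i)] of two potentials may differ, so the energy inequality
    carries a selector [s] that picks one of them for each ordered pair; this isolates the values
    g_k(z_l) with k < l. Potentials of charges of equal sign may overlap. This is why the D_k may
    overlap, and why the potential of z_k can be built in the component of the union: at the pole it
    must account for the radius of D_k, at the other points for the Green function of the larger
    component. Neutrality makes the total potential vanish at infinity, where each single one grows
    like ln |z|. *)

Local Open Scope classical_set_scope.
Local Open Scope complex_scope.
Local Open Scope ring_scope.

(** * The modulus, the points of the unit circle and the topology of the plane *)

Section Plane.
Context (R : realType).
Implicit Types (z w c : R[i]) (x y r s t : R).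

Lemma modulusE z : modulus z = Num.sqrt (complex.Re z ^+ 2 + complex.Im z ^+ 2).
Proof. by case: z. Qed.

Lemma normcE' z : `|z| = (modulus z)%:C.
Proof. by rewrite /modulus normc_def. Qed.

Lemma modulus_ge0 z : 0 <= modulus z.
Proof. by rewrite modulusE sqrtr_ge0. Qed.

Lemma modulusM z w : modulus (z * w) = modulus z * modulus w.
Proof. by apply: complexI; rewrite rmorphM -!normcE' normrM. Qed.

Lemma modulusD z w : modulus (z + w) <= modulus z + modulus w.
Proof. by rewrite -lecR rmorphD -!normcE' ler_normD. Qed.

Lemma modulusN z : modulus (- z) = modulus z.
Proof. by rewrite /modulus normrN. Qed.

Lemma modulusB z w : modulus (z - w) = modulus (w - z).
Proof. by rewrite -modulusN opprB. Qed.

Lemma modulus0 : modulus (0 : R[i]) = 0.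
Proof. by rewrite /modulus normr0. Qed.

Lemma modulus1 : modulus (1 : R[i]) = 1.
Proof. by rewrite /modulus normr1. Qed.

Lemma modulus_eq0 z : (modulus z == 0) = (z == 0).
Proof. by rewrite -(inj_eq (@complexI R)) -normcE' normr_eq0. Qed.

Lemma modulus_gt0 z : (0 < modulus z) = (z != 0).
Proof. by rewrite lt0r modulus_eq0 modulus_ge0 andbT. Qed.

Lemma modulusX z n : modulus (z ^+ n) = modulus z ^+ n.
Proof. by apply: complexI; rewrite rmorphXn -!normcE' normrX. Qed.

Lemma modulusV z : modulus z^-1 = (modulus z)^-1.
Proof. by apply: complexI; rewrite fmorphV -!normcE' normfV. Qed.

Lemma modulus_real x : modulus x%:C = `|x|.
Proof. by rewrite modulusE /= expr0n addr0 sqrtr_sqr. Qed.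

Lemma modulus_le_dist z w : modulus z <= modulus w + modulus (z - w).
Proof. by rewrite -{1}(subrK w z) addrC modulusD. Qed.

Lemma modulus_lip z w : `|modulus z - modulus w| <= modulus (z - w).
Proof.
have := modulus_le_dist z w; have := modulus_le_dist w z; rewrite (modulusB w z).
by rewrite ler_norml => ? ?; apply/andP; split; lra.
Qed.

Lemma Re_le_modulus z : `|complex.Re z| <= modulus z.
Proof. by rewrite modulusE -sqrtr_sqr ler_wsqrtr// lerDl sqr_ge0. Qed.

Lemma Im_le_modulus z : `|complex.Im z| <= modulus z.
Proof. by rewrite modulusE -sqrtr_sqr ler_wsqrtr// lerDr sqr_ge0. Qed.

Lemma modulus_le_sum x y : modulus (x +i* y) <= `|x| + `|y|.
Proof.
rewrite modulusE /= -(@ger0_norm _ (`|x| + `|y|)) ?addr_ge0// -sqrtr_sqr ler_wsqrtr//.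
by rewrite sqrrD !real_normK ?num_real// lerD2r lerDl mulrn_wge0// mulr_ge0.
Qed.

Lemma modulus_cis t : modulus (cis t) = 1.
Proof. by rewrite modulusE /= cos2Dsin2 sqrtr1. Qed.

Lemma modulus_sqr z : modulus z ^+ 2 = complex.Re z ^+ 2 + complex.Im z ^+ 2.
Proof. by rewrite modulusE sqr_sqrtr// addr_ge0// sqr_ge0. Qed.

Lemma modulus_conj z : modulus (z^*) = modulus z.
Proof. by rewrite /modulus normcJ. Qed.

Lemma cisD s t : cis (s + t) = cis s * cis t.
Proof. by apply/eqP; rewrite eq_complex/= sinD cosD eqxx/=; apply/eqP; ring. Qed.

Lemma cis0 : cis 0 = 1 :> R[i].
Proof. by rewrite /cis cos0 sin0. Qed.

Lemma cisX t n : cis t ^+ n = cis (n%:R * t).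
Proof.
elim: n => [|n ih]; first by rewrite expr0 mul0r cis0.
by rewrite exprS ih -cisD -natr1 mulrDl mul1r addrC.
Qed.

Lemma cis_neq0 t : cis t != 0 :> R[i].
Proof. by rewrite -modulus_gt0 modulus_cis. Qed.

Lemma cis_conj t : (cis t)^* = cis (- t).
Proof. by rewrite /cis cosN sinN. Qed.

Lemma nbhs_plane c (A : set R[i]^o) :
  nbhs (c : R[i]^o) A <-> exists2 e : R, 0 < e & forall z, modulus (z - c) < e -> A z.
Proof.
split=> [/nbhs_ballP[e /= e0 eA]|[e e0 eA]].
  have ee : e = (complex.Re e)%:C.
    by rewrite RRe_real// gtr0_real.
  exists (complex.Re e); first by move: e0; rewrite ltcE => /andP[].
  move=> z ze; apply: eA; rewrite /ball/= ee.
  by rewrite distrC normcE' ltcR.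
apply/nbhs_ballP; exists e%:C; first by rewrite /= ltcR.
by move=> z; rewrite /ball/= distrC normcE' ltcR; exact: eA.
Qed.

Lemma continuous_plane (u : R[i]^o -> R) c :
  {for c, continuous u} <->
  forall e, 0 < e -> exists2 d, 0 < d & forall z, modulus (z - c) < d -> `|u z - u c| < e.
Proof.
have FF : Filter (nbhs (c : R[i]^o)) by exact: nbhs_filter.
split=> [/(@cvgrPdist_lt _ _ _ (nbhs (c : R[i]^o)) FF) uc e e0|uc].
  by have /nbhs_plane[d d0 dA] := uc _ e0; exists d => // z /dA; rewrite distrC.
apply/(@cvgrPdist_lt _ _ _ (nbhs (c : R[i]^o)) FF) => e /uc[d d0 dA]; apply/nbhs_plane; exists d => // z /dA.
by rewrite distrC.
Qed.

Lemma continuous_modulus : continuous (@modulus R : R[i]^o -> R).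
Proof.
move=> c; apply/continuous_plane => e e0; exists e => // z; apply: le_lt_trans.
exact: modulus_lip.
Qed.

Lemma continuous_Re : continuous (@complex.Re R : R[i]^o -> R).
Proof.
move=> c; apply/continuous_plane => e e0; exists e => // z; apply: le_lt_trans.
by rewrite -raddfB; exact: Re_le_modulus.
Qed.

Lemma continuous_Im : continuous (@complex.Im R : R[i]^o -> R).
Proof.
move=> c; apply/continuous_plane => e e0; exists e => // z; apply: le_lt_trans.
by rewrite -raddfB; exact: Im_le_modulus.
Qed.

Lemma continuous_Complex (T : topologicalType) (f g : T -> R) (a : T) :
  {for a, continuous f} -> {for a, continuous g} ->
  {for a, continuous (fun p : T => f p +i* g p : R[i]^o)}.
Proof.
move=> /cvgrPdist_lt fa /cvgrPdist_lt ga A /nbhs_plane[e e0 eA].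
have e20 : 0 < e / 2 by rewrite divr_gt0.
change (\forall p \near a, A (f p +i* g p)); near=> p; apply: eA.
have -> : (f p +i* g p) - (f a +i* g a) = (f p - f a) +i* (g p - g a) by [].
apply: le_lt_trans (modulus_le_sum _ _) _; rewrite (splitr e) ltrD//.
  by rewrite distrC; near: p; exact: fa.
by rewrite distrC; near: p; exact: ga.
Unshelve. all: by end_near. Qed.

Lemma circleE c r t :
  c + r%:C * cis t = (complex.Re c + r * cos t) +i* (complex.Im c + r * sin t).
Proof. by case: c => a b; rewrite /cis; simpc. Qed.

Lemma continuous_circle c r : continuous (fun t => c + r%:C * cis t : R[i]^o).
Proof.
move=> t; pose f t := complex.Re c + r * cos t; pose g t := complex.Im c + r * sin t.
have -> : (fun t => c + r%:C * cis t : R[i]^o) = (fun t => f t +i* g t).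
  by apply/funext => s; exact: circleE.
apply: continuous_Complex.
  by apply: cvgD; [exact: cvg_cst|apply: cvgM; [exact: cvg_cst|]; exact: continuous_cos].
by apply: cvgD; [exact: cvg_cst|apply: cvgM; [exact: cvg_cst|]; exact: continuous_sin].
Qed.

End Plane.

(** * Neighbourhoods, compactness and continuity on the Riemann sphere *)

Section SphereTopology.
Context (R : realType).
Implicit Types (z w c : R[i]) (x y r s t e : R).

Definition cdisk c r : set R[i]^o := [set z | modulus (z - c) <= r].

Lemma closed_modulus_le c r : closed (cdisk c r).
Proof.
have -> : cdisk c r = (fun z : R[i]^o => modulus (z - c)) @^-1` [set x | x <= r] by [].
apply: closed_comp; last exact: closed_le.
move=> z _; apply/continuous_plane => e e0; exists e => // w; apply: le_lt_trans.
by rewrite (le_trans (modulus_lip _ _))// opprB addrA subrK.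
Qed.

Lemma compact_cdisk c r : compact (cdisk c r).
Proof.
pose B := `[complex.Re c - r, complex.Re c + r]%classic `*`
          `[complex.Im c - r, complex.Im c + r]%classic.
have cB : compact B by apply: compact_setX; exact: segment_compact.
pose f (p : R * R) : R[i]^o := p.1 +i* p.2.
have cf : compact (f @` B).
  apply: continuous_compact => //; apply: continuous_subspaceT => p.
  by apply: continuous_Complex; [exact: cvg_fst|exact: cvg_snd].
apply: subclosed_compact cf _; first exact: closed_modulus_le.
move=> z zr; exists (complex.Re z, complex.Im z); last by case: z zr.
have := Re_le_modulus (z - c); have := Im_le_modulus (z - c); rewrite !raddfB /=.
rewrite /cdisk /= in zr; rewrite !ler_norml => /andP[? ?] /andP[? ?].
by split; rewrite /= in_itv /=; apply/andP; split; lra.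
Qed.

Lemma hausdorff_plane : hausdorff_space (R[i]^o).
Proof. exact: norm_hausdorff. Qed.

Lemma compact_plane_bounded (A : set R[i]^o) :
  compact A -> exists2 X, 0 < X & forall z, A z -> modulus z <= X.
Proof.
move=> cA; have [A0|/eqP/set0P A0] := pselect (A = set0).
  by exists 1 => // z; rewrite A0.
have [|c _ cM] := compact_EVT_max (f := @modulus R : R[i]^o -> R) A0 cA.
  exact/continuous_subspaceT/continuous_modulus.
exists (modulus c + 1); first by rewrite ltr_wpDl// modulus_ge0.
move=> z Az; rewrite (le_trans (cM z _)) ?inE// lerDl//.
Qed.

Lemma nbhs_fin c (A : set (sphere R)) :
  nbhs (fin_pt c) A <-> exists2 e, 0 < e & forall z, modulus (z - c) < e -> A (fin_pt z).
Proof. exact: (nbhs_plane c (@fin_pt R @^-1` A)). Qed.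

Lemma nbhs_infty (A : set (sphere R)) :
  nbhs (None : sphere R) A <->
  A None /\ exists2 X, 0 < X & forall z, X < modulus z -> A (fin_pt z).
Proof.
split=> [[K [cK _] KA]|[AN [X X0 XA]]].
  split; first by apply: KA; right.
  have [X X0 KX] := compact_plane_bounded cK; exists X => // z zX.
  by apply: KA; left; exists z => //= /KX; rewrite leNgt zX.
exists (cdisk 0 X); first by split; [exact: compact_cdisk|exact: closed_modulus_le].
move=> _ [[z + <-]|->] //; rewrite /cdisk /= subr0 => /negP; rewrite -ltNge; exact: XA.
Qed.

Lemma locally_compact_plane : locally_compact [set: R[i]^o].
Proof.
move=> c _; rewrite withinET; exists (cdisk c 1).
  by apply/nbhs_plane; exists 1 => // z /ltW.
by split; [exact: compact_cdisk|exact: closed_modulus_le].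
Qed.

Lemma hausdorff_sphere : hausdorff_space (sphere R).
Proof.
apply: one_point_compactification_hausdorff; first exact: locally_compact_plane.
exact: hausdorff_plane.
Qed.

Lemma sphere_compact_closed (K : set (sphere R)) : compact K -> closed K.
Proof. by apply: compact_closed; exact: hausdorff_sphere. Qed.

Lemma continuous_fin (v : sphere R -> R) c :
  {for fin_pt c, continuous v} <-> {for (c : R[i]^o), continuous (v \o @fin_pt R : R[i]^o -> R)}.
Proof. by []. Qed.

Lemma continuous_fin_pt : continuous (@fin_pt R : R[i]^o -> sphere R).
Proof. by move=> z A. Qed.

Lemma compact_fin (K : set R[i]^o) : compact K -> compact (@fin_pt R @` K).
Proof.
move=> cK; apply: continuous_compact => //; apply: continuous_subspaceT.
exact: continuous_fin_pt.
Qed.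

Lemma continuous_infty (v : sphere R -> R) :
  {for (None : sphere R), continuous v} <->
  forall e, 0 < e -> exists2 X, 0 < X & forall z, X < modulus z -> `|v (fin_pt z) - v None| < e.
Proof.
have FF : Filter (nbhs (None : sphere R)) by exact: nbhs_filter.
split=> [/(@cvgrPdist_lt _ _ _ (nbhs (None : sphere R)) FF) vc e /vc|vc].
  by move=> /nbhs_infty[_ [X X0 XA]]; exists X => // z /XA; rewrite distrC.
apply/(@cvgrPdist_lt _ _ _ (nbhs (None : sphere R)) FF) => e e0.
apply/nbhs_infty; split; first by rewrite subrr normr0.
by have [X X0 XA] := vc _ e0; exists X => // z /XA; rewrite distrC.
Qed.

Lemma EVT_compact (T : topologicalType) (K : set T) (f : T -> R) :
  K !=set0 -> compact K -> (forall p, K p -> {for p, continuous f}) ->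
  exists2 p, K p & forall q, K q -> f q <= f p.
Proof.
move=> K0 cK fK; have [|p Kp pM] := compact_EVT_max (f := f) K0 cK.
  by apply: continuous_in_subspaceT => q; rewrite inE; exact: fK.
by exists p; [rewrite -inE|move=> q Kq; apply: pM; rewrite inE].
Qed.

(** Only [z] is confined to [K]: the point [w] may leave it, since [u] is continuous in the plane at
    the points of [K]. The radius comes from the near-covering form of compactness. *)
Lemma uniform_continuity_compact (K : set R[i]^o) (u : R[i]^o -> R) e :
  compact K -> (forall z, K z -> {for z, continuous u}) -> 0 < e ->
  exists2 d, 0 < d & forall z w, K z -> modulus (w - z) < d -> `|u w - u z| < e.
Proof.
move=> cK uK e0.
have e20 : 0 < e / 2 by rewrite divr_gt0.
pose P d (z : R[i]^o) := forall w, modulus (w - z) < d -> `|u w - u z| < e.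
have H : forall z : R[i]^o, K z -> \forall z' \near z & d \near (0 : R)^'+, P d z'.
  move=> z /uK /continuous_plane/(_ _ e20)[d d0 dA].
  have d20 : 0 < d / 2 by rewrite divr_gt0.
  exists (cdisk z (d/2), [set d' | d' < d / 2]).
    split=> /=; first by apply/nbhs_plane; exists (d/2) => // w /ltW.
    exact: nbhs_right_lt.
  move=> [z' d'] /= [zz' d'd] w wz'.
  rewrite /cdisk /= in zz'.
  rewrite (_ : u w - u z' = (u w - u z) - (u z' - u z)); last ring.
  apply: le_lt_trans (ler_normB _ _) _; rewrite (splitr e) ltrD//; apply: dA; last lra.
  have := modulusD (w - z') (z' - z); rewrite addrA subrK; lra.
have FF : Filter ((0:R)^'+) by exact: at_right_proper_filter.
move/compact_near_coveringP/(_ _ _ P FF H) : cK => HK.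
have [d [/= d0 dP]] := @filter_ex _ _ (at_right_proper_filter (0 : R))
  _ (filterI (nbhs_right_gt (0 : R)) HK).
by exists d => // z w Kz; exact: dP.
Qed.

End SphereTopology.

(** * Pointwise continuity of algebraic combinations *)

Section PointwiseContinuity.
Context (R : realType) (T : topologicalType) (a : T).
Implicit Types (f g : T -> R).

Lemma cont_cst (x : R) : {for a, continuous (fun _ : T => x)}.
Proof. exact: cvg_cst. Qed.

Lemma contD f g : {for a, continuous f} -> {for a, continuous g} ->
  {for a, continuous (fun p => f p + g p)}.
Proof. by move=> cf cg; apply: cvgD; [exact: cf|exact: cg]. Qed.

Lemma contN f : {for a, continuous f} -> {for a, continuous (fun p => - f p)}.
Proof. by move=> cf; apply: cvgN; exact: cf. Qed.

Lemma contB f g : {for a, continuous f} -> {for a, continuous g} ->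
  {for a, continuous (fun p => f p - g p)}.
Proof. by move=> cf cg; apply: cvgB; [exact: cf|exact: cg]. Qed.

Lemma contM f g : {for a, continuous f} -> {for a, continuous g} ->
  {for a, continuous (fun p => f p * g p)}.
Proof. by move=> cf cg; apply: cvgM; [exact: cf|exact: cg]. Qed.

Lemma contV f : f a != 0 -> {for a, continuous f} ->
  {for a, continuous (fun p => (f p)^-1)}.
Proof. by move=> f0 cf; apply: cvgV => //; exact: cf. Qed.

Lemma cont_comp (h : R -> R) f : {for f a, continuous h} -> {for a, continuous f} ->
  {for a, continuous (fun p => h (f p))}.
Proof. by move=> ch cf; exact: (@continuous_comp _ _ _ f h). Qed.

Lemma cont_max f g : {for a, continuous f} -> {for a, continuous g} ->
  {for a, continuous (fun p => Num.max (f p) (g p))}.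
Proof.
move=> cf cg.
have -> : (fun p => Num.max (f p) (g p)) = (fun p => (f p + g p + `|f p - g p|) / 2).
  by apply/funext => p; rewrite maxr_absE.
apply: contM; last exact: cont_cst.
apply: contD; first exact: contD.
apply: (cont_comp (h := fun x : R => `|x|)); last exact: contB.
exact: norm_continuous.
Qed.

Lemma cont_ln f : 0 < f a -> {for a, continuous f} ->
  {for a, continuous (fun p => ln (f p))}.
Proof. by move=> f0; apply: cont_comp; exact: continuous_ln. Qed.

Lemma cont_sum (I : Type) (s : seq I) (F : I -> T -> R) :
  (forall i, {for a, continuous (F i)}) ->
  {for a, continuous (fun p => \sum_(i <- s) F i p)}.
Proof.
move=> cF; elim: s => [|i s ih].
  have -> : (fun p => \sum_(j <- [::]) F j p) = fun=> 0 by apply/funext => p; rewrite big_nil.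
  exact: cont_cst.
have -> : (fun p => \sum_(j <- i :: s) F j p) = fun p => F i p + \sum_(j <- s) F j p.
  by apply/funext => p; rewrite big_cons.
exact: contD.
Qed.

Lemma cont_near f g : (\forall p \near a, f p = g p) ->
  {for a, continuous f} -> {for a, continuous g}.
Proof.
move=> fg cf; have fga : f a = g a := nbhs_singleton fg.
change (g x @[x --> a] --> g a); rewrite -fga; apply: cvg_trans cf.
exact: near_eq_cvg.
Qed.

End PointwiseContinuity.

(** * Integrals of continuous functions over segments *)

Section SegmentIntegral.
Context (R : realType).
Implicit Types (a b x y r s t e : R) (f g F : R -> R).

Local Notation mu := lebesgue_measure.

Lemma integrable_continuous a b f :
  continuous f -> mu.-integrable `[a, b] (EFin \o f).
Proof.
move=> cf; apply: continuous_compact_integrable; first exact: segment_compact.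
exact: continuous_subspaceT.
Qed.

Lemma integral_is_derive a b f F : a < b -> continuous f ->
  (forall x, a <= x -> x <= b -> is_derive x 1 F (f x)) ->
  \int[mu]_(t in `[a, b]) f t = F b - F a.
Proof.
move=> ab cf dF.
have cF x : a <= x -> x <= b -> {for x, continuous F}.
  by move=> ax xb; apply/differentiable_continuous/derivable1_diffP; have := dF x ax xb => -[].
have /= H := @continuous_FTC2 R f F a b ab (continuous_subspaceT cf).
rewrite /Rintegral [X in fine X]H //.
  split.
  - move=> x; rewrite in_itv /= => /andP[ax xb].
    by have [] := dF x (ltW ax) (ltW xb).
  - by apply: cvg_at_right_filter; apply: cF => //; exact: ltW.
  - by apply: cvg_at_left_filter; apply: cF => //; exact: ltW.
move=> x; rewrite in_itv /= => /andP[ax xb].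
by rewrite derive1E; have dx := dF x (ltW ax) (ltW xb); rewrite derive_val.
Qed.

Lemma has_primitive a f : continuous f ->
  exists F, forall x, a < x -> is_derive x 1 F (f x).
Proof.
move=> cf; exists (fun x => \int[mu]_(t in `[a, x]) f t) => x ax.
have xx1 : x < x + 1 by rewrite ltrDl.
have [d1 d2] := continuous_FTC1_closed xx1 (integrable_continuous a (x + 1) cf) ax (cf x).
by split; [exact: d1|rewrite -d2 derive1E].
Qed.

Lemma is_derive_comp_affine F x s y (d : R) :
  is_derive (s * x + y) 1 F d -> is_derive x 1 (fun t => F (s * t + y)) (s * d).
Proof.
move=> dF.
have dg : is_derive x 1 (fun t => s * t + y) s.
  rewrite -[X in is_derive _ _ _ X]addr0; apply: is_deriveD => /=.
  rewrite -[X in is_derive _ _ _ X]mulr1.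
  exact: (is_deriveZ s (is_derive_id x 1)).
rewrite [X in is_derive _ _ _ X]mulrC.
exact: (@is_derive1_comp R F (fun t => s * t + y) x d s dF dg).
Qed.

(** Both sides are increments of primitives: if [F] has derivative [f], then [s^-1 * F (s * t + y)]
    has derivative [f (s * t + y)]. *)
Lemma integral_affine a b s y f : a < b -> 0 < s -> continuous f ->
  \int[mu]_(t in `[a, b]) f (s * t + y) =
  s^-1 * \int[mu]_(t in `[s * a + y, s * b + y]) f t.
Proof.
move=> ab s0 cf.
(* The primitive starts one unit to the left, so that it is differentiable at the left endpoint as
   well. *)
have [F dF] := has_primitive (s * a + y - 1) cf.
have lt_ab : s * a + y < s * b + y by rewrite ltrD2r ltr_pM2l.
have H1 x : s * a + y <= x -> x <= s * b + y -> is_derive x 1 F (f x).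
  by move=> ax _; apply: dF; lra.
rewrite (integral_is_derive lt_ab cf H1).
have cf' : continuous (fun t => f (s * t + y)).
  move=> t; apply: (@continuous_comp _ _ _ (fun t => s * t + y) f); last exact: cf.
  by apply: cvgD; [apply: cvgM; [exact: cvg_cst|exact: cvg_id]|exact: cvg_cst].
suff H2 x : a <= x -> x <= b ->
    is_derive x 1 (fun t => s^-1 * F (s * t + y)) (f (s * x + y)).
  by rewrite (integral_is_derive ab cf' H2) mulrBr.
move=> ax xb.
have H : is_derive (s * x + y) 1 F (f (s * x + y)).
  have sax : s * a <= s * x by rewrite ler_pM2l.
  apply: dF; lra.
have := is_deriveZ s^-1 (is_derive_comp_affine H).
by rewrite /GRing.scale /= mulrA mulVf ?gt_eqF// mul1r.
Qed.

Lemma integral_split a b c f : a <= b -> b <= c -> continuous f ->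
  \int[mu]_(t in `[a, c]) f t =
  \int[mu]_(t in `[a, b]) f t + \int[mu]_(t in `[b, c]) f t.
Proof.
move=> ab bc cf.
have := @Rintegral_itvB R f (BLeft a) (BRight c) b (integrable_continuous a c cf).
rewrite !bnd_simp => /(_ ab bc).
rewrite Rintegral_itv_obnd_cbnd; last first.
  apply: integrableS (integrable_continuous b c cf) => //.
  by apply: subset_itv; rewrite bnd_simp.
by move=> /eqP; rewrite subr_eq addrC => /eqP.
Qed.

(** The interval [[0, y + p]] is cut once at [p] and once at [y]; the piece from [p] to [y + p] is
    the translate of [[0, y]] by one period. *)
Lemma integral_periodic_shift f y p : 0 <= y -> 0 < p -> continuous f ->
  (forall t, f (t + p) = f t) ->
  \int[mu]_(t in `[y, y + p]) f t = \int[mu]_(t in `[0, p]) f t.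
Proof.
move=> y0 p0 cf per.
have [->|y0'] := eqVneq y 0; first by rewrite add0r.
have yp : 0 < y by rewrite lt0r y0' y0.
have e1 := @integral_split 0 p (y + p) f (ltW p0).
have e2 := @integral_split 0 y (y + p) f y0.
have e3 := @integral_affine 0 y 1 p f yp ltr01 cf.
rewrite mulr0 add0r !mul1r invr1 mul1r in e3.
have e4 : \int[mu]_(t in `[0, y]) f (1 * t + p) = \int[mu]_(t in `[0, y]) f t.
  by apply: eq_Rintegral => t _; rewrite mul1r per.
have := e1 _ cf; have := e2 _ cf.
have -> : y <= y + p by rewrite lerDl ltW.
have -> : p <= y + p by rewrite lerDr.
move=> /(_ isT) H1 /(_ isT) H2; rewrite H1 -e3 e4 in H2; lra.
Qed.

(** If [f t] were positive, continuity would keep [f] above [f t / 2] on a small interval about [t],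
    which would contribute a positive amount. That interval has to fit into [[a, b]], hence the open
    interval in the conclusion. *)
Lemma Rintegral_ge0_eq0 a b f : a < b -> continuous f ->
  (forall t, 0 <= f t) -> \int[mu]_(t in `[a, b]) f t = 0 ->
  forall t, a < t < b -> f t = 0.
Proof.
move=> ab cf f0 If t /andP[at_ tb].
apply/eqP; apply: contraT => ft0.
have ftp : 0 < f t by rewrite lt0r ft0 f0.
have /cvgrPdist_lt/(_ _ (divr_gt0 ftp (ltr0n _ 2)))/nbhs_ballP[d /= d0 dA] := cf t.
pose e := Num.min (d / 2) (Num.min (t - a) (b - t)).
have e0 : 0 < e by rewrite !lt_min divr_gt0//= !subr_gt0 at_.
have ed : e <= d / 2 by rewrite ge_min lexx.
have ea : e <= t - a by rewrite !ge_min lexx orbT.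
have eb : e <= b - t by rewrite !ge_min lexx !orbT.
have h1 : a <= t - e by lra.
have h2 : t - e <= t + e by lra.
have h3 : t + e <= b by lra.
rewrite (integral_split h1 (le_trans h2 h3) cf) (integral_split h2 h3 cf) in If.
have h4 : f t / 2 * (e + e) <= \int[mu]_(t in `[t - e, t + e]) f t.
  have -> : f t / 2 * (e + e) = \int[mu]_(x in `[t - e, t + e]) (f t / 2).
    rewrite Rintegral_cst//= lebesgue_measure_itv /= lte_fin ifT; last lra.
    by rewrite -EFinB /=; congr (_ * _); ring.
  apply: le_Rintegral => //.
  - by apply: integrable_continuous => x; exact: cvg_cst.
  - exact: integrable_continuous.
  move=> x; rewrite /= in_itv /= => /andP[x1 x2].
  have := dA x; rewrite /ball /= => H.
  have : `|t - x| < d by rewrite ltr_norml; apply/andP; split; lra.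
  move=> /H; rewrite ltr_norml => /andP[]; lra.
have h5 : 0 <= \int[mu]_(t in `[a, t - e]) f t by apply: Rintegral_ge0.
have h6 : 0 <= \int[mu]_(t in `[t + e, b]) f t by apply: Rintegral_ge0.
have h7 : 0 < f t / 2 * (e + e) by rewrite mulr_gt0 ?divr_gt0 ?addr_gt0.
move: If h4 h5 h6 h7; clear; lra.
Qed.

End SegmentIntegral.

(** * Circle means and polar coordinates *)

Section CircleMean.
Context (R : realType).
Implicit Types (z w c a : R[i]) (x y r s t e M : R) (u v : R[i]^o -> R).

Local Notation mu := lebesgue_measure.

Definition mean u c r : R :=
  (2 * pi)^-1 * \int[mu]_(t in `[0, 2 * pi]) u (c + r%:C * cis t).

(** Continuity as a function on the plane at each point of the circle, which is stronger than
    continuity along it and passes directly to sums and maxima. *)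
Definition continuous_circle_at u c r :=
  forall z, modulus (z - c) = r -> {for (z : R[i]^o), continuous u}.

Lemma circle_meanE (v : sphere R -> R) c r :
  circle_mean v c r = mean (v \o @fin_pt R) c r.
Proof. by []. Qed.

Lemma twopi_gt0 : 0 < 2 * pi :> R.
Proof. by rewrite mulr_gt0 ?pi_gt0. Qed.

Lemma modulus_circle c r t : 0 <= r -> modulus (c + r%:C * cis t - c) = r.
Proof.
by move=> r0; rewrite addrC addKr modulusM modulus_cis mulr1 modulus_real ger0_norm.
Qed.

Lemma continuous_on_circle u c r : 0 <= r -> continuous_circle_at u c r ->
  continuous (fun t => u (c + r%:C * cis t)).
Proof.
move=> r0 uc t.
apply: (@continuous_comp _ _ _ (fun t => c + r%:C * cis t : R[i]^o) u).
  exact: continuous_circle.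
by apply: uc; exact: modulus_circle.
Qed.

Lemma integrable_circle u c r : 0 <= r -> continuous_circle_at u c r ->
  mu.-integrable `[0, 2 * pi] (EFin \o (fun t => u (c + r%:C * cis t))).
Proof. by move=> r0 uc; apply: integrable_continuous; exact: continuous_on_circle. Qed.

Lemma cis_periodic t : cis (t + 2 * pi) = cis t :> R[i].
Proof. by rewrite /cis mulr_natl cosD2pi sinD2pi. Qed.

Lemma cisDpi t : cis (t + pi) = - cis t :> R[i].
Proof. by rewrite /cis cosDpi sinDpi. Qed.

Lemma eq_mean u v c r : 0 <= r -> (forall z, modulus (z - c) = r -> u z = v z) ->
  mean u c r = mean v c r.
Proof.
move=> r0 uv; congr (_ * _); apply: eq_Rintegral => t _; apply: uv.
exact: modulus_circle.
Qed.

Lemma mean_cst x c r : mean (fun=> x) c r = x.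
Proof.
rewrite /mean Rintegral_cst//= lebesgue_measure_itv /= lte_fin twopi_gt0 -EFinB /=.
by rewrite subr0 mulrCA mulVf ?mulr1// gt_eqF// twopi_gt0.
Qed.

Lemma le_mean u v c r : 0 <= r -> continuous_circle_at u c r ->
  continuous_circle_at v c r -> (forall z, modulus (z - c) = r -> u z <= v z) ->
  mean u c r <= mean v c r.
Proof.
move=> r0 cu cv uv; rewrite ler_pM2l ?invr_gt0 ?twopi_gt0//.
apply: le_Rintegral => //; try exact: integrable_circle.
by move=> t _; apply: uv; exact: modulus_circle.
Qed.

Lemma meanD u v c r : 0 <= r -> continuous_circle_at u c r ->
  continuous_circle_at v c r ->
  mean (fun z => u z + v z) c r = mean u c r + mean v c r.
Proof.
move=> r0 cu cv.
have iu := integrable_circle r0 cu; have iv := integrable_circle r0 cv.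
by rewrite /mean (RintegralD _ iu iv)// mulrDr.
Qed.

Lemma meanZ x u c r : 0 <= r -> continuous_circle_at u c r ->
  mean (fun z => x * u z) c r = x * mean u c r.
Proof.
move=> r0 cu; have iu := integrable_circle r0 cu.
by rewrite /mean (RintegralZl _ _ iu)// mulrCA.
Qed.

Lemma meanB u v c r : 0 <= r -> continuous_circle_at u c r ->
  continuous_circle_at v c r ->
  mean (fun z => u z - v z) c r = mean u c r - mean v c r.
Proof.
move=> r0 cu cv.
have iu := integrable_circle r0 cu; have iv := integrable_circle r0 cv.
by rewrite /mean (RintegralB _ iu iv)// mulrBr.
Qed.

Lemma mean_le_cst u c r M : 0 <= r -> continuous_circle_at u c r ->
  (forall z, modulus (z - c) = r -> u z <= M) -> mean u c r <= M.
Proof.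
move=> r0 cu uM; rewrite -[leRHS](mean_cst M c r); apply: le_mean => //.
by move=> z _; exact: cst_continuous.
Qed.

Lemma cst_le_mean u c r M : 0 <= r -> continuous_circle_at u c r ->
  (forall z, modulus (z - c) = r -> M <= u z) -> M <= mean u c r.
Proof.
move=> r0 cu uM; rewrite -[leLHS](mean_cst M c r); apply: le_mean => //.
by move=> z _; exact: cst_continuous.
Qed.

(** The arccosine of Re z / |z| is an angle in [0, pi] whose sine is |Im z| / |z|; for a negative
    imaginary part the reflected angle 2 pi - acos is taken. *)
Lemma polar z : exists2 t, 0 <= t < 2 * pi & z = (modulus z)%:C * cis t.
Proof.
have [->|z0] := eqVneq z 0.
  by exists 0; rewrite ?lexx ?twopi_gt0// modulus0 mul0r.
have m0 : 0 < modulus z by rewrite modulus_gt0.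
pose x := complex.Re z / modulus z.
have x1 : -1 <= x <= 1.
  by rewrite -ler_norml normrM normfV (gtr0_norm m0) ler_pdivrMr// mul1r Re_le_modulus.
have c1 : cos (acos x) = x by rewrite acosK// in_itv.
have s1 : sin (acos x) = `|complex.Im z| / modulus z.
  rewrite sin_acos//; have -> : 1 - x ^+ 2 = (complex.Im z / modulus z) ^+ 2.
    have := modulus_sqr z => H.
    have mm : modulus z ^+ 2 != 0 by rewrite expf_neq0// gt_eqF.
    rewrite /x !expr_div_n; apply: (mulIf mm).
    by rewrite mulrBl mul1r !divfK// H addrC addKr.
  by rewrite sqrtr_sqr normrM normfV (gtr0_norm m0).
have zE (u v : R) : u = complex.Re z / modulus z -> v = complex.Im z / modulus z ->
    z = (modulus z)%:C * (u +i* v).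
  move=> -> ->; apply/eqP; rewrite eq_complex /=; simpc.
  by apply/andP; split; apply/eqP; field; rewrite gt_eqF.
have a0 := acos_ge0 x1; have api := acos_lepi x1; have p0 := pi_gt0 R.
have [im0|im0] := leP 0 (complex.Im z).
  exists (acos x); first by apply/andP; split => //; lra.
  by apply: zE => //; rewrite s1 ger0_norm.
have a0' : 0 < acos x.
  rewrite lt0r a0 andbT; apply/eqP => a00.
  move: s1; rewrite a00 sin0 => /eqP; rewrite eq_sym mulf_eq0 invr_eq0 (gt_eqF m0) orbF.
  by rewrite normr_eq0 lt_eqF.
exists (2 * pi - acos x); first by apply/andP; split; lra.
apply: zE; rewrite addrC mulr_natl.
  by rewrite cosD2pi cosN.
by rewrite sinD2pi sinN s1 ltr0_norm// mulNr opprK.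
Qed.

Lemma continuous_circleB u v c r : continuous_circle_at u c r ->
  continuous_circle_at v c r -> continuous_circle_at (fun z => u z - v z) c r.
Proof. by move=> cu cv z zc; apply: contB; [exact: cu|exact: cv]. Qed.

(** [M - u] is nonnegative on the circle with zero mean, hence vanishes along the parametrised
    circle. *)
Lemma mean_eq_max u c r M : 0 <= r -> continuous_circle_at u c r ->
  (forall z, modulus (z - c) = r -> u z <= M) -> M <= mean u c r ->
  forall z, modulus (z - c) = r -> u z = M.
Proof.
move=> r0 cu uM Mu z zc.
have cM : continuous_circle_at (fun=> M) c r by move=> ? _; exact: cst_continuous.
have cMu := continuous_circleB cM cu.
have c2 := continuous_on_circle r0 cMu.
have m0 : mean (fun z => M - u z) c r = 0.
  apply/eqP; rewrite eq_le; apply/andP; split.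
    by rewrite meanB// mean_cst subr_le0.
  by apply: cst_le_mean => // w /uM; rewrite subr_ge0.
have I0 : \int[mu]_(t in `[0, 2 * pi]) (M - u (c + r%:C * cis t)) = 0.
  by move/eqP: m0; rewrite mulf_eq0 invr_eq0 gt_eqF ?twopi_gt0//= => /eqP.
have H := Rintegral_ge0_eq0 twopi_gt0 c2 _ I0.
have {}H t : 0 < t < 2 * pi -> M - u (c + r%:C * cis t) = 0.
  by apply: H => s; rewrite subr_ge0 uM// modulus_circle.
have [t /andP[t0 t2] zt] := polar (z - c).
rewrite zc in zt.
have -> : z = c + r%:C * cis t by rewrite -zt addrC subrK.
move: t0; rewrite le_eqVlt => /orP[/eqP<-|t0]; last first.
  by apply/eqP; rewrite eq_sym -subr_eq0 H// t0.
(* The endpoint [t = 0] of the parameter interval is reached by continuity from small positive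
   [s]. *)
apply/eqP; rewrite eq_sym -subr_eq0 -[_ == 0]negbK -normr_gt0 -leNgt.
apply/ler_addgt0Pr => e e0; rewrite add0r.
have /cvgrPdist_lt/(_ _ e0)/nbhs_ballP[d /= d0 dA] := c2 0.
pose s := Num.min (d / 2) 1.
have s0 : 0 < s by rewrite lt_min divr_gt0//= ltr01.
have s1 : s <= d / 2 by rewrite ge_min lexx.
have s2 : s <= 1 by rewrite ge_min lexx orbT.
have pi2 : 2 <= pi :> R := pi_ge2 R.
have := dA s; rewrite /ball /= (H s); last by apply/andP; split => //; lra.
rewrite subr0 sub0r normrN gtr0_norm// => /(_ _)/ltW; apply.
apply: le_lt_trans s1 _; lra.
Qed.

End CircleMean.

(** * The mean value property of the logarithm and of the Cauchy kernel *)

Section MeanValue.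
Context (R : realType).
Implicit Types (z w v c a : R[i]) (x y r s t e M : R) (f : R[i]^o -> R).

Local Notation mu := lebesgue_measure.

Lemma continuous_rotation w : continuous (fun t => w * cis t : R[i]^o).
Proof.
case: w => p q t.
have -> : (fun t => (p +i* q) * cis t : R[i]^o) =
    (fun t => (p * cos t - q * sin t) +i* (p * sin t + q * cos t)).
  by apply/funext => s; rewrite /cis; simpc.
apply: (@continuous_Complex R R^o (fun t => p * cos t - q * sin t)
  (fun t => p * sin t + q * cos t) t); [apply: contB|apply: contD]; apply: contM;
  (try exact: cont_cst); (try exact: continuous_cos); exact: continuous_sin.
Qed.

(* Averaging the functional equation over the circle gives 2 K(w) = lam K(w^2)
   for the integral K(w), whence |K(w)| <= |K(w^(2^m))| for all m. *)
Lemma integral_doubling f lam C :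
  (forall z, modulus z < 1 -> {for (z : R[i]^o), continuous f}) ->
  (forall z, modulus z < 1 -> f z + f (- z) = lam * f (z ^+ 2)) ->
  0 <= lam <= 2 ->
  (forall z, modulus z <= 1 / 2 -> `|f z| <= C * modulus z) ->
  forall w, modulus w < 1 -> \int[mu]_(t in `[0, 2 * pi]) f (w * cis t) = 0.
Proof.
move=> cf fE /andP[lam0 lam2] fC w w1.
pose K w := \int[mu]_(t in `[0, 2 * pi]) f (w * cis t).
have p0 := pi_gt0 R; have pp0 := twopi_gt0 R.
have cphi v : modulus v < 1 -> continuous (fun t => f (v * cis t)).
  move=> v1 t; apply: (@continuous_comp _ _ _ (fun t => v * cis t : R[i]^o) f).
    exact: continuous_rotation.
  by apply: cf; rewrite modulusM modulus_cis mulr1.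
have per v t : f (v * cis (t + 2 * pi)) = f (v * cis t) by rewrite cis_periodic.
have KN v : modulus v < 1 -> K (- v) = K v.
  move=> v1; rewrite /K -[RHS](integral_periodic_shift (ltW p0) pp0 (cphi _ v1) (per v)).
  have := integral_affine pi pp0 ltr01 (cphi _ v1).
  rewrite mulr0 add0r !mul1r invr1 mul1r [2 * pi + pi]addrC => <-.
  by apply: eq_Rintegral => t _; rewrite mul1r cisDpi mulrN mulNr.
have KE v : modulus v < 1 -> 2 * K v = lam * K (v ^+ 2).
  move=> v1.
  have v21 : modulus (v ^+ 2) < 1 by rewrite modulusX expr_lt1// modulus_ge0.
  have i1 := integrable_continuous 0 (2 * pi) (cphi _ v1).
  have vN1 : modulus (- v) < 1 by rewrite modulusN.
  have i2 := integrable_continuous 0 (2 * pi) (cphi _ vN1).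
  have i3 := integrable_continuous 0 (2 * pi) (cphi _ v21).
  rewrite mulr_natl mulr2n -{2}(KN v v1) /K -(RintegralD _ i1 i2)//.
  have c2 : continuous (fun t => f (v ^+ 2 * cis (2 * t + 0))).
    move=> t; apply: (@cont_comp _ _ _ (fun s => f (v ^+ 2 * cis s)) (fun t => 2 * t + 0)).
      exact: cphi.
    by apply: contD; [apply: contM; [exact: cont_cst|exact: cvg_id]|exact: cont_cst].
  have -> : \int[mu]_(t in `[0, 2 * pi]) (f (v * cis t) + f (- v * cis t)) =
     \int[mu]_(t in `[0, 2 * pi]) (lam * f (v ^+ 2 * cis (2 * t + 0))).
    apply: eq_Rintegral => t _; rewrite mulNr fE; last by rewrite modulusM modulus_cis mulr1.
    by rewrite exprMn cisX addr0.
  rewrite (RintegralZl _ _ (integrable_continuous 0 (2 * pi) c2))//; congr (_ * _).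
  have -> := integral_affine 0 pp0 (ltr0n R 2) (cphi _ v21).
  have -> : 2 * 0 + 0 = 0 :> R by rewrite mulr0 addr0.
  have h1 : 2 * pi <= 2 * (2 * pi) + 0 :> R by lra.
  rewrite (integral_split (ltW pp0) h1 (cphi _ v21)).
  have -> : 2 * (2 * pi) + 0 = 2 * pi + 2 * pi :> R by ring.
  rewrite (integral_periodic_shift (ltW pp0) pp0 (cphi _ v21) (per _)).
  rewrite -/(K (v ^+ 2)); lra.
have Kle v : modulus v < 1 -> `|K v| <= `|K (v ^+ 2)|.
  move=> v1; have := KE v v1 => /(congr1 Num.norm); rewrite !normrM ger0_norm// (ger0_norm lam0).
  move=> H; rewrite -(ler_pM2l (ltr0n R 2)) H ler_wpM2r//.
have Kle2 m : `|K w| <= `|K (w ^+ (2 ^ m))|.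
  elim: m => [|m ih]; first by rewrite expr1.
  apply: le_trans ih _; rewrite expnSr exprM; apply: Kle.
  by rewrite modulusX exprn_ilt1 ?modulus_ge0// gtn_eqF// expn_gt0.
have KC v : modulus v <= 1 / 2 -> `|K v| <= C * modulus v * (2 * pi).
  move=> v2; have v1 : modulus v < 1 by lra.
  have cn : continuous (fun t => `|f (v * cis t)|).
    move=> t; apply: (@cont_comp _ _ _ (fun x : R => `|x|) (fun t => f (v * cis t))).
      exact: norm_continuous.
    exact: cphi.
  apply: le_trans (le_normr_Rintegral _ (integrable_continuous 0 (2 * pi) (cphi _ v1))) _ => //.
  have -> : C * modulus v * (2 * pi) = \int[mu]_(t in `[0, 2 * pi]) (C * modulus v).
    by rewrite Rintegral_cst//= lebesgue_measure_itv /= lte_fin pp0 -EFinB /= subr0.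
  apply: le_Rintegral => //; try apply: integrable_continuous => //.
    by move=> t; exact: cont_cst.
  by move=> t _; have := fC (v * cis t); rewrite modulusM modulus_cis mulr1; apply.
apply/eqP; rewrite -normr_le0; apply/ler_addgt0Pr => e e0; rewrite add0r.
have /cvgrPdist_lt H : (modulus w) ^+ n @[n --> \oo] --> (0 : R).
  by apply: cvg_expr; rewrite ger0_norm ?modulus_ge0.
(* The powers [w ^+ (2 ^ m)] tend to 0, where the hypothesis on [f] makes [K v] of order |v|; below
   [d] that estimate applies and is at most [e]. *)
pose d := Num.min (1 / 2) (e / ((`|C| + 1) * (2 * pi))).
have d0 : 0 < d by rewrite lt_min divr_gt0//= divr_gt0// mulr_gt0// ltr_wpDl.
have [N _ HN] := H _ d0.
have := HN N (leqnn N); rewrite /= sub0r normrN ger0_norm ?exprn_ge0 ?modulus_ge0// => wN.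
have w2N : modulus (w ^+ (2 ^ N)) <= modulus w ^+ N.
  by rewrite modulusX; apply: ler_wiXn2l; rewrite ?modulus_ge0 ?(ltW w1)// ltnW// ltn_expl.
apply: le_trans (Kle2 N) _; apply: le_trans (KC _ _) _.
  apply: le_trans w2N _; apply: le_trans (ltW wN) _; by rewrite ge_min lexx.
have h : modulus (w ^+ (2 ^ N)) <= e / ((`|C| + 1) * (2 * pi)).
  by apply: le_trans w2N _; apply: le_trans (ltW wN) _; rewrite ge_min lexx orbT.
rewrite ler_pdivlMr in h; last by rewrite mulr_gt0// ltr_wpDl.
apply: le_trans h; rewrite (mulrC C) -mulrA ler_wpM2l ?modulus_ge0// ler_pM2r//.
have := ler_norm C; lra.
Qed.

(** The upper bound is ln (1 + x) <= x. For the lower bound the same inequality is applied to the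
    inverse, and 1 / (1 - s) - 1 <= 2 s for 0 <= s <= 1/2, whence the factor 2. *)
Lemma ln_modulus_bound z : modulus z <= 1 / 2 -> `|ln (modulus (1 - z))| <= 2 * modulus z.
Proof.
move=> z2; have z0 := modulus_ge0 z.
have h1 : modulus (1 - z) <= 1 + modulus z.
  by have := modulusD 1 (- z); rewrite modulus1 modulusN.
have h2 : 1 - modulus z <= modulus (1 - z).
  by have := modulus_le_dist 1 z; rewrite modulus1; lra.
have p : 0 < modulus (1 - z) by lra.
have addK1 y : 1 + (y - 1) = y by ring.
rewrite ler_norml; apply/andP; split; last first.
  by have := le_ln1Dx (x := modulus (1 - z) - 1); rewrite addK1; lra.
rewrite -[ln _]opprK lerN2 -lnV//.
have q : 0 < (modulus (1 - z))^-1 by rewrite invr_gt0.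
have := le_ln1Dx (x := (modulus (1 - z))^-1 - 1); rewrite addK1 => H.
apply: le_trans (H _) _; first lra.
rewrite lerBlDr -[leLHS]mul1r ler_pdivrMr//.
apply: (@le_trans _ _ ((2 * modulus z + 1) * (1 - modulus z))); last by apply: ler_wpM2l; lra.
have : 0 <= modulus z * (1 - 2 * modulus z) by rewrite mulr_ge0//; lra.
lra.
Qed.

(** Since (1 - z)(1 + z) = 1 - z^2, the function ln |1 - z| satisfies the doubling equation with
    [lam = 1]. *)
Lemma integral_ln_modulus w : modulus w < 1 ->
  \int[mu]_(t in `[0, 2 * pi]) ln (modulus (1 - w * cis t)) = 0.
Proof.
have pos z : modulus z < 1 -> 0 < modulus (1 - z).
  by move=> z1; have := modulus_le_dist 1 z; rewrite modulus1; lra.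
apply: (@integral_doubling (fun z => ln (modulus (1 - z))) 1 2).
- move=> z z1; apply: cont_ln; first exact: pos.
  apply/continuous_plane => e e0; exists e => // z' z'z.
  by rewrite (le_lt_trans (modulus_lip _ _))// opprB addrC addrA subrK modulusB.
- move=> z z1; rewrite opprK mul1r -lnM ?posrE ?pos//; last first.
    by rewrite -[z]opprK pos// modulusN.
  by rewrite -modulusM; congr (ln (modulus _)); ring.
- by apply/andP; split; lra.
- exact: ln_modulus_bound.
Qed.

Lemma continuous_ln_rotation w : modulus w < 1 ->
  continuous (fun t => ln (modulus (1 - w * cis t))).
Proof.
move=> w1 t.
have pos : 0 < modulus (1 - w * cis t).
  have := modulus_le_dist 1 (w * cis t); rewrite modulus1 modulusM modulus_cis; lra.
apply: cont_ln; first exact: pos.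
apply: (@continuous_comp _ _ _ (fun t => w * cis t : R[i]^o) (fun z : R[i]^o => modulus (1 - z))).
  exact: continuous_rotation.
apply/continuous_plane => e e0; exists e => // z' z'z.
by rewrite (le_lt_trans (modulus_lip _ _))// opprB addrC addrA subrK modulusB.
Qed.

(** On the circle z - a = (c - a)(1 - w e^(it)) with w = -r / (c - a) of modulus less than 1, so the
    deviation from ln |c - a| integrates to 0. *)
Lemma mean_ln_out a c r : 0 <= r -> r < modulus (c - a) ->
  mean (fun z => ln (modulus (z - a))) c r = ln (modulus (c - a)).
Proof.
move=> r0 rca.
have ca : 0 < modulus (c - a) by lra.
have ca0 : c - a != 0 by rewrite -modulus_gt0.
pose w := - r%:C / (c - a).
have w1 : modulus w < 1.
  by rewrite modulusM modulusN modulus_real modulusV ger0_norm// ltr_pdivrMr// mul1r.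
rewrite -[RHS](mean_cst (ln (modulus (c - a))) c r) /mean; congr (_ * _).
have E t : c + r%:C * cis t - a = (c - a) * (1 - w * cis t).
  by rewrite /w; field.
have pos t : 0 < modulus (1 - w * cis t).
  have := modulus_le_dist 1 (w * cis t); rewrite modulus1 modulusM modulus_cis; lra.
under eq_Rintegral do rewrite E modulusM lnM ?posrE//.
have c1 := continuous_ln_rotation w1.
have c2 : continuous (fun _ : R => ln (modulus (c - a))) by move=> t; exact: cont_cst.
rewrite (RintegralD _ (integrable_continuous 0 (2 * pi) c2) (integrable_continuous 0 (2 * pi) c1))//.
by rewrite integral_ln_modulus// addr0.
Qed.

(** Here r e^(it) is factored out instead: |c + r e^(it) - a| = r |1 + ((c - a) / r) e^(-it)|, and
    conjugation brings the last factor to the form |1 - w e^(it)|. *)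
Lemma mean_ln_in a c r : modulus (c - a) < r ->
  mean (fun z => ln (modulus (z - a))) c r = ln r.
Proof.
move=> rca.
have r0 : 0 < r by apply: le_lt_trans rca; exact: modulus_ge0.
have rc0 : r%:C != 0 :> R[i] by rewrite -modulus_gt0 modulus_real gtr0_norm.
pose w := - ((c - a)^*) / r%:C.
have w1 : modulus w < 1.
  by rewrite modulusM modulusN modulusV modulus_conj modulus_real gtr0_norm// ltr_pdivrMr// mul1r.
rewrite -[RHS](mean_cst (ln r) c r) /mean; congr (_ * _).
have pos t : 0 < modulus (1 - w * cis t).
  have := modulus_le_dist 1 (w * cis t); rewrite modulus1 modulusM modulus_cis; lra.
have E t : modulus (c + r%:C * cis t - a) = r * modulus (1 - w * cis t).
  have -> : c + r%:C * cis t - a = r%:C * cis t * (1 + (c - a) / r%:C * cis (- t)).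
    have -> : cis (- t) = (cis t)^-1 :> R[i].
      by apply: (mulfI (cis_neq0 t)); rewrite -cisD subrr cis0 mulfV// cis_neq0.
    by move: (r%:C) rc0 => u u0; field; rewrite u0 cis_neq0.
  rewrite !modulusM modulus_cis modulus_real gtr0_norm// mulr1; congr (_ * _).
  rewrite -modulus_conj; congr modulus.
  rewrite rmorphD rmorph1 !rmorphM /= fmorphV cis_conj opprK /w !mulNr opprK.
  by congr (1 + _ / _ * _); apply/eqP; rewrite eq_complex /= oppr0 !eqxx.
under eq_Rintegral do rewrite E lnM ?posrE//.
have c1 := continuous_ln_rotation w1.
have c2 : continuous (fun _ : R => ln r) by move=> t; exact: cont_cst.
rewrite (RintegralD _ (integrable_continuous 0 (2 * pi) c2) (integrable_continuous 0 (2 * pi) c1))//.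
by rewrite integral_ln_modulus// addr0.
Qed.

(** The identity z / (1 - z) - z / (1 + z) = 2 z^2 / (1 - z^2) is the doubling equation with the
    extreme value [lam = 2]. *)
Lemma integral_Cauchy_kernel (b w : R[i]) : modulus w < 1 ->
  \int[mu]_(t in `[0, 2 * pi]) complex.Re (b * (w * cis t / (1 - w * cis t))) = 0.
Proof.
have pos z : modulus z < 1 -> 1 - z != 0.
  by move=> z1; rewrite -modulus_gt0; have := modulus_le_dist 1 z; rewrite modulus1; lra.
apply: (@integral_doubling (fun z => complex.Re (b * (z / (1 - z)))) 2 (2 * modulus b)).
- move=> z z1.
  apply: (@continuous_comp _ _ _ (fun z : R[i]^o => b * (z / (1 - z)) : R[i]^o) (@complex.Re R)).
    apply: (@cvgM R[i] R[i]^o (nbhs (z : R[i]^o))); first exact: cvg_cst.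
    apply: cvgM; first exact: cvg_id.
    apply: cvgV; first exact: pos.
    by apply: cvgB; [exact: cvg_cst|exact: cvg_id].
  exact: continuous_Re.
- move=> z z1; have z1' : 1 + z != 0 by rewrite -[z]opprK pos// modulusN.
  have z2 : 1 - z ^+ 2 != 0.
    by rewrite (_ : 1 - z ^+ 2 = (1 - z) * (1 + z)) ?mulf_neq0 ?pos//; ring.
  rewrite -raddfD -[2 in RHS]/(complex.Re (2%:C)) /=.
  have -> : b * (z / (1 - z)) + b * (- z / (1 - - z)) = (2 : R)%:C * (b * (z ^+ 2 / (1 - z ^+ 2))).
    have -> : (2 : R)%:C = 2 :> R[i] by rewrite rmorph_nat.
    by field; rewrite opprK z1' z2 pos.
  by case: (b * _) => p q; simpc.
- by rewrite ler0n lexx.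
- move=> z z2; apply: le_trans (Re_le_modulus _) _.
  have z0 := modulus_ge0 z; have b0 := modulus_ge0 b.
  have z1 : 1 / 2 <= modulus (1 - z).
    by have := modulus_le_dist 1 z; rewrite modulus1; lra.
  rewrite !modulusM modulusV (mulrC 2) -!mulrA ler_wpM2l// mulrC ler_wpM2r//.
  by rewrite -[leRHS]invrK lef_pV2 ?posrE ?invr_gt0//; lra.
Qed.

(** With w = r / (a - c) the kernel on the circle is b / (a - c) times 1 + w e^(it) / (1 - w
    e^(it)), and the second summand integrates to 0. This yields the mean value property of Poisson
    kernels. *)
Lemma mean_Cauchy_kernel (b a c : R[i]) r : 0 <= r -> r < modulus (a - c) ->
  mean (fun z => complex.Re (b / (a - z))) c r = complex.Re (b / (a - c)).
Proof.
move=> r0 rac.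
have ac : 0 < modulus (a - c) by lra.
have ac0 : a - c != 0 by rewrite -modulus_gt0.
pose w := r%:C / (a - c).
have w1 : modulus w < 1.
  by rewrite modulusM modulus_real modulusV ger0_norm// ltr_pdivrMr// mul1r.
rewrite -[RHS](mean_cst _ c r) /mean; congr (_ * _).
have pos t : 1 - w * cis t != 0.
  rewrite -modulus_gt0.
  have := modulus_le_dist 1 (w * cis t); rewrite modulus1 modulusM modulus_cis; lra.
have E t : complex.Re (b / (a - (c + r%:C * cis t))) =
   complex.Re (b / (a - c)) + complex.Re (b / (a - c) * (w * cis t / (1 - w * cis t))).
  rewrite -raddfD /=; congr complex.Re.
  have -> : a - (c + r%:C * cis t) = (a - c) * (1 - w * cis t) by rewrite /w; field.
  by field; rewrite pos.
under eq_Rintegral do rewrite E.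
have c1 : continuous (fun t => complex.Re (b / (a - c) * (w * cis t / (1 - w * cis t)))).
  move=> t.
  apply: (@continuous_comp _ _ _ (fun t => w * cis t : R[i]^o)
    (fun z : R[i]^o => complex.Re (b / (a - c) * (z / (1 - z))))).
    exact: continuous_rotation.
  apply: (@continuous_comp _ _ _ (fun z : R[i]^o => b / (a - c) * (z / (1 - z)) : R[i]^o) (@complex.Re R)).
    apply: (@cvgM R[i] R[i]^o (nbhs (w * cis t : R[i]^o))); first exact: cvg_cst.
    apply: cvgM; first exact: cvg_id.
    apply: cvgV; first exact: pos.
    by apply: cvgB; [exact: cvg_cst|exact: cvg_id].
  exact: continuous_Re.
have c2 : continuous (fun _ : R => complex.Re (b / (a - c))) by move=> t; exact: cont_cst.
rewrite (RintegralD _ (integrable_continuous 0 (2 * pi) c2) (integrable_continuous 0 (2 * pi) c1))//.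
by rewrite integral_Cauchy_kernel// addr0.
Qed.

End MeanValue.

(** * Subharmonicity and harmonicity at a point *)

Section LocalSubharmonicity.
Context (R : realType).
Implicit Types (z w c a : R[i]) (x y r s t e M : R) (u v T : R[i]^o -> R).

(** Continuity is asked on a neighbourhood, so that means over small circles are integrals of
    continuous functions; the sub-mean inequality is asked at [z] only, the form in which Perron
    families provide it. *)
Definition subh_pt u z :=
  (\forall w \near (z : R[i]^o), {for w, continuous u}) /\
  \forall r \near (0 : R)^'+, u z <= mean u z r.

Definition harm_pt u z :=
  (\forall w \near (z : R[i]^o), {for w, continuous u}) /\
  \forall r \near (0 : R)^'+, mean u z r = u z.

Lemma near_circle (P : R[i] -> Prop) z : (\forall w \near (z : R[i]^o), P w) ->
  \forall r \near (0 : R)^'+, 0 <= r /\ forall w, modulus (w - z) <= r -> P w.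
Proof.
move=> /nbhs_plane[e e0 eP]; near=> r; split => // w wr; apply: eP.
by rewrite (le_lt_trans wr)//.
Unshelve. all: by end_near. Qed.

Lemma subh_pt_circle u z : subh_pt u z ->
  \forall r \near (0 : R)^'+, [/\ 0 <= r, continuous_circle_at u z r & u z <= mean u z r].
Proof.
move=> [/near_circle h1 h2]; apply: filterS2 h1 h2 => r [r0 h] h2; split => // w wr.
by apply: h; rewrite wr.
Qed.

Lemma harm_pt_circle u z : harm_pt u z ->
  \forall r \near (0 : R)^'+, [/\ 0 <= r, continuous_circle_at u z r & mean u z r = u z].
Proof.
move=> [/near_circle h1 h2]; apply: filterS2 h1 h2 => r [r0 h] h2; split => // w wr.
by apply: h; rewrite wr.
Qed.

Lemma subh_pt_cont u z : subh_pt u z -> {for (z : R[i]^o), continuous u}.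
Proof. by case=> /nbhs_singleton. Qed.

Lemma harm_subh u z : harm_pt u z -> subh_pt u z.
Proof. by case=> h1 h2; split => //; apply: filterS h2 => r ->. Qed.

Lemma harm_subhN u z : harm_pt u z -> subh_pt (fun w => - u w) z.
Proof.
move=> hu; split; first by apply: filterS hu.1 => w; exact: contN.
apply: filterS (harm_pt_circle hu) => r [r0 cu um].
have -> : mean (fun w => - u w) z r = - mean u z r.
  by rewrite -mulN1r -meanZ//; apply: eq_mean => // w _; rewrite mulN1r.
by rewrite um.
Qed.

Lemma subh_ptD u v z : subh_pt u z -> subh_pt v z -> subh_pt (fun w => u w + v w) z.
Proof.
move=> su sv; split; first by apply: filterS2 su.1 sv.1 => w; exact: contD.
apply: filterS2 (subh_pt_circle su) (subh_pt_circle sv) => r [r0 cu um] [_ cv vm].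
by rewrite meanD// lerD.
Qed.

Lemma subh_ptB u v z : subh_pt u z -> harm_pt v z -> subh_pt (fun w => u w - v w) z.
Proof. by move=> su /harm_subhN; exact: subh_ptD. Qed.

Lemma harm_ptD u v z : harm_pt u z -> harm_pt v z -> harm_pt (fun w => u w + v w) z.
Proof.
move=> su sv; split; first by apply: filterS2 su.1 sv.1 => w; exact: contD.
apply: filterS2 (harm_pt_circle su) (harm_pt_circle sv) => r [r0 cu um] [_ cv vm].
by rewrite meanD// um vm.
Qed.

Lemma harm_ptZ x u z : harm_pt u z -> harm_pt (fun w => x * u w) z.
Proof.
move=> su; split; first by apply: filterS su.1 => w; apply: contM; exact: cont_cst.
by apply: filterS (harm_pt_circle su) => r [r0 cu um]; rewrite meanZ// um.
Qed.

Lemma harm_ptB u v z : harm_pt u z -> harm_pt v z -> harm_pt (fun w => u w - v w) z.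
Proof.
move=> su /(harm_ptZ (-1)) sv; have := harm_ptD su sv.
by under eq_fun do rewrite mulN1r.
Qed.

Lemma harm_cst x z : harm_pt (fun=> x) z.
Proof.
split; last by apply: nearW => r; exact: mean_cst.
have FF : Filter (nbhs (z : R[i]^o)) by exact: nbhs_filter.
by apply: (@nearW _ (nbhs (z : R[i]^o))) => w; exact: cont_cst.
Qed.

Lemma subh_ptZ x u z : 0 <= x -> subh_pt u z -> subh_pt (fun w => x * u w) z.
Proof.
move=> x0 su; split; first by apply: filterS su.1 => w; apply: contM; exact: cont_cst.
by apply: filterS (subh_pt_circle su) => r [r0 cu um]; rewrite meanZ// ler_wpM2l.
Qed.

Lemma subh_pt_max u v z : subh_pt u z -> subh_pt v z ->
  subh_pt (fun w => Num.max (u w) (v w)) z.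
Proof.
move=> su sv; split; first by apply: filterS2 su.1 sv.1 => w; exact: cont_max.
apply: filterS2 (subh_pt_circle su) (subh_pt_circle sv) => r [r0 cu um] [_ cv vm].
have cm : continuous_circle_at (fun w => Num.max (u w) (v w)) z r.
  by move=> w wr; apply: cont_max; [exact: cu|exact: cv].
rewrite ge_max; apply/andP; split.
  by apply: le_trans um _; apply: le_mean => // w _; rewrite le_max lexx.
by apply: le_trans vm _; apply: le_mean => // w _; rewrite le_max lexx orbT.
Qed.

Lemma subh_pt_near u v z : (\forall w \near (z : R[i]^o), u w = v w) ->
  subh_pt u z -> subh_pt v z.
Proof.
move=> uv su; split.
  have /nbhs_interior uv2 := uv; apply: filterS2 uv2 su.1 => w; exact: cont_near.
apply: filterS2 (near_circle uv) (subh_pt_circle su) => r [r0 h] [_ cu um].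
rewrite -(h z); last by rewrite subrr modulus0.
by rewrite (le_trans um)//; rewrite (eq_mean (v := v))// => w wr; apply: h; rewrite wr.
Qed.

Lemma continuous_modulusB a : continuous (fun w : R[i]^o => modulus (w - a)).
Proof.
move=> c; apply/continuous_plane => e e0; exists e => // z zc.
by rewrite (le_lt_trans (modulus_lip _ _))// opprB addrA subrK.
Qed.

Lemma near_neq a z : z != a -> \forall w \near (z : R[i]^o), w != a.
Proof.
move=> za; apply/nbhs_plane; exists (modulus (z - a)).
  by rewrite modulus_gt0 subr_eq0.
by move=> w wz; apply/eqP => wa; move: wz; rewrite wa modulusB ltxx.
Qed.

Lemma continuous_ln_modulus a z : z != a ->
  {for (z : R[i]^o), continuous (fun w : R[i]^o => ln (modulus (w - a)))}.
Proof.
move=> za; apply: cont_ln; first by rewrite modulus_gt0 subr_eq0.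
exact: continuous_modulusB.
Qed.

Lemma harm_ln a z : z != a -> harm_pt (fun w => ln (modulus (w - a))) z.
Proof.
move=> za; split.
  have FF : Filter (nbhs (z : R[i]^o)) by exact: nbhs_filter.
  exact: (filterS (fun w => @continuous_ln_modulus a w) (near_neq za)).
have za0 : 0 < modulus (z - a) by rewrite modulus_gt0 subr_eq0.
by near=> r; apply: mean_ln_out.
Unshelve. all: by end_near. Qed.

End LocalSubharmonicity.

(** * Maximum principles on the sphere, in the plane and in a disk *)

Section MaximumPrinciple.
Context (R : realType).
Implicit Types (z w c a q : R[i]) (x y r s t e M : R) (u v T : R[i]^o -> R).

(** The real line through [q] and a finite point [c] of [S] meets [S] in a clopen set of parameters,
    hence in all of them. If [S] contains infinity, being open it also contains finite points. *)
Lemma clopen_sphere (S : set (sphere R)) q : open S -> closed S -> S !=set0 -> S (fin_pt q).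
Proof.
move=> oS cS [p Sp].
have [c Sc] : exists c, S (fin_pt c).
  case: p Sp => [c|] Sp; first by exists c.
  have /nbhs_infty[_ [X X0 XS]] : nbhs (None : sphere R) S.
    by apply: open_nbhs_nbhs.
  by exists (X + 1)%:C; apply: XS; rewrite modulus_real ger0_norm ?ltrDl//; lra.
pose g (t : R) : sphere R := fin_pt (c + t%:C * (q - c)).
have cg : continuous g.
  move=> t; apply: (@continuous_comp _ _ _ (fun t => c + t%:C * (q - c) : R[i]^o) (@fin_pt R));
    last exact: continuous_fin_pt.
  have -> : (fun t => c + t%:C * (q - c) : R[i]^o) = (fun t =>
     (complex.Re c + t * complex.Re (q - c)) +i* (complex.Im c + t * complex.Im (q - c))).
    by apply/funext => s; case: c {Sc g} => c1 c2; case: (q - _) => d1 d2; simpc.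
  apply: (@continuous_Complex R R^o (fun t => complex.Re c + t * complex.Re (q - c))
    (fun t => complex.Im c + t * complex.Im (q - c)) t);
  (apply: contD; [exact: cont_cst|apply: contM; [exact: cvg_id|exact: cont_cst]]).
have H : connected [set: R] by apply/connected_intervalP.
have {}H : g @^-1` S = setT.
  apply: H.
  - by exists 0; rewrite /g /= mul0r addr0.
  - exists (g @^-1` S); last by rewrite setTI.
    by apply: open_comp => // t _; exact: cg.
  - exists (g @^-1` S); last by rewrite setTI.
    by apply: closed_comp => // t _; exact: cg.
have : (g @^-1` S) 1 by rewrite H.
by rewrite /g /= mul1r addrC subrK.
Qed.

(** If the maximum over [K] were positive, the part [S] of [K] where it is attained would be closed,
    and open by the equality case of the mean inequality, so it would contain [q]. The alternative
    [f p' <= 0] allows points near [p] to leave [K]: the maximum is not attained there. *)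
Lemma maximum_principle (K : set (sphere R)) q (f : sphere R -> R) :
  compact K -> ~ K (fin_pt q) -> (forall p, K p -> {for p, continuous f}) ->
  (forall p, K p -> 0 < f p -> sub_mean_at f p /\
     \forall p' \near p, {for p', continuous f} /\ (K p' \/ f p' <= 0)) ->
  forall p, K p -> f p <= 0.
Proof.
move=> cK nKq fK sK p Kp; rewrite leNgt; apply/negP => fp.
have [m Km mM] := EVT_compact (ex_intro _ p Kp) cK fK.
have M0 : 0 < f m by rewrite (lt_le_trans fp)// mM.
pose S := K `&` [set p | f p = f m].
suff /nKq : K (fin_pt q) by [].
have clK := sphere_compact_closed cK.
suff [] : S (fin_pt q) by [].
apply: clopen_sphere; last by exists m.
- rewrite openE => p' [Kp' fp']; have fp'0 : 0 < f p' by rewrite fp'.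
  have [sm nr] := sK _ Kp' fp'0.
  have leM z : {for fin_pt z, continuous f} /\ (K (fin_pt z) \/ f (fin_pt z) <= 0) ->
      f (fin_pt z) <= f m.
    by move=> [_ [/mM//|h]]; rewrite (le_trans h)// ltW.
  have inK z : {for fin_pt z, continuous f} /\ (K (fin_pt z) \/ f (fin_pt z) <= 0) ->
      f (fin_pt z) = f m -> S (fin_pt z).
    move=> [_ [Kz|h]] fz; first by split.
    by move: M0; rewrite -fz ltNge h.
  have main c r : 0 <= r -> (forall z, modulus (z - c) = r ->
      {for fin_pt z, continuous f} /\ (K (fin_pt z) \/ f (fin_pt z) <= 0)) ->
      f m <= circle_mean f c r -> forall z, modulus (z - c) = r -> S (fin_pt z).
    move=> r0 nrc le z zr; apply: inK; first by apply: nrc.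
    rewrite circle_meanE in le.
    have h1 : continuous_circle_at (f \o @fin_pt R) c r by move=> w /nrc[].
    have h2 w : modulus (w - c) = r -> (f \o @fin_pt R) w <= f m by move=> /nrc/leM.
    exact: (mean_eq_max r0 h1 h2 le zr).
  case: p' Kp' fp' sm nr fp'0 => [c|] Kp' fp' sm nr fp'0.
    have /nbhs_fin[d d0 dn] := nr.
    have /nbhs_ballP[e /= e0 eA] := sm.
    apply/nbhs_fin; exists (Num.min d e); first by rewrite lt_min d0.
    move=> z; rewrite lt_min => /andP[zd ze].
    have [->|zc] := eqVneq z c; first by split.
    apply: (main c (modulus (z - c))) => //; first exact: modulus_ge0.
      by move=> w wz; apply: dn; rewrite wz.
    rewrite -fp'; apply: eA; last by rewrite modulus_gt0 subr_eq0.
    by rewrite /ball/= sub0r normrN ger0_norm ?modulus_ge0.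
  have /nbhs_infty[_ [X X0 Xn]] := nr.
  have [Y [Yr Yn]] := sm.
  apply/nbhs_infty; split; first by split.
  exists (Num.max X Y); first by rewrite lt_max X0.
  move=> z; rewrite gt_max => /andP[zX zY].
  apply: (main 0 (modulus z)); rewrite ?subr0//; first exact: modulus_ge0.
    by move=> w; rewrite subr0 => wz; apply: Xn; rewrite wz.
  by rewrite -fp'; exact: Yn.
- rewrite -openC openE => p' /not_andP np'.
  have [Kp'|nKp'] := pselect (K p'); last first.
    apply: filterS (_ : nbhs p' (~` K)); first by move=> ? ? [].
    by apply: open_nbhs_nbhs; split => //; exact: closed_openC.
  have fp' : f p' != f m by apply/eqP => h; case: np'.
  have FF : Filter (nbhs p') by exact: nbhs_filter.
  have d0 : 0 < `|f p' - f m| by rewrite normr_gt0 subr_eq0.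
  have /(@cvgrPdist_lt _ _ _ (nbhs p') FF)/(_ _ d0) := fK _ Kp'.
  by apply: filterS => w h [_ /= fw]; move: h; rewrite fw ltxx.
Qed.

(** The function is extended to the sphere by 0 at infinity, and [q] is a point beyond a bound of
    [K]. *)
Lemma plane_maximum_principle (K : set R[i]^o) u :
  compact K -> (forall z, K z -> {for z, continuous u}) ->
  (forall z, K z -> 0 < u z -> subh_pt u z /\ \forall w \near (z : R[i]^o), K w \/ u w <= 0) ->
  forall z, K z -> u z <= 0.
Proof.
move=> cK uK sK z Kz.
have [X X0 KX] := compact_plane_bounded cK.
pose f (p : sphere R) := if p is Some z then u z else 0.
suff H : forall p, (@fin_pt R @` K) p -> f p <= 0 by apply: (H (fin_pt z)); exists z.
apply: (@maximum_principle (@fin_pt R @` K) (X + 1)%:C f).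
- exact: compact_fin.
- move=> [w Kw [wE]]; have := KX _ Kw; rewrite wE modulus_real ger0_norm; lra.
- by move=> _ [w Kw <-]; exact: (uK w Kw).
- move=> _ [w Kw <-] /= uw; have [[h1 h2] h3] := sK w Kw uw; split => //.
  apply: (filterS2 _ _ h1 h3) => w' cw' [Kw'|uw'].
    by split; [exact: cw'|left; exists w'].
  by split; [exact: cw'|right].
Qed.

Lemma disk_maximum_principle u c r :
  (forall z, modulus (z - c) <= r -> {for (z : R[i]^o), continuous u}) ->
  (forall z, modulus (z - c) < r -> subh_pt u z) ->
  (forall z, modulus (z - c) = r -> u z <= 0) ->
  forall z, modulus (z - c) <= r -> u z <= 0.
Proof.
move=> cu su bu; apply: (plane_maximum_principle (@compact_cdisk R c r)) => // z zr uz.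
have {}zr : modulus (z - c) < r.
  rewrite lt_neqAle (zr : _ <= _) andbT; apply/eqP => /bu; by rewrite leNgt uz.
split; first exact: su.
apply/nbhs_plane; exists (r - modulus (z - c)); first by rewrite subr_gt0.
move=> w wz; left; rewrite /cdisk /=.
have := modulusD (w - z) (z - c); rewrite addrA subrK; lra.
Qed.

End MaximumPrinciple.

(** * Poisson kernels and sums over roots of unity *)

Section DiscretePoisson.
Context (R : realType).
Implicit Types (z w c a A Z : R[i]) (x y r s t e M rho : R) (u v T phi : R[i]^o -> R).

Definition poisson A Z : R := (modulus A ^+ 2 - modulus Z ^+ 2) / modulus (A - Z) ^+ 2.

(** The right-hand side is the real part of (A + Z) / (A - Z), written as a constant plus a Cauchy
    kernel, whose circle means are known. *)
Lemma poissonE A Z : A != Z -> poisson A Z = -1 + complex.Re (2 * A / (A - Z)).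
Proof.
move=> AZ; have AZ0 : modulus (A - Z) ^+ 2 != 0.
  by rewrite expf_neq0// modulus_eq0 subr_eq0.
rewrite /poisson; apply: (mulIf AZ0); rewrite mulfVK// mulrDl.
move: AZ0; rewrite !modulus_sqr; case: A AZ => a b AZ; case: Z AZ => p q AZ AZ0.
have -> : complex.Re (2 * (a +i* b) / (a +i* b - (p +i* q))) =
    (2 * a * (a - p) + 2 * b * (b - q)) / ((a - p) ^+ 2 + (b - q) ^+ 2).
  rewrite mulr_natl mulr2n.
  have -> : (a +i* b - (p +i* q))^-1 = ((a - p) / ((a - p) ^+ 2 + (b - q) ^+ 2)) +i*
      (- (b - q) / ((a - p) ^+ 2 + (b - q) ^+ 2)).
    by apply/eqP; rewrite eq_complex /= mulNr !eqxx.
  move: (_ ^+ 2 + _) => D; simpc => /=.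
  by rewrite !mulrA -mulrDl -!mulr2n !mulr_natl.
move: AZ0; rewrite [complex.Re (_ - _)]raddfB [complex.Im (_ - _)]raddfB /= => AZ0.
rewrite divfK //; ring.
Qed.

(** A geometric sum with ratio [xi] and [xi ^+ N = 1]. The ratio differs from 1, for cos th = 1
    would force sin (th / 2) = 0 although 0 < th / 2 < pi. *)
Lemma sum_roots_of_unity (N m : nat) : (0 < m < N)%N ->
  \sum_(j < N) cis (- (2 * pi * m%:R / N%:R)) ^+ j = 0 :> R[i].
Proof.
move=> /andP[m0 mN]; set xi := cis _.
have N0 : (0 < N)%N by exact: leq_trans mN.
have NR : N%:R != 0 :> R by rewrite pnatr_eq0 -lt0n.
have xi1 : xi != 1.
  apply/eqP => h; have : complex.Re xi = 1 by rewrite h.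
  rewrite /= cosN => c1.
  set th := 2 * pi * m%:R / N%:R in c1.
  have th2 : th = (th / 2) *+ 2 by rewrite -mulr_natr divfK.
  have s0 : 0 < sin (th / 2).
    apply: sin_gt0_pi; rewrite /th.
    have -> : 2 * pi * m%:R / N%:R / 2 = pi * (m%:R / N%:R) :> R by field.
    have p0 := pi_gt0 R.
    rewrite mulr_gt0//= ?divr_gt0 ?ltr0n//.
    by rewrite gtr_pMr// ltr_pdivrMr ?ltr0n// mul1r ltr_nat.
  move: c1; rewrite th2 mulr2n cosD -!expr2 cos2sin2 => c1.
  have : sin (th / 2) ^+ 2 = 0 by lra.
  by move/eqP; rewrite sqrf_eq0 gt_eqF.
have xiN : xi ^+ N = 1.
  rewrite cisX mulrN mulrCA mulfV// mulr1.
  apply/eqP; rewrite eq_complex /= cosN sinN.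
  have -> : 2 * pi * m%:R = 0 + (pi *+ 2) *+ m :> R by rewrite add0r mulr_natl mulr_natr.
  by rewrite (periodicn (@cosD2pi R)) (periodicn (@sinD2pi R)) cos0 sin0 oppr0 !eqxx.
have := subrX1 xi N; rewrite xiN subrr => /esym/eqP.
by rewrite mulf_eq0 subr_eq0 (negPf xi1) /= => /eqP.
Qed.

Definition unit_root (N : nat) (j : nat) : R[i] := cis (2 * pi * j%:R / N%:R).

(** For an N-th root of unity u, the quotient u / (u - w) is the sum of (w / u)^m over m < N,
    divided by 1 - w^N. Summation over u leaves only the term m = 0, counted N times. *)
Lemma sum_Cauchy_kernel (N : nat) w : (0 < N)%N -> modulus w < 1 ->
  \sum_(j < N) unit_root N j / (unit_root N j - w) = N%:R / (1 - w ^+ N).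
Proof.
move=> N0 w1.
have NR : N%:R != 0 :> R by rewrite pnatr_eq0 -lt0n.
have lt1 z : modulus z < 1 -> 1 - z != 0.
  by move=> z1; apply/eqP => /eqP; rewrite subr_eq0 => /eqP h; move: z1; rewrite -h modulus1 ltxx.
have wN : 1 - w ^+ N != 0.
  by apply: lt1; rewrite modulusX exprn_ilt1 ?modulus_ge0// -lt0n.
apply: (mulIf wN); rewrite divfK// mulr_suml.
have E (j : 'I_N) : unit_root N j / (unit_root N j - w) * (1 - w ^+ N) =
    \sum_(m < N) w ^+ m * cis (- (2 * pi * m%:R / N%:R)) ^+ j.
  have uj : unit_root N j != 0 by exact: cis_neq0.
  have ujV : (unit_root N j)^-1 = cis (- (2 * pi * j%:R / N%:R)).
    by apply: (mulfI uj); rewrite mulfV// -cisD subrr cis0.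
  have ujN : unit_root N j ^+ N = 1.
    rewrite cisX mulrCA mulfV// mulr1.
    apply/eqP; rewrite eq_complex /=.
    have -> : 2 * pi * j%:R = 0 + (pi *+ 2) *+ j :> R by rewrite add0r mulr_natl mulr_natr.
    by rewrite (periodicn (@cosD2pi R)) (periodicn (@sinD2pi R)) cos0 sin0 !eqxx.
  have wu : modulus (w / unit_root N j) < 1.
    by rewrite modulusM modulusV modulus_cis invr1 mulr1.
  have -> : unit_root N j / (unit_root N j - w) = (1 - w / unit_root N j)^-1.
    have := lt1 _ wu => h; have h2 : unit_root N j - w != 0.
      by apply: contra h => /eqP h; rewrite -[1](mulfV uj) -mulrBl h mul0r.
    by field; rewrite h2 uj.
  apply: (mulfI (lt1 _ wu)); rewrite mulrA mulfV ?lt1// mul1r.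
  have -> : w ^+ N = (w / unit_root N j) ^+ N by rewrite expr_div_n ujN divr1.
  rewrite -opprB subrX1 -mulNr opprB; congr (_ * _); apply: eq_bigr => m _.
  rewrite exprMn ujV; congr (_ * _); rewrite !cisX; congr cis; ring.
under eq_bigr do rewrite E.
rewrite exchange_big /=.
under eq_bigr do rewrite -mulr_sumr.
case: N N0 NR wN E => // N N0 NR wN E.
rewrite big_ord_recl [X in _ + X]big1 ?addr0.
  have -> : cis (- (2 * pi * (@ord0 N)%:R / N.+1%:R)) = 1 :> R[i].
    by rewrite /= mulr0 mul0r oppr0 cis0.
  by under eq_bigr do rewrite expr1n; rewrite expr0 mul1r sumr_const card_ord.
move=> m _; have -> : \sum_(i < N.+1) cis (- (2 * pi * (lift ord0 m)%:R / N.+1%:R)) ^+ i = 0 :> R[i].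
  by apply: sum_roots_of_unity; rewrite lift0 /= ltnS ltn_ord.
by rewrite mulr0.
Qed.

End DiscretePoisson.

(** * Harmonic approximation of boundary values on a circle *)

Section HarmonicApproximation.
Context (R : realType).
Implicit Types (z w c a A Z : R[i]) (x y r s t e M rho : R) (u v T phi : R[i]^o -> R).

Lemma poisson_ge0 A Z : modulus Z <= modulus A -> 0 <= poisson A Z.
Proof.
move=> ZA; rewrite /poisson divr_ge0 ?sqr_ge0// subr_ge0.
by rewrite ler_sqr ?nnegrE ?modulus_ge0.
Qed.

Lemma poisson_neq A c z : modulus (z - c) < modulus A -> A != z - c.
Proof. by move=> h; apply/eqP => AE; move: h; rewrite AE ltxx. Qed.

Lemma continuous_poisson A c z : modulus (z - c) < modulus A ->
  {for (z : R[i]^o), continuous (fun w : R[i]^o => poisson A (w - c))}.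
Proof.
move=> zA; apply: contM; last first.
  apply: contV; first by rewrite expf_neq0// modulus_eq0 subr_eq0 poisson_neq.
  have -> : (fun w : R[i]^o => modulus (A - (w - c)) ^+ 2) =
      fun w : R[i]^o => modulus (w - (A + c)) * modulus (w - (A + c)).
    by apply/funext => w; rewrite -expr2 -modulusN; congr (modulus _ ^+ 2); ring.
  by apply: contM; exact: continuous_modulusB.
apply: contB; first exact: cont_cst.
by apply: contM; exact: continuous_modulusB.
Qed.

Lemma mean_poisson A c z r : 0 <= r -> modulus (z - c) + r < modulus A ->
  mean (fun w => poisson A (w - c)) z r = poisson A (z - c).
Proof.
move=> r0 zrA.
have h w : modulus (w - z) = r -> modulus (w - c) < modulus A.
  by move=> wz; have := modulusD (w - z) (z - c); rewrite addrA subrK wz; lra.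
have zA : modulus (z - c) < modulus A by lra.
have E w : modulus (w - c) < modulus A ->
    poisson A (w - c) = -1 + complex.Re (2 * A / (A + c - w)).
  by move=> wA; rewrite poissonE ?poisson_neq// opprB addrA.
have rA : r < modulus (A + c - z).
  rewrite (_ : A + c - z = A - (z - c)); last ring.
  by have := modulus_le_dist A (z - c); lra.
rewrite E// (eq_mean (v := fun w => -1 + complex.Re (2 * A / (A + c - w))))//; last first.
  by move=> w /h/E.
have AC w : modulus (w - z) = r -> A + c - w != 0.
  by move=> /h wA; rewrite (_ : A + c - w = A - (w - c)) ?subr_eq0 ?poisson_neq//; ring.
rewrite meanD ?mean_cst ?mean_Cauchy_kernel//.
  by move=> w _; exact: cont_cst.
move=> w wz.
apply: (@cont_near R R[i]^o w (fun w => poisson A (w - c) + 1)).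
  have wA := h w wz.
  apply/nbhs_plane; exists (modulus A - modulus (w - c)); first by rewrite subr_gt0.
  move=> w' w'w; rewrite E; first ring.
  by have := modulusD (w' - w) (w - c); rewrite addrA subrK; lra.
by apply: contD; [exact: continuous_poisson (h w wz)|exact: cont_cst].
Qed.

(** The numerator factors as (|A| - |Z|)(|A| + |Z|), and the denominator is at most (|A| +
    |Z|)^2. *)
Lemma poisson_Harnack A Z s : modulus Z <= s -> s < modulus A ->
  (modulus A - modulus Z) / (modulus A + modulus Z) <= poisson A Z.
Proof.
move=> Zs sA; have Z0 := modulus_ge0 Z.
have p : 0 < modulus (A - Z) by have := modulus_le_dist A Z; lra.
have q : modulus (A - Z) <= modulus A + modulus Z.
  by have := modulusD A (- Z); rewrite modulusN.
rewrite /poisson ler_pdivrMr; last lra.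
rewrite mulrAC ler_pdivlMr ?exprn_gt0// subr_sqr -mulrA -expr2 ler_wpM2l//; first lra.
by rewrite ler_sqr ?nnegrE; lra.
Qed.

Lemma poisson0r A : A != 0 -> poisson A 0 = 1.
Proof. by move=> A0; rewrite /poisson modulus0 subr0 expr0n subr0 mulfV// expf_neq0// modulus_eq0. Qed.

(** The deviation is exactly Re (2 w^N / (1 - w^N)) with w = Z / rho; it measures how far the
    discrete kernel is from total mass 1. *)
Lemma sum_poisson (N : nat) rho Z : (0 < N)%N -> 0 < rho -> modulus Z < rho ->
  `|N%:R^-1 * \sum_(j < N) poisson (rho%:C * unit_root R N j) Z - 1| <=
  2 * (modulus Z / rho) ^+ N / (1 - (modulus Z / rho) ^+ N).
Proof.
move=> N0 rho0 Zr.
have NR : N%:R != 0 :> R by rewrite pnatr_eq0 -lt0n.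
have NC : N%:R != 0 :> R[i] by rewrite pnatr_eq0 -lt0n.
have rC : rho%:C != 0 :> R[i] by rewrite -modulus_gt0 modulus_real gtr0_norm.
pose w := Z / rho%:C.
have wm : modulus w = modulus Z / rho by rewrite modulusM modulusV modulus_real gtr0_norm.
have w1 : modulus w < 1 by rewrite wm ltr_pdivrMr// mul1r.
have wN1 : modulus (w ^+ N) < 1 by rewrite modulusX exprn_ilt1 ?modulus_ge0// -lt0n.
have wN : 1 - w ^+ N != 0.
  by apply/eqP => /eqP; rewrite subr_eq0 => /eqP h; move: wN1; rewrite -h modulus1 ltxx.
have E (j : 'I_N) : poisson (rho%:C * unit_root R N j) Z =
    -1 + complex.Re (2 * (unit_root R N j / (unit_root R N j - w))).
  rewrite poissonE; last first.
    apply/eqP => h; move: Zr; rewrite -h modulusM modulus_cis mulr1 modulus_real.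
    by rewrite gtr0_norm// ltxx.
  congr (_ + complex.Re _); rewrite -mulrA; congr (_ * _).
  have -> : rho%:C * unit_root R N j - Z = rho%:C * (unit_root R N j - w).
    by rewrite /w mulrBr mulrCA mulfV ?mulr1.
  by rewrite invfM mulrACA mulfV// mul1r.
have -> : N%:R^-1 * \sum_(j < N) poisson (rho%:C * unit_root R N j) Z - 1 =
   complex.Re (2 * w ^+ N / (1 - w ^+ N)).
  under eq_bigr do rewrite E.
  rewrite big_split /= sumr_const card_ord -raddf_sum -mulr_sumr sum_Cauchy_kernel//.
  rewrite mulrDr -(mulr_natr (-1) N) [_^-1 * (-1 * _)]mulrCA mulVf// mulr1.
  have -> : 2 * (N%:R / (1 - w ^+ N)) = (N%:R : R)%:C * (2 / (1 - w ^+ N)).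
    by rewrite rmorph_nat mulrCA.
  have -> : 2 * w ^+ N / (1 - w ^+ N) = 2 / (1 - w ^+ N) - (2 : R)%:C.
    by rewrite rmorph_nat; field.
  have ReZ (x : R) (z : R[i]) : complex.Re (x%:C * z) = x * complex.Re z.
    by case: z => p q; simpc.
  rewrite [complex_Re__canonical__Algebra_Additive R _](ReZ N%:R) mulKf//.
  by rewrite [RHS]raddfB /=; ring.
apply: le_trans (Re_le_modulus _) _.
have m2 : modulus (2 : R[i]) = 2 by rewrite -(rmorph_nat (real_complex R)) modulus_real ger0_norm.
rewrite !modulusM m2 modulusV modulusX wm ler_wpM2l//.
  by rewrite mulr_ge0// exprn_ge0// divr_ge0 ?modulus_ge0// ltW.
rewrite lef_pV2 ?posrE; last 2 first.
- by rewrite modulus_gt0.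
- by rewrite subr_gt0 -wm -modulusX.
by have := modulus_le_dist 1 (w ^+ N); rewrite modulus1 modulusX wm; lra.
Qed.

Lemma mean_sum (I : Type) (S : seq I) (F : I -> R[i]^o -> R) z r : 0 <= r ->
  (forall i, continuous_circle_at (F i) z r) ->
  mean (fun w => \sum_(i <- S) F i w) z r = \sum_(i <- S) mean (F i) z r.
Proof.
move=> r0 cF; elim: S => [|i S ih].
  by rewrite big_nil; under eq_fun do rewrite big_nil; exact: mean_cst.
rewrite big_cons -ih -meanD//; last by move=> w wz; apply: cont_sum => j; exact: cF.
by congr mean; apply/funext => w; rewrite big_cons.
Qed.

(* A finite sum of Poisson kernels with poles on a slightly larger circle: harmonic
   up to the boundary, unlike the Poisson integral. *)
Lemma harmonic_approximation c rho phi e : 0 < rho -> 0 < e ->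
  continuous_circle_at phi c rho ->
  exists T : R[i]^o -> R,
  [/\ forall z, modulus (z - c) <= rho -> {for (z : R[i]^o), continuous T},
      forall z r, 0 <= r -> modulus (z - c) + r <= rho -> mean T z r = T z,
      forall z, modulus (z - c) = rho -> `|T z - phi z| <= e &
      (forall z, modulus (z - c) = rho -> 0 <= phi z) ->
      forall z, modulus (z - c) < rho ->
        (rho - modulus (z - c)) / (rho + modulus (z - c)) * T c <= T z].
Proof.
move=> rho0 e0 cphi.
pose K : set R[i]^o := [set z | modulus (z - c) = rho].
have cK : compact K.
  apply: (subclosed_compact _ (@compact_cdisk R c rho)); last by move=> z; rewrite /K /cdisk /= => ->.
  have -> : K = (fun z : R[i]^o => modulus (z - c)) @^-1` [set rho] by [].
  apply: closed_comp; last exact: closed_eq.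
  by move=> z _; exact: continuous_modulusB.
have rhoC : modulus (rho%:C : R[i]) = rho by rewrite modulus_real gtr0_norm.
have K0 : K (c + rho%:C) by rewrite /K /= addrC addKr rhoC.
have [M M0 phiM] : exists2 M, 0 < M & forall z, K z -> `|phi z| <= M.
  have [|z Kz zM] := @EVT_compact R R[i]^o K (fun z => `|phi z|) (ex_intro _ _ K0) cK.
    move=> z Kz; apply: (cont_comp (h := fun x : R => `|x|)); last exact: cphi.
    exact: norm_continuous.
  exists (`|phi z| + 1); first by rewrite ltr_wpDl.
  by move=> z' /zM; lra.
have e40 : 0 < e / 4 by rewrite divr_gt0.
have [d d0 phid] := uniform_continuity_compact cK cphi e40.
(* poles on the circle of radius rho + h *)
pose h := Num.min (d / 2) (Num.min rho (e / 4 * (d / 2) ^+ 2 / (2 * M * (3 * rho)))).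
have den : 0 < 2 * M * (3 * rho) by rewrite !mulr_gt0.
have h0 : 0 < h by rewrite !lt_min divr_gt0//= rho0 divr_gt0// mulr_gt0// exprn_gt0// divr_gt0.
have hd : h <= d / 2 by rewrite ge_min lexx.
have hr : h <= rho by rewrite !ge_min lexx orbT.
have he : 2 * M * (3 * rho * h) <= e / 4 * (d / 2) ^+ 2.
  rewrite mulrA -[leLHS]mulrC -ler_pdivlMr//.
  by rewrite /h !ge_min lexx !orbT.
pose rho' := rho + h.
have rr' : rho < rho' by rewrite ltrDl.
have rho'0 : 0 < rho' by lra.
pose q := rho / rho'.
have q0 : 0 <= q by rewrite divr_ge0 ?ltW.
have q1 : q < 1 by rewrite ltr_pdivrMr// mul1r.
(* On the circle the mean [S] of the kernels will differ from 1 by at most [4 * k], because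
   [q ^+ N < k] and [1 - q ^+ N > 1 / 2]. The two bounds built into [k] give [S <= 2] and
   [M * (4 * k) <= e / 4]. *)
pose k := Num.min 1 (e / (4 * M)) / 4.
have k0 : 0 < k by rewrite divr_gt0// lt_min ltr01 divr_gt0// mulr_gt0.
have [N N0 qN] : exists2 N, (0 < N)%N & q ^+ N < Num.min (1/2) k.
  have /cvgrPdist_lt H : q ^+ n @[n --> \oo] --> (0 : R) by apply: cvg_expr; rewrite ger0_norm.
  have d1 : 0 < Num.min (1 / 2) k by rewrite lt_min divr_gt0.
  have [N _ HN] := H _ d1; exists N.+1 => //.
  by have := HN N.+1 (leqnSn N); rewrite /= sub0r normrN ger0_norm// exprn_ge0.
have [qN1 qN2] : q ^+ N < 1 / 2 /\ q ^+ N < k by move: qN; rewrite lt_min => /andP[].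
have qN0 : 0 <= q ^+ N by rewrite exprn_ge0.
pose A (j : 'I_N) := rho'%:C * unit_root R N j.
have mA j : modulus (A j) = rho'.
  by rewrite modulusM modulus_cis mulr1 modulus_real gtr0_norm.
pose p (j : 'I_N) := c + rho%:C * unit_root R N j.
have Kp j : K (p j) by rewrite /K /= /p addrC addKr modulusM modulus_cis mulr1.
have NR : 0 < N%:R :> R by rewrite ltr0n.
pose T (z : R[i]^o) : R := N%:R^-1 * \sum_(j < N) phi (p j) * poisson (A j) (z - c).
exists T.
have cT z : modulus (z - c) <= rho -> {for (z : R[i]^o), continuous T}.
  move=> zr; apply: contM; first exact: cont_cst.
  apply: cont_sum => j; apply: contM; first exact: cont_cst.
  by apply: continuous_poisson; rewrite mA; lra.
split => //.
- move=> z r r0 zr.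
  have cc j : continuous_circle_at (fun w => poisson (A j) (w - c)) z r.
    move=> w wz; apply: continuous_poisson; rewrite mA.
    by have := modulusD (w - z) (z - c); rewrite addrA subrK wz; lra.
  have cc2 j : continuous_circle_at (fun w => phi (p j) * poisson (A j) (w - c)) z r.
    by move=> w wz; apply: contM; [exact: cont_cst|exact: cc].
  rewrite /T meanZ// ?mean_sum//; last by move=> w wz; apply: cont_sum => j; exact: cc2.
  congr (_ * _); apply: eq_bigr => j _; rewrite meanZ// mean_poisson// mA; lra.
- move=> z zr.
  have Zr' : modulus (z - c) < rho' by rewrite zr.
  have S1 := sum_poisson N0 rho'0 Zr'.
  set S := N%:R^-1 * \sum_(j < N) poisson (rho'%:C * unit_root R N j) (z - c) in S1.
  have S2 : `|S - 1| <= 4 * k.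
    apply: le_trans S1 _; rewrite zr -/q ler_pdivrMr; last lra.
    apply: (@le_trans _ _ (4 * k * (1 / 2))); first lra.
    rewrite (ler_pM2l (mulr_gt0 (ltr0n R 4) k0)); lra.
  have k1 : 4 * k <= 1 by rewrite /k mulrC divfK// ge_min lexx.
  have k2 : M * (4 * k) <= e / 4.
    have : 4 * k <= e / (4 * M) by rewrite /k mulrC divfK// ge_min lexx orbT.
    by rewrite ler_pdivlMr ?mulr_gt0//; lra.
  pose D := 2 * M * (3 * rho * h / (d / 2) ^+ 2).
  have d2 : 0 < (d / 2) ^+ 2 by rewrite exprn_gt0// divr_gt0.
  have D1 : D <= e / 4 by rewrite /D mulrA ler_pdivrMr.
  (* If [p j] is within [d] of [z], uniform continuity bounds the variation of [phi] by [e / 4].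
     Otherwise [z - c] is at least [d - h >= d / 2] away from [A j], and the kernel is at most
     [3 * rho * h / (d / 2) ^+ 2]. The total error is at most [e / 4 * S + D + M * (4 * k) <= e]. *)
  have term (j : 'I_N) : `|phi (p j) - phi z| * poisson (A j) (z - c) <=
      e / 4 * poisson (A j) (z - c) + D.
    have P0 : 0 <= poisson (A j) (z - c) by rewrite poisson_ge0// mA zr ltW.
    have D0 : 0 <= D by rewrite /D mulr_ge0 ?divr_ge0 ?mulr_ge0 ?ltW.
    have [pd|pd] := ltP (modulus (p j - z)) d.
      rewrite -[leLHS]addr0 lerD// ler_wpM2r// ltW//.
      by apply: phid.
    have h1 : `|phi (p j) - phi z| <= 2 * M.
      have := phiM _ (Kp j); have := phiM _ zr; have := ler_normB (phi (p j)) (phi z).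
      lra.
    have h2 : d / 2 <= modulus (A j - (z - c)).
      have e1 : p j - z - (A j - (z - c)) = (rho - rho')%:C * unit_root R N j.
        by rewrite rmorphB /A /p; ring.
      have := modulus_le_dist (p j - z) (A j - (z - c)).
      rewrite e1 modulusM modulus_cis mulr1 modulus_real.
      rewrite (_ : rho - rho' = - h) ?normrN ?gtr0_norm//; last by rewrite /rho'; ring.
      lra.
    apply: (@le_trans _ _ D); last by rewrite lerDr mulr_ge0// ltW.
    apply: ler_pM => //; rewrite /poisson mA zr.
    apply: ler_pM; first by rewrite subr_ge0 ler_sqr ?nnegrE; lra.
    - by rewrite invr_ge0 sqr_ge0.
    - have -> : rho' ^+ 2 - rho ^+ 2 = (2 * rho + h) * h by rewrite /rho'; ring.
      by rewrite ler_pM2r//; lra.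
    - have h3 : 0 < modulus (A j - (z - c)) by apply: lt_le_trans h2; rewrite divr_gt0.
      rewrite lef_pV2 ?posrE ?exprn_gt0 ?divr_gt0//.
      by rewrite ler_sqr ?nnegrE ?modulus_ge0// ltW// divr_gt0.
  have -> : T z - phi z = N%:R^-1 * \sum_(j < N) (phi (p j) - phi z) * poisson (A j) (z - c)
      + phi z * (S - 1).
    under [in RHS]eq_bigr do rewrite mulrBl.
    rewrite sumrB -mulr_sumr /T /S /A; ring.
  have t1 : `|N%:R^-1 * \sum_(j < N) (phi (p j) - phi z) * poisson (A j) (z - c)| <=
      e / 4 * S + D.
    have NV : 0 <= N%:R^-1 :> R by rewrite invr_ge0 ltW.
    rewrite normrM (ger0_norm NV).
    apply: (@le_trans _ _ (N%:R^-1 * \sum_(j < N) (e / 4 * poisson (A j) (z - c) + D))).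
      rewrite ler_pM2l ?invr_gt0//; apply: le_trans (ler_norm_sum _ _ _) _.
      apply: ler_sum => j _; rewrite normrM [`|poisson _ _|]ger0_norm//.
      by rewrite poisson_ge0// mA zr ltW.
    rewrite big_split /= -mulr_sumr sumr_const card_ord mulrDr.
    by rewrite [_^-1 * (e / 4 * _)]mulrCA -(mulr_natl D) mulKf ?gt_eqF.
  have t2 : `|phi z * (S - 1)| <= M * (4 * k).
    by rewrite normrM; apply: ler_pM => //; exact: phiM.
  have S3 : S <= 2 by move: S2; rewrite ler_norml => /andP[_]; lra.
  have : e / 4 * S <= e / 4 * 2 by rewrite ler_pM2l.
  move=> S4; apply: le_trans (ler_normD _ _) _; lra.
- move=> phi0 z zr.
  have Tc : T c = N%:R^-1 * \sum_(j < N) phi (p j).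
    congr (_ * _); apply: eq_bigr => j _; rewrite subrr poisson0r ?mulr1//.
    by rewrite -modulus_gt0 mA.
  rewrite Tc mulrCA /T ler_pM2l ?invr_gt0// mulr_sumr; apply: ler_sum => j _.
  rewrite mulrC ler_wpM2l ?phi0//; first exact: Kp.
  have zA : rho < modulus (A j) by rewrite mA.
  have z0 := modulus_ge0 (z - c).
  apply: le_trans (poisson_Harnack (ltW zr) zA); rewrite mA.
  rewrite ler_pdivrMr; last lra.
  rewrite mulrAC ler_pdivlMr; last lra.
  have : 0 <= (rho' - rho) * modulus (z - c) by rewrite mulr_ge0//; lra.
  lra.
Qed.

End HarmonicApproximation.

(** * From small circles to circles of any radius *)

Section GlobalSubMean.
Context (R : realType).
Implicit Types (z w c a : R[i]) (x y r s t e : R) (u v T : R[i]^o -> R).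

Lemma harm_pt_disk T c rho :
  (forall z, modulus (z - c) <= rho -> {for (z : R[i]^o), continuous T}) ->
  (forall z r, 0 <= r -> modulus (z - c) + r <= rho -> mean T z r = T z) ->
  forall z, modulus (z - c) < rho -> harm_pt T z.
Proof.
move=> cT mT z zr; have d0 : 0 < rho - modulus (z - c) by rewrite subr_gt0.
split.
  apply/nbhs_plane; exists (rho - modulus (z - c)) => // w wz; apply: cT.
  by have := modulusD (w - z) (z - c); rewrite addrA subrK; lra.
near=> r; apply: mT => //.
have : r < rho - modulus (z - c) by near: r; exact: nbhs_right_lt.
lra.
Unshelve. all: by end_near. Qed.

(** By the maximum principle the harmonic approximant [T] of the values of [u] on the circle
    satisfies [u <= T + e / 2] in the disk, and its value at the centre is its own mean. *)
Lemma sub_mean_global u c r : 0 < r ->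
  (forall z, modulus (z - c) <= r -> {for (z : R[i]^o), continuous u}) ->
  (forall z, modulus (z - c) < r -> subh_pt u z) -> u c <= mean u c r.
Proof.
move=> r0 cu su; apply/ler_addgt0Pr => e e0.
have e20 : 0 < e / 2 by rewrite divr_gt0.
have cu' : continuous_circle_at u c r by move=> z zr; apply: cu; rewrite zr.
have [T [cT mT Tu _]] := harmonic_approximation r0 e20 cu'.
have cT' : continuous_circle_at T c r by move=> z zr; apply: cT; rewrite zr.
have H z : modulus (z - c) <= r -> u z - (T z + e / 2) <= 0.
  apply: (@disk_maximum_principle R (fun z => u z - (T z + e / 2)) c r) => {}z zr.
  - by apply: contB; [exact: cu|apply: contD; [exact: cT|exact: cont_cst]].
  - apply: subh_ptB; first exact: su.
    by apply: harm_ptD; [exact: (harm_pt_disk cT mT)|exact: harm_cst].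
  - by have := Tu z zr; rewrite ler_norml => /andP[]; lra.
have := H c; rewrite subrr modulus0 => /(_ (ltW r0)) Hc.
have : mean T c r = T c by apply: mT; [exact: ltW|rewrite subrr modulus0 add0r].
have : mean T c r <= mean (fun z => u z + e / 2) c r.
  apply: le_mean => //; first exact: ltW.
    by move=> z zr; apply: contD; [exact: cu'|exact: cont_cst].
  by move=> z zr; have := Tu z zr; rewrite ler_norml => /andP[]; lra.
rewrite (meanD (ltW r0)) ?mean_cst//; last by move=> z _; exact: cont_cst.
lra.
Qed.

End GlobalSubMean.

(** * Parameter dependence and interchange of integrals *)

Section ParametricIntegral.
Context (R : realType).
Implicit Types (a b c d e x y r s t X Y : R).
Local Notation mu := lebesgue_measure.

Lemma le_norm_integral_cst a b (f : R -> R) e : a <= b -> continuous f ->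
  (forall t, a <= t <= b -> `|f t| <= e) ->
  `|\int[mu]_(t in `[a, b]) f t| <= e * (b - a).
Proof.
move=> ab cf fe.
have i1 := integrable_continuous a b cf.
have cn : continuous (fun t => `|f t|).
  move=> t; apply: (@cont_comp _ _ _ (fun x : R => `|x|) f); last exact: cf.
  exact: norm_continuous.
apply: le_trans (le_normr_Rintegral _ i1) _ => //.
have -> : e * (b - a) = \int[mu]_(t in `[a, b]) e.
  rewrite Rintegral_cst//= lebesgue_measure_itv /= lte_fin.
  case: ifPn => [_|]; first by rewrite -EFinB.
  by rewrite -leNgt => ba; have -> : b = a; [by apply/le_anti; rewrite ba|by rewrite subrr mulr0].
apply: le_Rintegral => //; try apply: integrable_continuous => //.
by move=> t; exact: cont_cst.
Qed.

Lemma cont_pair (T U V : topologicalType) (f : T -> U) (g : T -> V) (p : T) :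
  {for p, continuous f} -> {for p, continuous g} ->
  {for p, continuous (fun q => (f q, g q))}.
Proof. by move=> cf cg; exact: cvg_pair cf cg. Qed.

Lemma continuous_section1 (T : topologicalType) (G : T * R -> R) (p : T) :
  continuous G -> continuous (fun y => G (p, y)).
Proof.
move=> cG y; apply: (@continuous_comp _ _ _ (fun y => (p, y)) G); last exact: cG.
by apply: (@cont_pair _ _ _ (fun=> p) id); [exact: cvg_cst|exact: cvg_id].
Qed.

Lemma continuous_section2 (G : R * R -> R) y :
  continuous G -> continuous (fun x => G (x, y)).
Proof.
move=> cG x; apply: (@continuous_comp _ _ _ (fun x => (x, y)) G); last exact: cG.
by apply: cont_pair; [exact: cvg_id|exact: cvg_cst].
Qed.

(** Compactness of [[a, b]] makes the continuity in the parameter uniform in [y], for an arbitrary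
    topological space of parameters. *)
Lemma continuous_parametric_integral (T : topologicalType) (G : T * R -> R) a b :
  a < b -> continuous G -> continuous (fun p : T => \int[mu]_(y in `[a, b]) G (p, y)).
Proof.
move=> ab cG p.
have FF : ProperFilter (nbhs p) by exact: nbhs_pfilter.
apply/(@cvgrPdist_le _ _ _ (nbhs p)) => e e0.
have e1 : 0 < e / (b - a) by rewrite divr_gt0// subr_gt0.
have e2 : 0 < e / (b - a) / 2 by rewrite divr_gt0.
pose P (p' : T) y := `|G (p, y) - G (p', y)| <= e / (b - a).
have H : forall y, `[a, b]%classic y -> \forall y' \near y & p' \near p, P p' y'.
  move=> y _.
  have /cvgrPdist_lt/(_ _ e2)[[A B] /= [Ap By] AB] := cG (p, y).
  exists (B, A); first by split.
  move=> [y' p'] /= [By' Ap']; rewrite /P.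
  have h1 := AB (p, y') (conj (nbhs_singleton Ap) By').
  have h2 := AB (p', y') (conj Ap' By').
  rewrite /= in h1 h2.
  have -> : G (p, y') - G (p', y') = (G (p, y) - G (p', y')) - (G (p, y) - G (p, y')) by ring.
  apply: le_trans (ler_normB _ _) _; rewrite [leRHS](splitr); apply: lerD; exact: ltW.
have cab := @segment_compact R a b.
move/compact_near_coveringP/(_ _ (nbhs p) P FF H) : cab.
apply: filterS => p' Pp'.
have i1 := integrable_continuous a b (@continuous_section1 T G p cG).
have i2 := integrable_continuous a b (@continuous_section1 T G p' cG).
rewrite -(RintegralB _ i1 i2)//.
have -> : e = e / (b - a) * (b - a) by rewrite divfK// subr_eq0 gt_eqF.
apply: le_norm_integral_cst => //; first exact: ltW.
by move=> t; apply: contB; exact: continuous_section1.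
Qed.

Lemma continuous_swap (G : R * R -> R) : continuous G ->
  continuous (fun p : R * R => G (p.2, p.1)).
Proof.
move=> cG p; apply: (@continuous_comp _ _ _ (fun p : R * R => (p.2, p.1)) G); last exact: cG.
by apply: cont_pair; [exact: cvg_snd|exact: cvg_fst].
Qed.

(** The difference [H s s'] of the two iterated integrals over [[s, s']] is additive in the interval
    and, by uniform continuity of [G], at most a small multiple of its length when this is below
    [dl]. Cutting [[a, b]] into short pieces shows that it is 0. *)
Lemma integral_swap (G : R * R -> R) a b c d : a < b -> c < d -> continuous G ->
  \int[mu]_(x in `[a, b]) (\int[mu]_(y in `[c, d]) G (x, y)) =
  \int[mu]_(y in `[c, d]) (\int[mu]_(x in `[a, b]) G (x, y)).
Proof.
move=> ab cd cG.
have cGy := continuous_parametric_integral cd cG.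
have cGx s s' : s < s' -> continuous (fun y => \int[mu]_(x in `[s, s']) G (x, y)).
  by move=> ss'; exact: (continuous_parametric_integral ss' (continuous_swap cG)).
pose H s s' := \int[mu]_(x in `[s, s']) (\int[mu]_(y in `[c, d]) G (x, y)) -
  \int[mu]_(y in `[c, d]) (\int[mu]_(x in `[s, s']) G (x, y)).
suff : H a b = 0 by move/eqP; rewrite subr_eq0 => /eqP.
apply/eqP; rewrite -normr_le0; apply/ler_addgt0Pr => e e0; rewrite add0r.
(* Chosen so that the final bound [2 * k * (d - c) * (b - a)] equals [e]. *)
pose k := e / (2 * (d - c) * (b - a)).
have k0 : 0 < k by rewrite divr_gt0// !mulr_gt0 ?subr_gt0.
pose u (z : R[i]^o) := G (complex.Re z, complex.Im z).
have cu : forall z : R[i]^o, True -> {for z, continuous u}.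
  move=> z _; apply: (@continuous_comp _ _ _ (fun z : R[i]^o => (complex.Re z, complex.Im z)) G).
    by apply: cont_pair; [exact: continuous_Re|exact: continuous_Im].
  exact: cG.
pose X := `|a| + `|b| + `|c| + `|d|.
have [dl dl0 Hdl] := uniform_continuity_compact (@compact_cdisk R 0 X)
   (fun z _ => cu z I) k0.
have G_unif x x' y : a <= x <= b -> c <= y <= d -> `|x' - x| < dl ->
    `|G (x', y) - G (x, y)| <= k.
  move=> /andP[ax xb] /andP[cy yd] xx'; apply/ltW; apply: (Hdl (x +i* y) (x' +i* y)).
    rewrite /cdisk /= subr0; apply: le_trans (modulus_le_sum _ _) _.
    have A x0 a0 b0 : a0 <= x0 -> x0 <= b0 -> `|x0| <= `|a0| + `|b0|.
      move=> h1 h2; rewrite ler_norml; apply/andP; split.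
        by have := ler_norm (- a0); rewrite normrN; have := normr_ge0 b0; lra.
      by have := ler_norm b0; have := normr_ge0 a0; lra.
    by have := A _ _ _ ax xb; have := A _ _ _ cy yd; rewrite /X; lra.
  have -> : x' +i* y - (x +i* y) = (x' - x)%:C.
    by apply/eqP; rewrite eq_complex /= subrr !eqxx.
  by rewrite modulus_real.
have small s s' : a <= s -> s < s' -> s' <= b -> s' - s < dl ->
    `|H s s'| <= 2 * k * (d - c) * (s' - s).
  move=> as_ ss' s'b sdl.
  (* Both iterated integrals are compared with [(s' - s) * J], the result of freezing the first
     variable at [s]. *)
  pose J := \int[mu]_(y in `[c, d]) G (s, y).
  have cs := @continuous_section1 _ G s cG.
  have cJ : continuous (fun _ : R => J) by move=> ?; exact: cont_cst.
  have c3 : continuous (fun y => (s' - s) * G (s, y)).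
    by move=> y; exact: (contM (@cont_cst R R y (s' - s)) (cs y)).
  have H1 : `|\int[mu]_(x in `[s, s']) ((\int[mu]_(y in `[c, d]) G (x, y)) - J)| <=
      k * (d - c) * (s' - s).
    apply: le_norm_integral_cst; first exact: ltW.
      by move=> x; exact: (contB (cGy x) (cJ x)).
    move=> x /andP[sx xs']; rewrite -RintegralB//; try by apply: integrable_continuous; exact: continuous_section1.
    apply: le_norm_integral_cst; first exact: ltW.
      by move=> y; apply: contB; exact: continuous_section1.
    move=> y cyd; apply: G_unif => //; first by apply/andP; split; lra.
    by rewrite ger0_norm; lra.
  have H2 : `|\int[mu]_(y in `[c, d]) ((\int[mu]_(x in `[s, s']) G (x, y)) - (s' - s) * G (s, y))|
      <= k * (s' - s) * (d - c).
    apply: le_norm_integral_cst; first exact: ltW.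
      by move=> y; exact: (contB (cGx _ _ ss' y) (c3 y)).
    move=> y cyd.
    have -> : (s' - s) * G (s, y) = \int[mu]_(x in `[s, s']) G (s, y).
      by rewrite Rintegral_cst//= lebesgue_measure_itv /= lte_fin ss' -EFinB mulrC.
    rewrite -RintegralB//; last 2 first.
    - by apply: integrable_continuous; exact: continuous_section2.
    - by apply: integrable_continuous => x; exact: cont_cst.
    apply: le_norm_integral_cst; first exact: ltW.
      by move=> x; apply: contB; [exact: continuous_section2|exact: cont_cst].
    move=> x /andP[sx xs']; apply: G_unif => //; first by apply/andP; split; lra.
    by rewrite ger0_norm; lra.
  have E1 : \int[mu]_(x in `[s, s']) ((\int[mu]_(y in `[c, d]) G (x, y)) - J) =
     \int[mu]_(x in `[s, s']) (\int[mu]_(y in `[c, d]) G (x, y)) - (s' - s) * J.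
    rewrite RintegralB//; try by apply: integrable_continuous.
    rewrite Rintegral_cst//= lebesgue_measure_itv /= lte_fin ss' -EFinB /=.
    by rewrite [J * _]mulrC.
  have E2 : \int[mu]_(y in `[c, d]) ((\int[mu]_(x in `[s, s']) G (x, y)) - (s' - s) * G (s, y)) =
     \int[mu]_(y in `[c, d]) (\int[mu]_(x in `[s, s']) G (x, y)) - (s' - s) * J.
    rewrite (RintegralB _ (integrable_continuous c d (cGx _ _ ss')) (integrable_continuous c d c3))//.
    by rewrite (RintegralZl _ _ (integrable_continuous c d cs)).
  have -> : H s s' =
     \int[mu]_(x in `[s, s']) ((\int[mu]_(y in `[c, d]) G (x, y)) - J) -
     \int[mu]_(y in `[c, d]) ((\int[mu]_(x in `[s, s']) G (x, y)) - (s' - s) * G (s, y)).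
    by rewrite E1 E2 /H; ring.
  apply: le_trans (ler_normB _ _) _; move: H1 H2; clear; lra.
have Hadd s s' s'' : s < s' -> s' < s'' -> H s s'' = H s s' + H s' s''.
  move=> h1 h2; have h3 := lt_trans h1 h2.
  rewrite /H (integral_split (ltW h1) (ltW h2) cGy).
  have -> : \int[mu]_(y in `[c, d]) (\int[mu]_(x in `[s, s'']) G (x, y)) =
    \int[mu]_(y in `[c, d]) (\int[mu]_(x in `[s, s']) G (x, y) + \int[mu]_(x in `[s', s'']) G (x, y)).
    apply: eq_Rintegral => y _; apply: integral_split; [exact: ltW|exact: ltW|].
    exact: continuous_section2.
  rewrite (RintegralD _ (integrable_continuous c d (cGx _ _ h1)) (integrable_continuous c d (cGx _ _ h2)))//.
  by rewrite opprD addrACA.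
have [N Ndl] : exists N : nat, (b - a) / N.+1%:R < dl.
  have ba : 0 <= (b - a) / dl by rewrite divr_ge0 ?subr_ge0// ltW.
  exists (Num.bound ((b - a) / dl)); rewrite ltr_pdivrMr// mulrC -ltr_pdivrMr//.
  by apply: lt_trans (archi_boundP ba) _; rewrite ltr_nat.
have [h [h0 hdl hN]] : exists h, [/\ 0 < h, h < dl & h * N.+1%:R = b - a].
  by exists ((b - a) / N.+1%:R); split; rewrite ?divr_gt0 ?subr_gt0// divfK.
have kd : 0 < 2 * k * (d - c) by rewrite mulr_gt0 ?subr_gt0// mulr_gt0.
have step n : (n < N.+1)%N -> `|H a (a + h * n.+1%:R)| <= 2 * k * (d - c) * (h * n.+1%:R).
  elim: n => [|n ih] nN.
    have -> : h * 1%:R = a + h * 1%:R - a by ring.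
    have h1 : h * 1%:R <= h * N.+1%:R by rewrite ler_pM2l// ler_nat.
    rewrite mulr1 in h1 *; rewrite addrCA subrr addr0.
    have := @small a (a + h) (lexx a); rewrite [a + h - a]addrAC subrr add0r.
    apply; lra.
  have h1 : h * n.+2%:R <= h * N.+1%:R by rewrite ler_pM2l// ler_nat.
  have h2 : 0 < h * n.+1%:R by rewrite mulr_gt0.
  have h3 : h * n.+2%:R = h * n.+1%:R + h by rewrite -[n.+2]addn1 natrD mulrDr mulr1.
  rewrite (@Hadd a (a + h * n.+1%:R)); [|lra|lra].
  apply: le_trans (ler_normD _ _) _.
  have := ih (ltnW nN).
  have : `|H (a + h * n.+1%:R) (a + h * n.+2%:R)| <=
      2 * k * (d - c) * (a + h * n.+2%:R - (a + h * n.+1%:R)).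
    by apply: small; lra.
  rewrite h3; move: (H _ _) (H _ _) => H1 H2; clear; lra.
have := step N (ltnSn N); rewrite hN addrC subrK => /le_trans; apply.
rewrite le_eqVlt; apply/orP; left; apply/eqP; rewrite /k; field.
by rewrite !subr_eq0 !gt_eqF.
Qed.

End ParametricIntegral.

(** * Integration over squares and the symmetry of circle averaging *)

Section PlaneIntegral.
Context (R : realType).
Implicit Types (a b e x y r s t X Y : R) (z w zeta : R[i]) (F G h u : R[i]^o -> R).
Local Notation mu := lebesgue_measure.

Definition pint X F : R :=
  \int[mu]_(x in `[- X, X]) \int[mu]_(y in `[- X, X]) F (x +i* y).

Definition avg r F : R[i]^o -> R := fun z => mean F z r.

Definition vanishes_off Y F := forall z, Y < modulus z -> F z = 0.

Lemma continuous_row F x : continuous F -> continuous (fun y => F (x +i* y)).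
Proof.
move=> cF y; apply: (@continuous_comp _ _ _ (fun y => x +i* y : R[i]^o) F); last exact: cF.
by apply: (@continuous_Complex R R (fun=> x) id); [exact: cvg_cst|exact: cvg_id].
Qed.

Lemma continuous_Complex_pair : continuous (fun p : R * R => p.1 +i* p.2 : R[i]^o).
Proof. by move=> p; apply: continuous_Complex; [exact: cvg_fst|exact: cvg_snd]. Qed.

Lemma continuous_plane_pair F : continuous F -> continuous (fun p : R * R => F (p.1 +i* p.2)).
Proof.
move=> cF p; apply: (@continuous_comp _ _ _ (fun p : R * R => p.1 +i* p.2 : R[i]^o) F).
  exact: continuous_Complex_pair.
exact: cF.
Qed.

Lemma continuous_inner_pint F X : 0 < X -> continuous F ->
  continuous (fun x => \int[mu]_(y in `[- X, X]) F (x +i* y)).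
Proof.
move=> X0 cF; have XX : - X < X by lra.
exact: (continuous_parametric_integral XX (continuous_plane_pair cF)).
Qed.

Lemma pintD F G X : 0 < X -> continuous F -> continuous G ->
  pint X (fun z => F z + G z) = pint X F + pint X G.
Proof.
move=> X0 cF cG; rewrite /pint -RintegralD//;
  try by apply: integrable_continuous; exact: continuous_inner_pint.
apply: eq_Rintegral => x _; rewrite RintegralD//;
  by apply: integrable_continuous; exact: continuous_row.
Qed.

Lemma continuousZ s F : continuous F -> continuous (fun z : R[i]^o => s * F z).
Proof. by move=> cF z; exact: (contM (@cont_cst R R[i]^o z s) (cF z)). Qed.

Lemma pintZ s F X : 0 < X -> continuous F -> pint X (fun z => s * F z) = s * pint X F.
Proof.
move=> X0 cF; rewrite /pint -RintegralZl//;
  try by apply: integrable_continuous; exact: continuous_inner_pint.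
apply: eq_Rintegral => x _; rewrite RintegralZl//.
by apply: integrable_continuous; exact: continuous_row.
Qed.

Lemma eq_pint F G X : (forall z, F z = G z) -> pint X F = pint X G.
Proof. by move=> FG; congr pint; apply/funext. Qed.

Lemma pintB F G X : 0 < X -> continuous F -> continuous G ->
  pint X (fun z => F z - G z) = pint X F - pint X G.
Proof.
move=> X0 cF cG; have cG' := @continuousZ (-1) _ cG.
rewrite -mulN1r -(pintZ (-1) X0 cG) -(pintD X0 cF cG').
by apply: eq_pint => z; rewrite mulN1r.
Qed.

Lemma le_pint F G X : 0 < X -> continuous F -> continuous G -> (forall z, F z <= G z) ->
  pint X F <= pint X G.
Proof.
move=> X0 cF cG FG; apply: le_Rintegral => //;
  try by apply: integrable_continuous; exact: continuous_inner_pint.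
move=> x _; apply: le_Rintegral => //; by apply: integrable_continuous; exact: continuous_row.
Qed.

Lemma pint_ge0 F X : (forall z, 0 <= F z) -> 0 <= pint X F.
Proof. by move=> F0; apply: Rintegral_ge0 => x _; exact: Rintegral_ge0. Qed.

Lemma pint0 X : pint X (fun=> 0) = 0.
Proof. by rewrite /pint !Rintegral_cst// !mul0r. Qed.

Lemma pint_sum (I : Type) (S : seq I) (F : I -> R[i]^o -> R) X : 0 < X ->
  (forall i, continuous (F i)) ->
  pint X (fun z => \sum_(i <- S) F i z) = \sum_(i <- S) pint X (F i).
Proof.
move=> X0 cF; elim: S => [|i S ih].
  rewrite big_nil -[RHS](pint0 X); apply: eq_pint => z; exact: big_nil.
have cS : continuous (fun z : R[i]^o => \sum_(j <- S) F j z).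
  by move=> z; apply: cont_sum => j; exact: cF.
rewrite big_cons -ih -(pintD X0 (cF i) cS).
by apply: eq_pint => z; rewrite big_cons.
Qed.

Lemma integral_trunc (f : R -> R) a b Y : continuous f -> 0 <= Y -> a <= - Y -> Y <= b ->
  (forall t, Y < `|t| -> f t = 0) ->
  \int[mu]_(t in `[a, b]) f t = \int[mu]_(t in `[- Y, Y]) f t.
Proof.
move=> cf Y0 aY Yb f0.
have YY : - Y <= Y by lra.
rewrite (integral_split aY (le_trans YY Yb) cf) (integral_split YY Yb cf).
(* The hypothesis is strict, so the endpoints, which belong to the outer closed intervals, are
   settled by continuity. *)
have fYY : f (- Y) = 0 /\ f Y = 0.
  have key s : `|s| = Y -> f s = 0.
    move=> sY; apply/eqP; rewrite -normr_le0; apply/ler_addgt0Pr => e e0; rewrite add0r.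
    have /cvgrPdist_lt/(_ _ e0)/nbhs_ballP[d /= d0 dA] := cf s.
    have d20 : 0 < d / 2 by rewrite divr_gt0.
    have d2d : d / 2 < d by rewrite ltr_pdivrMr// ltr_pMr// ltr1n.
    have [sg|sg] := leP 0 s.
      have h1 : `|s - (s + d / 2)| < d.
        by rewrite opprD addrA subrr add0r normrN gtr0_norm.
      have h2 : f (s + d / 2) = 0 by apply: f0; rewrite -sY !ger0_norm ?ltrDl// addr_ge0// ltW.
      by have := dA _ h1; rewrite h2 subr0 => /ltW.
    have h1 : `|s - (s - d / 2)| < d.
      by rewrite opprB addrC subrK gtr0_norm.
    have h2 : f (s - d / 2) = 0.
      have sd : s - d / 2 < 0 by rewrite subr_lt0 (lt_trans sg).
      by apply: f0; rewrite -sY (ltr0_norm sg) (ltr0_norm sd) opprB ltrDr.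
    by have := dA _ h1; rewrite h2 subr0 => /ltW.
  by split; apply: key; rewrite ?normrN ger0_norm.
have z1 : \int[mu]_(t in `[a, - Y]) f t = 0.
  transitivity (\int[mu]_(_ in `[a, - Y]) (0 : R)); last by rewrite Rintegral_cst// mul0r.
  apply: eq_Rintegral => t; rewrite inE /= in_itv /= => /andP[_].
  rewrite le_eqVlt => /orP[/eqP->|tY]; first by case: fYY.
  by apply: f0; rewrite ltr0_norm; lra.
have z2 : \int[mu]_(t in `[Y, b]) f t = 0.
  transitivity (\int[mu]_(_ in `[Y, b]) (0 : R)); last by rewrite Rintegral_cst// mul0r.
  apply: eq_Rintegral => t; rewrite inE /= in_itv /= => /andP[+ _].
  rewrite le_eqVlt => /orP[/eqP<-|tY]; first by case: fYY.
  by apply: f0; rewrite gtr0_norm; lra.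
by rewrite z1 z2 add0r addr0.
Qed.

Lemma integral_shift (f : R -> R) b Y X : continuous f -> 0 <= Y -> Y + `|b| <= X -> 0 < X ->
  (forall t, Y < `|t| -> f t = 0) ->
  \int[mu]_(t in `[- X, X]) f (t + b) = \int[mu]_(t in `[- X, X]) f t.
Proof.
move=> cf Y0 YX X0 f0.
have XX : - X < X by lra.
have b1 := ler_norm b; have b2 := ler_norm (- b); rewrite normrN in b2.
have := @integral_affine R (- X) X 1 b f XX ltr01 cf.
rewrite !mul1r invr1 mul1r.
under eq_Rintegral do rewrite mul1r.
move=> ->; rewrite (@integral_trunc f (- X + b) (X + b) Y)//; [|lra|lra].
by rewrite (@integral_trunc f (- X) X Y)//; lra.
Qed.

Lemma pint_shift F zeta Y X : continuous F -> 0 <= Y -> Y + modulus zeta <= X -> 0 < X ->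
  vanishes_off Y F -> pint X (fun z => F (z + zeta)) = pint X F.
Proof.
case: zeta => a b cF Y0 YX X0 F0.
have aX := Re_le_modulus (a +i* b); have bX := Im_le_modulus (a +i* b); rewrite /= in aX bX.
pose f x := \int[mu]_(y in `[- X, X]) F (x +i* y).
transitivity (\int[mu]_(x in `[- X, X]) f (x + a)).
  apply: eq_Rintegral => x _.
  rewrite /f -(@integral_shift (fun y => F ((x + a) +i* y)) b Y X)//; last 2 first.
  - by apply: le_trans YX; rewrite lerD2l.
  - by move=> t Yt; apply: F0; apply: lt_le_trans Yt _; exact: (Im_le_modulus ((x + a) +i* t)).
  exact: continuous_row.
rewrite (@integral_shift f a Y X)//.
- exact: continuous_inner_pint.
- by apply: le_trans YX; rewrite lerD2l.
move=> x Yx; rewrite /f.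
transitivity (\int[mu]_(_ in `[- X, X]) (0 : R)); last by rewrite Rintegral_cst// mul0r.
by apply: eq_Rintegral => y _; apply: F0; apply: lt_le_trans Yx _; exact: (Re_le_modulus (x +i* y)).
Qed.

Lemma pint_integral_swap (F : R[i]^o * R -> R) X a b : 0 < X -> a < b -> continuous F ->
  pint X (fun z => \int[mu]_(t in `[a, b]) F (z, t)) =
  \int[mu]_(t in `[a, b]) pint X (fun z => F (z, t)).
Proof.
move=> X0 ab cF; have XX : - X < X by lra.
have c3 : continuous (fun p : (R * R) * R => F (p.1.1 +i* p.2, p.1.2)).
  move=> p; apply: (@continuous_comp _ _ _
    (fun p : (R * R) * R => (p.1.1 +i* p.2 : R[i]^o, p.1.2)) F); last exact: cF.
  apply: (@cont_pair _ _ _ (fun p : (R * R) * R => p.1.1 +i* p.2 : R[i]^o) (fun p => p.1.2)).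
    apply: (@continuous_Complex R _ (fun p : (R * R) * R => p.1.1) snd); last exact: cvg_snd.
    by apply: (@continuous_comp _ _ _ fst fst); exact: cvg_fst.
  by apply: (@continuous_comp _ _ _ fst snd); [exact: cvg_fst|exact: cvg_snd].
have cG : continuous (fun p : R * R => \int[mu]_(y in `[- X, X]) F (p.1 +i* y, p.2)).
  exact: (continuous_parametric_integral XX c3).
rewrite /pint -(integral_swap XX ab cG).
apply: eq_Rintegral => x _.
have c2 : continuous (fun p : R * R => F (x +i* p.1, p.2)).
  move=> p; apply: (@continuous_comp _ _ _ (fun p : R * R => (x +i* p.1 : R[i]^o, p.2)) F);
    last exact: cF.
  apply: (@cont_pair _ _ _ (fun p : R * R => x +i* p.1 : R[i]^o) snd); last exact: cvg_snd.
  by apply: (@continuous_Complex R _ (fun=> x) fst); [exact: cvg_cst|exact: cvg_fst].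
exact: (integral_swap XX ab c2).
Qed.

Lemma continuous_add_circle F r : continuous F ->
  continuous (fun p : R[i]^o * R => F (p.1 + r%:C * cis p.2)).
Proof.
move=> cF p; apply: (@continuous_comp _ _ _
  (fun p : R[i]^o * R => p.1 + r%:C * cis p.2 : R[i]^o) F); last exact: cF.
have -> : (fun p : R[i]^o * R => p.1 + r%:C * cis p.2 : R[i]^o) = (fun p : R[i]^o * R =>
    (complex.Re p.1 + r * cos p.2) +i* (complex.Im p.1 + r * sin p.2)).
  by apply/funext => q; exact: circleE.
apply: (@continuous_Complex R _ (fun p : R[i]^o * R => complex.Re p.1 + r * cos p.2)
  (fun p => complex.Im p.1 + r * sin p.2)).
  apply: contD.
    by apply: (@continuous_comp _ _ _ fst (@complex.Re R : R[i]^o -> R));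
      [exact: cvg_fst|exact: continuous_Re].
  apply: contM; first exact: cont_cst.
  by apply: (@continuous_comp _ _ _ snd (@cos R)); [exact: cvg_snd|exact: continuous_cos].
apply: contD.
  by apply: (@continuous_comp _ _ _ fst (@complex.Im R : R[i]^o -> R));
    [exact: cvg_fst|exact: continuous_Im].
apply: contM; first exact: cont_cst.
by apply: (@continuous_comp _ _ _ snd (@sin R)); [exact: cvg_snd|exact: continuous_sin].
Qed.

Lemma continuous_avg F r : continuous F -> continuous (avg r F).
Proof.
move=> cF; apply: (@continuousZ (2 * pi)^-1
  (fun z => \int[mu]_(t in `[0, 2 * pi]) F (z + r%:C * cis t))).
exact: (@continuous_parametric_integral R R[i]^o (fun p => F (p.1 + r%:C * cis p.2)) 0 _
  (twopi_gt0 R) (@continuous_add_circle F r cF)).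
Qed.

Lemma continuous_along F r z : continuous F -> continuous (fun t => F (z + r%:C * cis t)).
Proof.
move=> cF t; apply: (@continuous_comp _ _ _ (fun t => z + r%:C * cis t : R[i]^o) F).
  exact: continuous_circle.
exact: cF.
Qed.

Lemma avg_opp F r z : continuous F ->
  \int[mu]_(t in `[0, 2 * pi]) F (z - r%:C * cis t) =
  \int[mu]_(t in `[0, 2 * pi]) F (z + r%:C * cis t).
Proof.
move=> cF.
have cphi := @continuous_along F r z cF.
have per t : F (z + r%:C * cis (t + 2 * pi)) = F (z + r%:C * cis t) by rewrite cis_periodic.
rewrite -[RHS](integral_periodic_shift (ltW (pi_gt0 R)) (twopi_gt0 R) cphi per).
have := integral_affine pi (twopi_gt0 R) ltr01 cphi.
rewrite mulr0 add0r !mul1r invr1 mul1r [2 * pi + pi]addrC => <-.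
by apply: eq_Rintegral => t _; rewrite mul1r cisDpi mulrN.
Qed.

Lemma continuousM F G : continuous F -> continuous G -> continuous (fun z : R[i]^o => F z * G z).
Proof. by move=> cF cG z; apply: contM; [exact: cF|exact: cG]. Qed.

Lemma continuous_translate F zeta : continuous F -> continuous (fun z : R[i]^o => F (z + zeta)).
Proof.
move=> cF z; apply/continuous_plane => e e0.
have /continuous_plane/(_ _ e0)[d d0 dA] := cF (z + zeta).
by exists d => // w wz; apply: dA; rewrite opprD addrACA subrr addr0.
Qed.

(** Circle averaging is self-adjoint. For each angle a translation by -r e^(it) moves the shift from
    [h] to [F], and the symmetry of the circle absorbs the sign. The factor [F] confines the product
    to a bounded set, which justifies the translation. *)
Lemma pint_avg_sym F h r Y X : 0 <= r -> continuous F -> continuous h -> 0 <= Y -> Y + r <= X ->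
  0 < X -> vanishes_off Y F ->
  pint X (fun z => F z * avg r h z) = pint X (fun z => h z * avg r F z).
Proof.
move=> r0 cF ch Y0 YX X0 F0.
have ch2 := @continuous_add_circle h r ch.
have cN : continuous (fun p : R[i]^o * R => F (p.1 - r%:C * cis p.2)).
  have := @continuous_add_circle F (- r) cF.
  by under eq_fun do rewrite rmorphN mulNr.
have c1 : continuous (fun p : R[i]^o * R => F p.1 * h (p.1 + r%:C * cis p.2)).
  move=> p; apply: contM; last exact: ch2.
  by apply: (@continuous_comp _ _ _ fst F); [exact: cvg_fst|exact: cF].
have c2 : continuous (fun p : R[i]^o * R => h p.1 * F (p.1 - r%:C * cis p.2)).
  move=> p; apply: contM; last exact: cN.
  by apply: (@continuous_comp _ _ _ fst h); [exact: cvg_fst|exact: ch].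
have ciL z : continuous (fun t => h (z + r%:C * cis t)) by exact: continuous_along.
have ciR z : continuous (fun t => F (z - r%:C * cis t)).
  by have := @continuous_along F (- r) z cF; under eq_fun do rewrite rmorphN mulNr.
have cI1 : continuous (fun z : R[i]^o => \int[mu]_(t in `[0, 2 * pi]) (F z * h (z + r%:C * cis t))).
  exact: (continuous_parametric_integral (twopi_gt0 R) c1).
have cI2 : continuous (fun z : R[i]^o => \int[mu]_(t in `[0, 2 * pi]) (h z * F (z - r%:C * cis t))).
  exact: (continuous_parametric_integral (twopi_gt0 R) c2).
transitivity ((2 * pi)^-1 * pint X (fun z => \int[mu]_(t in `[0, 2 * pi]) (F z * h (z + r%:C * cis t)))).
  rewrite -(pintZ _ X0 cI1); apply: eq_pint => z.
  by rewrite (RintegralZl _ _ (integrable_continuous 0 (2 * pi) (ciL z)))// /avg /mean mulrCA.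
transitivity ((2 * pi)^-1 * pint X (fun z => \int[mu]_(t in `[0, 2 * pi]) (h z * F (z - r%:C * cis t)))); last first.
  rewrite -(pintZ _ X0 cI2); apply: eq_pint => z.
  rewrite (RintegralZl _ _ (integrable_continuous 0 (2 * pi) (ciR z)))// (avg_opp r z cF).
  by rewrite /avg /mean mulrCA.
apply: (congr1 (fun x => (2 * pi)^-1 * x)).
transitivity (\int[mu]_(t in `[0, 2 * pi]) pint X (fun z => F z * h (z + r%:C * cis t))).
  exact: (pint_integral_swap X0 (twopi_gt0 R) c1).
transitivity (\int[mu]_(t in `[0, 2 * pi]) pint X (fun z => h z * F (z - r%:C * cis t))); last first.
  by symmetry; exact: (pint_integral_swap X0 (twopi_gt0 R) c2).
apply: eq_Rintegral => t _ /=.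
have mr : modulus (r%:C * cis t) = r by rewrite modulusM modulus_cis mulr1 modulus_real ger0_norm.
have <- := @pint_shift (fun z => F z * h (z + r%:C * cis t)) (- (r%:C * cis t)) Y X.
- by apply: eq_pint => z; rewrite subrK mulrC.
- by apply: continuousM => //; exact: continuous_translate.
- by [].
- by rewrite modulusN mr.
- by [].
- by move=> z /F0 ->; rewrite mul0r.
Qed.

Lemma avg_cst r s : avg r (fun=> s) = fun=> s.
Proof. by apply/funext => z; exact: mean_cst. Qed.

(* Positivity of the Dirichlet form, for pairs F, h that vary in the same sense. *)
Lemma pint_avg_le F h r Y X : 0 <= r -> continuous F -> continuous h -> 0 <= Y -> Y + r <= X ->
  0 < X -> vanishes_off Y F ->
  (forall z w, 0 <= (F z - F w) * (h z - h w)) ->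
  pint X (fun z => F z * avg r h z) <= pint X (fun z => F z * h z).
Proof.
move=> r0 cF ch Y0 YX X0 F0 mono.
have dbl (a b : R) : a + a <= b + b -> a <= b by lra.
have cFh := continuousM cF ch.
have cA := @continuous_avg h r ch; have cAF := @continuous_avg F r cF; have cAFh := @continuous_avg _ r cFh.
(* This is the mean over [w] on the circle about [z] of [(F z - F w) * (h z - h w) >= 0],
   expanded. *)
have P z : F z * avg r h z + h z * avg r F z <= F z * h z + avg r (fun w => F w * h w) z.
  have ccF : continuous_circle_at F z r by move=> w _; exact: cF.
  have cch : continuous_circle_at h z r by move=> w _; exact: ch.
  have ccFh : continuous_circle_at (fun w => F w * h w) z r by move=> w _; exact: cFh.
  have ccZ s (u : R[i]^o -> R) : continuous_circle_at u z r ->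
      continuous_circle_at (fun w => s * u w) z r.
    by move=> cu w wr; apply: contM; [exact: cont_cst|exact: cu].
  have cc0 : continuous_circle_at (fun=> F z * h z) z r by move=> w _; exact: cont_cst.
  have ccD (u v : R[i]^o -> R) : continuous_circle_at u z r -> continuous_circle_at v z r ->
      continuous_circle_at (fun w => u w + v w) z r.
    by move=> cu cv w wr; apply: contD; [exact: cu|exact: cv].
  rewrite -[in leRHS](mean_cst (F z * h z) z r) /avg -!meanZ// -!meanD//; try exact: ccZ.
  apply: le_mean => //; try (apply: ccD => //; exact: ccZ).
  by move=> w _; have := mono z w; lra.
have e1 := pint_avg_sym r0 cF ch Y0 YX X0 F0.
have FH0 : vanishes_off Y (fun z => F z * h z) by move=> z /F0 ->; rewrite mul0r.
(* Symmetry against the constant 1: averaging preserves the integral of [F * h]. *)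
have e2 := pint_avg_sym r0 cFh (fun z => @cont_cst R R[i]^o z 1) Y0 YX X0 FH0.
have := le_pint X0 (F := fun z => F z * avg r h z + h z * avg r F z)
  (G := fun z => F z * h z + avg r (fun w => F w * h w) z) _ _ P.
rewrite (pintD X0 (continuousM cF cA) (continuousM ch cAF)) (pintD X0 cFh cAFh) -e1.
have -> : pint X (avg r (fun w => F w * h w)) = pint X (fun z => F z * h z).
  transitivity (pint X (fun z => 1 * avg r (fun w => F w * h w) z)).
    by apply: eq_pint => z; rewrite mul1r.
  by rewrite -e2; apply: eq_pint => z; rewrite avg_cst mulr1.
have c1 : continuous (fun z : R[i]^o => F z * avg r h z + h z * avg r F z).
  by move=> z; exact: (contD (@continuousM _ _ cF cA z) (@continuousM _ _ ch cAF z)).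
have c2 : continuous (fun z : R[i]^o => F z * h z + avg r (fun w => F w * h w) z).
  by move=> z; exact: (contD (cFh z) (cAFh z)).
move=> /(_ c1 c2); exact: dbl.
Qed.

Lemma pint_gt0 F z X : continuous F -> (forall w, 0 <= F w) -> 0 < F z -> modulus z < X ->
  0 < pint X F.
Proof.
case: z => x0 y0 cF F0 Fz zX.
have X0 : 0 < X by apply: le_lt_trans zX; exact: modulus_ge0.
have XX : - X < X by lra.
rewrite lt_neqAle pint_ge0// andbT eq_sym; apply/eqP => I0.
have xX : - X < x0 < X by rewrite -ltr_norml; apply: le_lt_trans zX; exact: (Re_le_modulus (x0 +i* y0)).
have yX : - X < y0 < X by rewrite -ltr_norml; apply: le_lt_trans zX; exact: (Im_le_modulus (x0 +i* y0)).
have inner_ge0 x : 0 <= \int[mu]_(y in `[- X, X]) F (x +i* y).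
  by apply: Rintegral_ge0 => y _; exact: F0.
have h1 := Rintegral_ge0_eq0 XX (continuous_inner_pint X0 cF) inner_ge0 I0 xX.
have h2 := Rintegral_ge0_eq0 XX (@continuous_row F x0 cF) (fun y => F0 _) h1 yX.
by rewrite h2 ltxx in Fz.
Qed.

End PlaneIntegral.

(** * Truncated logarithms, discrete Laplacians and positivity of the energy *)

Section LogarithmicKernel.
Context (R : realType).
Implicit Types (a b e x y r s t X Y rho : R) (p z w zeta : R[i]) (F G h u : R[i]^o -> R).

(** The logarithmic potential of a unit mass spread evenly over the circle of radius [rho] about
    [p], a finite and continuous substitute for the logarithm. *)
Definition lcut p rho : R[i]^o -> R := fun z => ln (Num.max (modulus (z - p)) rho).

(** A discrete Laplacian: for [r > 0] it is nonnegative on continuous subharmonic functions, and it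
    is zero where [F] agrees with a logarithm on a disk of radius [r] avoiding the pole. *)
Definition lap r F : R[i]^o -> R := fun z => avg r F z - F z.

(** A bump standing for the point mass at [p]: nonnegative, carried by the disk of radius [3 * rho],
    of total mass independent of [p]. The radius [2 * rho] reaches beyond the flat part of [lcut],
    so that the value at [p] is ln 2. *)
Definition kap p rho : R[i]^o -> R := lap (2 * rho) (lcut p rho).

Lemma continuous_lap r F : continuous F -> continuous (lap r F).
Proof. by move=> cF z; exact: (contB (@continuous_avg R F r cF z) (cF z)). Qed.

Lemma continuous_lcut p rho : 0 < rho -> continuous (lcut p rho).
Proof.
move=> r0 z; apply: (@cont_ln R R[i]^o z (fun w => Num.max (modulus (w - p)) rho)).
  by rewrite lt_max r0 orbT.
by apply: cont_max; [exact: continuous_modulusB|exact: cont_cst].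
Qed.

Lemma lcut_far p rho z : rho <= modulus (z - p) -> lcut p rho z = ln (modulus (z - p)).
Proof. by move=> h; rewrite /lcut max_l. Qed.

Lemma lcut_close p rho z : modulus (z - p) <= rho -> lcut p rho z = ln rho.
Proof. by move=> h; rewrite /lcut max_r. Qed.

Lemma subh_lcut p rho z : 0 < rho -> subh_pt (lcut p rho) z.
Proof.
move=> rho0; have [->|zp] := eqVneq z p.
  apply: (@subh_pt_near _ (fun=> ln rho)); last exact/harm_subh/harm_cst.
  by apply/nbhs_plane; exists rho => // w /ltW wr; rewrite lcut_close.
apply: (@subh_pt_near _ (fun w => Num.max (ln (modulus (w - p))) (ln rho))).
  have FF : Filter (nbhs (z : R[i]^o)) by exact: nbhs_filter.
  apply: (filterS _ (near_neq zp)) => w wp; rewrite /lcut.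
  have wp0 : 0 < modulus (w - p) by rewrite modulus_gt0 subr_eq0.
  have [h|h] := leP (modulus (w - p)) rho.
    by rewrite max_r// ler_ln.
  by rewrite max_l// ler_ln// ltW.
by apply: subh_pt_max; [apply/harm_subh/harm_ln|exact/harm_subh/harm_cst].
Qed.

Lemma lap_ge0 r F z : 0 < r -> continuous F -> (forall w, subh_pt F w) -> 0 <= lap r F z.
Proof.
move=> r0 cF sF; rewrite subr_ge0; apply: sub_mean_global => //.
by move=> w _; exact: cF.
Qed.

Lemma lapD r F G z : 0 <= r -> continuous F -> continuous G ->
  lap r (fun w => F w + G w) z = lap r F z + lap r G z.
Proof.
by move=> r0 cF cG; rewrite /lap /avg meanD//; [ring|move=> w _; exact: cF|move=> w _; exact: cG].
Qed.

Lemma lap_sum (I : Type) (S : seq I) (c : I -> R) (F : I -> R[i]^o -> R) r z : 0 <= r ->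
  (forall i, continuous (F i)) ->
  lap r (fun w => \sum_(i <- S) c i * F i w) z = \sum_(i <- S) c i * lap r (F i) z.
Proof.
move=> r0 cF; rewrite /lap /avg mean_sum//; last first.
  by move=> i w _; exact: (@continuousZ R (c i) (F i) (cF i) w).
rewrite -sumrB; apply: eq_bigr => i _; rewrite meanZ// ?mulrBr//.
by move=> w _; exact: cF.
Qed.

Lemma lap_ln p r F z : 0 <= r -> r < modulus (z - p) ->
  (forall w, modulus (w - z) <= r -> F w = ln (modulus (w - p))) -> lap r F z = 0.
Proof.
move=> r0 rz FE; rewrite /lap FE ?subrr ?modulus0// /avg (eq_mean (v := fun w => ln (modulus (w - p))))//.
  by rewrite mean_ln_out// subrr.
by move=> w wz; apply: FE; rewrite wz.
Qed.

Lemma kap_supp p rho z : 0 < rho -> 3 * rho < modulus (z - p) -> kap p rho z = 0.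
Proof.
move=> r0 zp; apply: (@lap_ln p) => //; [lra|lra|].
move=> w wz; apply: lcut_far; have := modulus_le_dist (z - p) (w - p).
by rewrite opprB addrA subrK (modulusB z w); lra.
Qed.

Lemma kap_ge0 p rho z : 0 < rho -> 0 <= kap p rho z.
Proof.
move=> r0; apply: lap_ge0; [lra|exact: continuous_lcut|].
by move=> w; exact: subh_lcut.
Qed.

Lemma continuous_kap p rho : 0 < rho -> continuous (kap p rho).
Proof. by move=> r0; exact/continuous_lap/continuous_lcut. Qed.

Lemma kap_shift p rho z : kap p rho z = kap 0 rho (z - p).
Proof.
rewrite /kap /lap /lcut subr0; congr (_ - _); rewrite /avg /mean; congr (_ * _).
apply: eq_Rintegral => t _; rewrite subr0; congr (ln (Num.max (modulus _) _)).
by rewrite addrAC.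
Qed.

Lemma pint_kap p rho X : 0 < rho -> 3 * rho + modulus p <= X ->
  pint X (kap p rho) = pint X (kap 0 rho).
Proof.
move=> r0 pX; have := modulus_ge0 p => p0.
rewrite -(@pint_shift R (kap 0 rho) (- p) (3 * rho) X); first last.
- by move=> z Yz; apply: kap_supp; rewrite ?subr0.
- lra.
- by rewrite modulusN.
- lra.
- exact: continuous_kap.
by apply: eq_pint => z; exact: kap_shift.
Qed.

Lemma pint_kap_gt0 rho X : 0 < rho -> 0 < X -> 0 < pint X (kap 0 rho).
Proof.
move=> r0 X0; apply: (@pint_gt0 _ _ 0); rewrite ?modulus0//; first exact: continuous_kap.
  by move=> w; exact: kap_ge0.
rewrite /kap /lap /avg lcut_close ?subrr ?modulus0 ?ltW// subr_gt0.
rewrite (eq_mean (v := fun=> ln (2 * rho))) ?mean_cst//; first last.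
- move=> z; rewrite subr0 => z0; rewrite lcut_far subr0 z0//; lra.
- lra.
by rewrite ltr_ln ?posrE//; lra.
Qed.

Lemma pint_indep F Y X X' : continuous F -> 0 <= Y -> Y <= X -> X <= X' -> 0 < X ->
  vanishes_off Y F -> pint X F = pint X' F.
Proof.
move=> cF Y0 YX XX' X0 F0; have X'0 : 0 < X' by lra.
have E x : \int[lebesgue_measure]_(y in `[- X, X]) F (x +i* y) =
           \int[lebesgue_measure]_(y in `[- X', X']) F (x +i* y).
  have cr := @continuous_row R F x cF.
  have z0 t : Y < `|t| -> F (x +i* t) = 0.
    by move=> Yt; apply: F0; apply: lt_le_trans Yt _; exact: (Im_le_modulus (x +i* t)).
  by rewrite (integral_trunc cr Y0 _ _ z0) ?(@integral_trunc R _ (- X') X' Y cr)//; lra.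
rewrite /pint; under eq_Rintegral do rewrite E.
have ci := continuous_inner_pint X'0 cF.
have z1 x : Y < `|x| -> \int[lebesgue_measure]_(y in `[- X', X']) F (x +i* y) = 0.
  move=> Yx; transitivity (\int[lebesgue_measure]_(_ in `[- X', X']) (0 : R));
    last by rewrite Rintegral_cst// mul0r.
  by apply: eq_Rintegral => y _; apply: F0; apply: lt_le_trans Yx _; exact: (Re_le_modulus (x +i* y)).
by rewrite (integral_trunc ci Y0 _ _ z1) ?(@integral_trunc R _ (- X') X' Y ci)//; lra.
Qed.

Lemma lap_vanishes r F Y : 0 <= r -> vanishes_off Y F -> vanishes_off (Y + r) (lap r F).
Proof.
move=> r0 F0 z zY; rewrite /lap F0 ?subr0; last lra.
rewrite /avg (eq_mean (v := fun=> 0)) ?mean_cst// => w wz; apply: F0.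
by have := modulus_le_dist z w; rewrite modulusB wz; lra.
Qed.

Lemma pint_lap_sym F h r Y X : 0 <= r -> continuous F -> continuous h -> 0 <= Y -> Y + r <= X ->
  0 < X -> vanishes_off Y F ->
  pint X (fun z => F z * lap r h z) = pint X (fun z => h z * lap r F z).
Proof.
move=> r0 cF ch Y0 YX X0 F0.
have cA := @continuous_avg R h r ch; have cA' := @continuous_avg R F r cF.
transitivity (pint X (fun z => F z * avg r h z) - pint X (fun z => F z * h z)).
  rewrite -(pintB X0 (continuousM cF cA) (continuousM cF ch)).
  by apply: eq_pint => z; rewrite mulrBr.
rewrite (pint_avg_sym r0 cF ch Y0 YX X0 F0).
have -> : pint X (fun z => F z * h z) = pint X (fun z => h z * F z).
  by apply: eq_pint => z; rewrite mulrC.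
rewrite -(pintB X0 (continuousM ch cA') (continuousM ch cF)).
by apply: eq_pint => z; rewrite mulrBr.
Qed.

(** Soft thresholding: monotone, within [e] of the identity and zero on [-e, e], so that it turns
    decay at infinity into compact support. *)
Definition soft e x := Num.max (x - e) 0 - Num.max (- x - e) 0.

Lemma soft_mono e x y : 0 <= (soft e x - soft e y) * (x - y).
Proof.
have H a b : a <= b -> soft e a <= soft e b.
  move=> ab; rewrite /soft lerB//.
    by rewrite ge_max !le_max lexx orbT andbT lerD2r ab.
  by rewrite ge_max !le_max lexx orbT andbT lerD2r lerN2 ab.
have [xy|yx] := leP x y; first by rewrite mulr_le0// subr_le0// H.
by rewrite mulr_ge0// subr_ge0 ?H// ltW.
Qed.

Lemma soft_close e x : 0 <= e -> `|x - soft e x| <= e.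
Proof.
move=> e0; rewrite /soft.
have [h1|h1] := leP (x - e) 0; have [h2|h2] := leP (- x - e) 0;
  rewrite ?(max_r _) ?(max_l (ltW _)) //; rewrite ler_norml; apply/andP; split; lra.
Qed.

Lemma soft_small e x : `|x| <= e -> soft e x = 0.
Proof.
by rewrite ler_norml => /andP[h1 h2]; rewrite /soft !max_r ?subrr//; lra.
Qed.

Lemma continuous_soft e F : continuous F -> continuous (fun z : R[i]^o => soft e (F z)).
Proof.
move=> cF z.
have c1 := contB (cF z) (@cont_cst R R[i]^o z e).
have c2 := contB (contN (cF z)) (@cont_cst R R[i]^o z e).
have c0 := @cont_cst R R[i]^o z 0.
exact: (contB (cont_max c1 c0) (cont_max c2 c0)).
Qed.

(* The energy of F is nonnegative, although F itself need not have compact support. *)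
Lemma pint_lap_le0 F r Y X : 0 <= r -> continuous F -> 0 <= Y -> Y <= X -> 0 < X ->
  vanishes_off Y (lap r F) ->
  (forall e, 0 < e -> exists Z, forall z, Z < modulus z -> `|F z| <= e) ->
  pint X (fun z => F z * lap r F z) <= 0.
Proof.
move=> r0 cF Y0 YX X0 L0 F0.
have cL := @continuous_lap r F cF.
have cnL : continuous (fun z : R[i]^o => `|lap r F z|).
  by move=> z; apply: (@cont_comp _ _ _ (fun x : R => `|x|) (lap r F)); [exact: norm_continuous|exact: cL].
have I0 : 0 <= pint X (fun z => `|lap r F z|) by apply: pint_ge0.
apply/ler_addgt0Pr => e e0; rewrite add0r.
pose d := e / (pint X (fun z => `|lap r F z|) + 1).
have d0 : 0 < d by rewrite divr_gt0// ltr_wpDl.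
have [Z FZ] := F0 _ d0.
have cS := @continuous_soft d F cF.
pose Y' := Num.max Z 0.
have Y'0 : 0 <= Y' by rewrite le_max lexx orbT.
pose X' := Num.max X (Y' + r).
have XX' : X <= X' by rewrite le_max lexx.
have X'0 : 0 < X' by lra.
have S0 : vanishes_off Y' (fun z => soft d (F z)).
  by move=> z zY; apply: soft_small; apply: FZ; apply: le_lt_trans zY; rewrite le_max lexx.
have YX' : Y' + r <= X' by rewrite le_max lexx orbT.
(* The thresholded function varies in the same sense as [F] and has compact support, so positivity
   of the Dirichlet form applies to the pair. Replacing [F] by it costs at most [d] times the
   integral of [|lap r F|]. *)
have H := pint_avg_le r0 cS cF Y'0 YX' X'0 S0 (fun z w => soft_mono d (F z) (F w)).
have cSL := continuousM cS cL.
have H2 : pint X (fun z => soft d (F z) * lap r F z) <= 0.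
  rewrite (pint_indep cSL Y0 YX XX' X0); last by move=> z /L0 ->; rewrite mulr0.
  have -> : pint X' (fun z => soft d (F z) * lap r F z) =
     pint X' (fun z => soft d (F z) * avg r F z) - pint X' (fun z => soft d (F z) * F z).
    rewrite -(pintB X'0 (continuousM cS (@continuous_avg R F r cF)) (continuousM cS cF)).
    by apply: eq_pint => z; rewrite mulrBr.
  by rewrite subr_le0.
have cZ := @continuousZ R d _ cnL.
have H3 : pint X (fun z => F z * lap r F z) <=
   pint X (fun z => soft d (F z) * lap r F z + d * `|lap r F z|).
  apply: le_pint => //; first exact: continuousM.
    by move=> z; exact: (contD (cSL z) (cZ z)).
  move=> z; rewrite -lerBlDl -mulrBl; apply: le_trans (ler_norm _) _.
  by rewrite normrM ler_wpM2r// soft_close// ltW.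
apply: le_trans H3 _; rewrite (pintD X0 cSL cZ) (pintZ d X0 cnL).
have : d * pint X (fun z => `|lap r F z|) <= e.
  rewrite /d mulrAC ler_pdivrMr; last by rewrite ltr_wpDl.
  by rewrite ler_pM2l// lerDl.
move: H2; clear; move: (pint _ _) (d * _) => a b; lra.
Qed.

End LogarithmicKernel.

(** * The energy inequality for neutral charges *)

Section EnergyInequality.
Context (R : realType) (J : finType) (q : J -> R) (p : J -> R[i]) (f : J -> R[i]^o -> R).
Implicit Types (z w : R[i]) (i j : J) (rho eta r : R).

(** Off this set [f i] is the logarithm. The pole is listed separately because [ln 0] is a default
    value, which deprives the second condition of meaning there. *)
Definition potential_supp i : set R[i] := [set z | z = p i \/ f i z <> ln (modulus (z - p i))].

Hypothesis q_neutral : \sum_i q i = 0.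
Hypothesis f_cont : forall i, continuous (f i).
Hypothesis f_subh : forall i z, subh_pt (f i) z.
Variable Y0 : R.
Hypothesis f_far : forall i z, Y0 < modulus z -> f i z = ln (modulus (z - p i)).
Hypothesis f_ge : forall i z, z != p i -> ln (modulus (z - p i)) <= f i z.
Variable r0 : R.
Hypothesis r0_gt0 : 0 < r0.
Hypothesis f_disj : forall i j, q i * q j < 0 -> forall z w,
  potential_supp i z -> potential_supp j w -> r0 < modulus (z - w).
Hypothesis p_inj : forall i j, i != j -> p i != p j.

(** Neutrality cancels the terms ln |z|; what is left, ln |1 - p_i / z|, is of order |p_i| / |z|. *)
Lemma sum_ln_at_infinity : forall e, 0 < e -> exists Z, forall z, Z < modulus z ->
  `|\sum_i q i * ln (modulus (z - p i))| <= e.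
Proof.
move=> e e0.
pose S := \sum_i `|q i| * (2 * modulus (p i)).
have S0 : 0 <= S by apply: sumr_ge0 => i _; rewrite !mulr_ge0// modulus_ge0.
pose P := \sum_i modulus (p i).
have Pi i : modulus (p i) <= P.
  by rewrite /P (bigD1 i)//= lerDl sumr_ge0// => j _; exact: modulus_ge0.
exists (Num.max (Num.max 1 (2 * P)) (S / e)) => z; rewrite !gt_max => /andP[/andP[z1 z2] z3].
have z0 : 0 < modulus z by lra.
have z_neq0 : z != 0 by rewrite -modulus_gt0.
have -> : \sum_i q i * ln (modulus (z - p i)) = \sum_i q i * ln (modulus (1 - p i / z)).
  have E i : ln (modulus (z - p i)) = ln (modulus (1 - p i / z)) + ln (modulus z).
    have Pz : modulus (p i / z) <= 1 / 2.
      by rewrite modulusM modulusV ler_pdivrMr//; have := Pi i; lra.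
    have pos : 0 < modulus (1 - p i / z).
      by have := modulus_le_dist 1 (p i / z); rewrite modulus1; lra.
    by rewrite -lnM ?posrE// -modulusM mulrBl mul1r divfK.
  under eq_bigr do rewrite E mulrDr.
  by rewrite big_split /= -mulr_suml q_neutral mul0r addr0.
apply: le_trans (ler_norm_sum _ _ _) _.
apply: (@le_trans _ _ (S / modulus z)); last first.
  by rewrite ler_pdivrMr// mulrC -ler_pdivrMr// ltW.
rewrite /S mulr_suml; apply: ler_sum => i _; rewrite normrM -mulrA ler_wpM2l//.
have Pz : modulus (p i / z) <= 1 / 2.
  by rewrite modulusM modulusV ler_pdivrMr//; have := Pi i; lra.
by apply: le_trans (ln_modulus_bound Pz) _; rewrite modulusM modulusV mulrA.
Qed.

(** The form [b i j], the integral of [f i * lap r (f j)], has a nonpositive sum against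
    [q i * q j]. Splitting [f j = v j + l j] leaves in [b i j] a term concentrated at [p j], equal
    to [f i (p j)] times the mass [m] of the bump up to [eta * m], and an interaction of [v j] with
    [lap r (f i)], whose product with [q i * q j] is nonnegative. *)
Lemma energy_at_scale (s : J -> J -> bool) rho eta :
  0 < rho -> 0 <= eta -> 2 * rho < r0 ->
  (forall i z, modulus (z - p i) < rho -> ln rho <= f i z) ->
  (forall i j z, modulus (z - p j) <= 3 * rho -> `|f i z - f i (p j)| <= eta) ->
  (forall i j z, i != j -> modulus (z - p j) <= 3 * rho -> rho <= modulus (z - p i) /\
     `|ln (modulus (z - p i)) - ln (modulus (p j - p i))| <= eta) ->
  \sum_i \sum_j q i * q j * (if s i j then f i (p j) else f j (p i)) <=
  3 * eta * \sum_i \sum_j `|q i * q j|.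
Proof.
have arith1 (A B C D : R) : A + B + C = B + D + A + (C - D) by ring.
have arith2 (c h m B : R) : (c - h) * m <= B -> B <= (c + h) * m -> `|B - c * m| <= h * m.
  by move=> h1 h2; rewrite ler_norml; apply/andP; split; lra.
have arith3 (A B C d : R) : `|A - C| <= d -> `|B - C| <= d -> `|A - B| <= 2 * d.
  rewrite !ler_norml => /andP[h1 h2] /andP[h3 h4]; apply/andP; split; lra.
have arith4 (x B E k : R) : `|B - E| <= k -> x * E <= x * B + k * `|x|.
  move=> h; have : `|x * (B - E)| <= k * `|x| by rewrite normrM mulrC ler_wpM2r.
  by rewrite ler_norml => /andP[h1 _]; lra.
have arith5 (A d : R) : 0 <= d -> A <= d -> A <= 3 * d by move=> h1 h2; lra.
have arith6 (A B d : R) : A <= d -> B <= 2 * d -> A + B <= 3 * d by move=> h1 h2; lra.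
move=> rho0 eta0 rhor0 f_low f_osc ln_osc.
set r := 2 * rho in rhor0 *.
have rp : 0 < r by rewrite mulr_gt0.
have r_ge0 := ltW rp.
pose l i := lcut (p i) rho.
pose kp i := kap (p i) rho.
pose v i : R[i]^o -> R := fun z => f i z - l i z.
pose Lf i := lap r (f i).
have cl i : continuous (l i) by exact: continuous_lcut.
have ck i : continuous (kp i) by exact: continuous_kap.
have cv i : continuous (v i).
  move=> z; have h := @contB R R[i]^o z (f i) (l i) (@f_cont i z) (cl i z). exact: h.
have cLf i : continuous (Lf i) by exact: continuous_lap.
have cLv i : continuous (lap r (v i)) by exact: continuous_lap.
have kp0 i z : 0 <= kp i z by exact: kap_ge0.
have Lf0 i z : 0 <= Lf i z by apply: lap_ge0.
have v0 i z : 0 <= v i z.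
  rewrite subr_ge0; have [h|h] := ltP (modulus (z - p i)) rho.
    by rewrite /l lcut_close; [exact: f_low|exact: ltW].
  rewrite /l lcut_far//; apply: f_ge; rewrite -subr_eq0 -modulus_gt0; lra.
have supp_v i z : v i z != 0 -> potential_supp i z.
  have [->|zp] := eqVneq z (p i); first by left.
  move=> vz; right => fz; move/eqP: vz; apply; rewrite /v.
  have [h|h] := ltP (modulus (z - p i)) rho; last by rewrite /l lcut_far// fz subrr.
  have := f_low _ _ h; rewrite fz ler_ln ?posrE//; last by rewrite modulus_gt0 subr_eq0.
  by rewrite leNgt h.
pose P := \sum_i modulus (p i).
have Pi i : modulus (p i) <= P.
  by rewrite /P (bigD1 i)//= lerDl sumr_ge0// => j _; exact: modulus_ge0.
have P0 : 0 <= P by apply: sumr_ge0 => i _; exact: modulus_ge0.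
pose Y1 := `|Y0| + P + 3 * rho.
have Y1_ge : Y0 <= Y1 by rewrite /Y1; have := ler_norm Y0; lra.
have Y1_ge0 : 0 <= Y1 by rewrite /Y1; have := normr_ge0 Y0; lra.
have Y1P : 3 * rho + P <= Y1 by rewrite /Y1; have := normr_ge0 Y0; lra.
clearbody Y1.
have vY i : vanishes_off Y1 (v i).
  move=> z zY; rewrite /v f_far; last lra.
  rewrite /l lcut_far ?subrr//.
  by have := modulus_le_dist z (p i); have := Pi i; lra.
have kY i : vanishes_off Y1 (kp i).
  move=> z zY; apply: kap_supp => //.
  by have := modulus_le_dist z (p i); have := Pi i; lra.
pose X := Y1 + r + r.
have X0 : 0 < X by rewrite /X; lra.
have YX : Y1 + r <= X by rewrite /X; lra.
have LfE i z : Lf i z = lap r (v i) z + kp i z.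
  have E : f i = (fun w : R[i]^o => v i w + l i w) by apply/funext => w; rewrite /v subrK.
  by rewrite /Lf E; exact: (lapD z r_ge0 (cv i) (cl i)).
have LfY i : vanishes_off (Y1 + r) (Lf i).
  move=> z zY; rewrite LfE (lap_vanishes r_ge0 (vY i))// kY ?addr0//; lra.
pose I := pint X.
pose m := I (kap 0 rho).
have m0 : 0 < m by exact: pint_kap_gt0.
have mE j : I (kp j) = m.
  by apply: pint_kap => //; have := Pi j; rewrite /X; lra.
clearbody X.
pose b i j := I (fun z => f i z * Lf j z).
(* By symmetry the discrete Laplacian passes from the compactly supported [v j] to [f i]. *)
have bE1 i j : b i j = I (fun z => f i z * kp j z) + I (fun z => v j z * Lf i z).
  have -> : I (fun z => v j z * Lf i z) = I (fun z => f i z * lap r (v j) z).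
    exact: (pint_lap_sym r_ge0 (cv j) (@f_cont i) Y1_ge0 YX X0 (vY j)).
  rewrite /I -(pintD X0 (continuousM (@f_cont i) (ck j)) (continuousM (@f_cont i) (cLv j))).
  by apply: eq_pint => z; rewrite LfE; ring.
have bE2 i j : b i j = I (fun z => v i z * Lf j z) + I (fun z => v j z * kp i z) +
    I (fun z => l i z * kp j z).
  have -> : I (fun z => v j z * kp i z) = I (fun z => l i z * lap r (v j) z).
    exact: (pint_lap_sym r_ge0 (cv j) (cl i) Y1_ge0 YX X0 (vY j)).
  have c1 := continuousM (cv i) (cLf j); have c2 := continuousM (cl i) (cLv j).
  have c3 := continuousM (cl i) (ck j).
  have c12 : continuous (fun z : R[i]^o => v i z * Lf j z + l i z * lap r (v j) z).
    by move=> z; exact: (contD (c1 z) (c2 z)).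
  rewrite /I -(pintD X0 c1 c2) -(pintD X0 c12 c3).
  by apply: eq_pint => z; rewrite /v LfE; ring.
(* The form is symmetric up to the interaction of two truncated logarithms, which is itself
   symmetric up to [2 * eta * m]; this is what lets [s] choose either value. *)
have asym i j : b i j = b j i + (I (fun z => l i z * kp j z) - I (fun z => l j z * kp i z)).
  rewrite bE2 bE1.
  have -> : I (fun z => f j z * kp i z) = I (fun z => v j z * kp i z) + I (fun z => l j z * kp i z).
    rewrite /I -(pintD X0 (continuousM (cv j) (ck i)) (continuousM (cl j) (ck i))).
    by apply: eq_pint => z; rewrite /v; ring.
  exact: arith1.
(* For charges of equal sign both factors of the integrand are nonnegative. For opposite signs the
   supports are more than [r0 > r] apart, so [f i] is a logarithm on the whole disk of radius [r]
   about any point where [v j] does not vanish. *)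
have sgn i j : 0 <= q i * q j * I (fun z => v j z * Lf i z).
  have [qq|qq] := leP 0 (q i * q j).
    have vL z : 0 <= v j z * Lf i z by exact: mulr_ge0 (v0 j z) (Lf0 i z).
    exact: mulr_ge0 qq (pint_ge0 X vL).
  suff -> : I (fun z => v j z * Lf i z) = 0 by rewrite mulr0.
  rewrite /I -[RHS](pint0 X); apply: eq_pint => z.
  have [->|/supp_v vz] := eqVneq (v j z) 0; first by rewrite mul0r.
  suff -> : Lf i z = 0 by rewrite mulr0.
  have pz : potential_supp i (p i) by left.
  apply: (@lap_ln _ (p i)) => //.
    by have := f_disj qq pz vz; rewrite (modulusB (p i)); lra.
  move=> w wz; have [//|nw] := pselect (f i w = ln (modulus (w - p i))).
  have : potential_supp i w by right.
  by move=> /(f_disj qq)/(_ vz); lra.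
(* [kp j] has mass [m] and lives within [3 * rho] of [p j], so it acts on [g] like [m] times
   evaluation near [p j]. *)
have conc (g : R[i]^o -> R) j (c : R) : continuous g ->
    (forall z, modulus (z - p j) <= 3 * rho -> `|g z - c| <= eta) ->
    `|I (fun z => g z * kp j z) - c * m| <= eta * m.
  move=> cg gc.
  have cc := continuousM cg (ck j).
  have cz (x : R) := @continuousZ R x _ (ck j).
  have key z : (c - eta) * kp j z <= g z * kp j z /\ g z * kp j z <= (c + eta) * kp j z.
    have [h|h] := leP (modulus (z - p j)) (3 * rho).
      have := gc z h; rewrite ler_norml => /andP[h1 h2].
      by split; apply: ler_wpM2r => //; lra.
    by rewrite /kp kap_supp// !mulr0.
  have e1 : (c - eta) * m <= I (fun z => g z * kp j z).
    by rewrite -(mE j) -(pintZ _ X0 (ck j)); apply: le_pint => // z; case: (key z).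
  have e2 : I (fun z => g z * kp j z) <= (c + eta) * m.
    by rewrite -(mE j) -(pintZ _ X0 (ck j)); apply: le_pint => // z; case: (key z).
  exact: arith2.
have conc_f i j : `|I (fun z => f i z * kp j z) - f i (p j) * m| <= eta * m.
  by apply: conc => // z; exact: f_osc.
have D_small i j : `|I (fun z => l i z * kp j z) - I (fun z => l j z * kp i z)| <= 2 * eta * m.
  have [->|ij] := eqVneq i j; first by rewrite subrr normr0 mulr_ge0 ?mulr_ge0// ltW.
  have h1 : `|I (fun z => l i z * kp j z) - ln (modulus (p j - p i)) * m| <= eta * m.
    by apply: conc => // z h; have [h1 h2] := ln_osc i j z ij h; rewrite /l lcut_far.
  have h2 : `|I (fun z => l j z * kp i z) - ln (modulus (p j - p i)) * m| <= eta * m.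
    rewrite modulusB; apply: conc => // z h; rewrite eq_sym in ij.
    by have [h2 h3] := ln_osc j i z ij h; rewrite /l lcut_far.
  by rewrite -mulrA; exact: arith3 h1 h2.
pose F : R[i]^o -> R := fun z => \sum_i q i * f i z.
have cF : continuous F.
  by move=> z; apply: cont_sum => i; exact: (@continuousZ R (q i) (f i) (@f_cont i) z).
have LF z : lap r F z = \sum_j q j * Lf j z by exact: lap_sum.
have total : \sum_i \sum_j q i * q j * b i j <= 0.
  have -> : \sum_i \sum_j q i * q j * b i j = I (fun z => F z * lap r F z).
    have cij i j : continuous (fun z : R[i]^o => q i * q j * (f i z * Lf j z)).
      exact: (continuousZ (continuousM (@f_cont i) (cLf j))).
    have ci i : continuous (fun z : R[i]^o => \sum_j q i * q j * (f i z * Lf j z)).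
      by move=> z; apply: cont_sum => j; exact: cij.
    transitivity (I (fun z => \sum_i \sum_j q i * q j * (f i z * Lf j z))).
      rewrite /I (pint_sum _ X0 ci); apply: eq_bigr => i _.
      rewrite (pint_sum _ X0 (cij i)); apply: eq_bigr => j _.
      by rewrite (pintZ _ X0 (continuousM (@f_cont i) (cLf j))).
    apply: eq_pint => z; rewrite LF /F mulr_suml; apply: eq_bigr => i _.
    by rewrite mulr_sumr; apply: eq_bigr => j _; ring.
  apply: (@pint_lap_le0 R F r (Y1 + r) X) => //; first by rewrite addr_ge0.
    by move=> z zY; rewrite LF big1// => j _; rewrite LfY ?mulr0.
  move=> e e0; have [Z HZ] := sum_ln_at_infinity e0.
  exists (Num.max Z Y0) => z; rewrite gt_max => /andP[zZ zY].
  rewrite /F; under eq_bigr do rewrite f_far//; exact: HZ.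
have term i j : q i * q j * (if s i j then f i (p j) else f j (p i)) * m <=
    q i * q j * b i j + 3 * eta * m * `|q i * q j|.
  have em : 0 <= eta * m by exact: mulr_ge0 eta0 (ltW m0).
  have sg := sgn i j; have sg' := sgn j i.
  rewrite -[3 * eta * m]mulrA -[_ * _ * m]mulrA; case: (s i j).
    have h := arith4 (q i * q j) _ _ _ (arith5 _ _ em (conc_f i j)).
    by apply: le_trans h _; rewrite lerD2r bE1 mulrDr lerDl; exact: sg.
  have h1 : `|I (fun z => f j z * kp i z) + (I (fun z => l i z * kp j z) -
      I (fun z => l j z * kp i z)) - f j (p i) * m| <= 3 * (eta * m).
    rewrite addrAC; apply: le_trans (ler_normD _ _) _; apply: arith6; first exact: conc_f.
    by rewrite mulrA; exact: D_small.
  apply: le_trans (arith4 (q i * q j) _ _ _ h1) _.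
  rewrite lerD2r asym bE1 !mulrDr lerD2r lerDl.
  by rewrite [q i * q j]mulrC.
have : (\sum_i \sum_j q i * q j * (if s i j then f i (p j) else f j (p i))) * m <=
    (3 * eta * \sum_i \sum_j `|q i * q j|) * m.
  have -> : (\sum_i \sum_j q i * q j * (if s i j then f i (p j) else f j (p i))) * m =
     \sum_i \sum_j q i * q j * (if s i j then f i (p j) else f j (p i)) * m.
    by rewrite mulr_suml; apply: eq_bigr => i _; rewrite mulr_suml.
  have -> : (3 * eta * \sum_i \sum_j `|q i * q j|) * m =
     \sum_i \sum_j 3 * eta * m * `|q i * q j|.
    rewrite mulrAC mulr_sumr; apply: eq_bigr => i _; by rewrite mulr_sumr.
  apply: (@le_trans _ _ (\sum_i \sum_j (q i * q j * b i j + 3 * eta * m * `|q i * q j|))).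
    by apply: ler_sum => i _; apply: ler_sum => j _; exact: term.
  rewrite -[leRHS]add0r; under eq_bigr do rewrite big_split /=.
  by rewrite big_split /= lerD2r.
by rewrite ler_pM2r.
Qed.

(** The conditions at scale [rho] all hold for small [rho]: [ln rho] tends to minus infinity while
    [f i] is bounded near its pole, and the oscillations within [3 * rho] tend to 0. *)
Lemma energy_inequality (s : J -> J -> bool) :
  \sum_i \sum_j q i * q j * (if s i j then f i (p j) else f j (p i)) <= 0.
Proof.
set S := (S in S <= 0); pose Q := \sum_i \sum_j `|q i * q j|.
have Q0 : 0 <= Q by apply: sumr_ge0 => i _; apply: sumr_ge0.
apply/ler_addgt0Pr => e e0; rewrite add0r.
(* Makes the error [3 * eta * Q] at most [e], also when [Q = 0]. *)
pose eta := e / (3 * (Q + 1)).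
have eta0 : 0 < eta by rewrite divr_gt0// mulr_gt0// ltr_wpDl.
have FF : Filter ((0 : R)^'+) by exact: at_right_proper_filter.
have C1 i : \forall rho \near (0 : R)^'+, forall z, modulus (z - p i) < rho -> ln rho <= f i z.
  have /continuous_plane/(_ _ ltr01)[d d0 dA] := @f_cont i (p i).
  near=> rho => z zr.
  have rd : rho < d by near: rho; exact: nbhs_right_lt.
  have re : rho < expR (f i (p i) - 1) by near: rho; apply: nbhs_right_lt; exact: expR_gt0.
  have rho0 : 0 < rho by [].
  have := dA z (lt_trans zr rd); rewrite ltr_norml => /andP[h _].
  apply: (@le_trans _ _ (f i (p i) - 1)); last lra.
  by rewrite -[leRHS]expRK ler_ln ?posrE ?expR_gt0// ltW.
have C2 i j : \forall rho \near (0 : R)^'+, forall z, modulus (z - p j) <= 3 * rho ->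
    `|f i z - f i (p j)| <= eta.
  have /continuous_plane/(_ _ eta0)[d d0 dA] := @f_cont i (p j).
  near=> rho => z zr; apply/ltW/dA.
  have : rho < d / 3 by near: rho; apply: nbhs_right_lt; rewrite divr_gt0.
  lra.
have C3 i j : \forall rho \near (0 : R)^'+, i != j -> forall z, modulus (z - p j) <= 3 * rho ->
    rho <= modulus (z - p i) /\ `|ln (modulus (z - p i)) - ln (modulus (p j - p i))| <= eta.
  have [->|ij] := eqVneq i j; first by apply: nearW.
  have pji : p j != p i by rewrite eq_sym p_inj.
  have /continuous_plane/(_ _ eta0)[d d0 dA] := continuous_ln_modulus pji.
  have pos : 0 < modulus (p j - p i) by rewrite modulus_gt0 subr_eq0.
  near=> rho => _ z zr; split.
    have : rho < modulus (p j - p i) / 4 by near: rho; apply: nbhs_right_lt; rewrite divr_gt0.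
    have := modulus_le_dist (p j - p i) (z - p i); rewrite opprB addrA subrK (modulusB (p j) z).
    lra.
  apply/ltW/dA; have : rho < d / 3 by near: rho; apply: nbhs_right_lt; rewrite divr_gt0.
  lra.
have C1' := filter_forall FF C1.
have C2' := filter_forall FF (fun i => filter_forall FF (C2 i)).
have C3' := filter_forall FF (fun i => filter_forall FF (C3 i)).
have C4 : \forall rho \near (0 : R)^'+, 0 < rho /\ 2 * rho < r0.
  near=> rho; split => //.
  have : rho < r0 / 2 by near: rho; apply: nbhs_right_lt; rewrite divr_gt0.
  lra.
have [rho [[C1r C2r] [C3r [rho0 rhor]]]] := @filter_ex _ _ (at_right_proper_filter (0 : R)) _
  (filterI (filterI C1' C2') (filterI C3' C4)).
have := energy_at_scale s rho0 (ltW eta0) rhor C1r C2r (fun i j z ij => C3r i j ij z).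
move/le_trans; apply.
rewrite -/Q /eta mulrA mulrAC ler_pdivrMr ?mulr_gt0 ?ltr_wpDl//.
have : 0 <= e by exact: ltW.
have : 0 <= e * Q by rewrite mulr_ge0// ltW.
lra.
Unshelve. all: by end_near. Qed.

End EnergyInequality.

(** * Perron families: closure properties and comparison *)

Section GreenFamily.
Context (R : realType) (G : set (sphere R)) (z0 : R[i]).
Implicit Types (z w c : R[i]) (x y r s t e : R) (v V : sphere R -> R) (T : R[i]^o -> R).
Hypothesis oG : open G.

Lemma nbhs_domain (P : sphere R) : G P -> \forall Q \near P, G Q.
Proof. by move=> GP; apply: open_nbhs_nbhs. Qed.

Lemma domain_near_fin c : G (fin_pt c) -> \forall w \near (c : R[i]^o), G (fin_pt w).
Proof. by move=> /nbhs_domain. Qed.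

Lemma family_off v : green_family G z0 v ->
  exists K : set (sphere R), [/\ compact K, closed K, K `<=` G & forall P, ~ K P -> v P = 0].
Proof.
case=> _ [K [cK KG K0]] _; exists K; split => //; exact: sphere_compact_closed.
Qed.

Lemma family_zero_near v (P : sphere R) : green_family G z0 v -> ~ G P ->
  \forall Q \near P, v Q = 0.
Proof.
move=> /family_off[K [cK clK KG K0]] nGP.
have nKP : (~` K) P by move=> /KG.
apply: filterS (_ : nbhs P (~` K)); first by move=> Q /K0.
by apply: open_nbhs_nbhs; split => //; exact: closed_openC.
Qed.

(** Off [G] a member vanishes identically near the point, so the property extends from [G] to the
    plane without the pole. *)
Lemma family_subh v c : green_family G z0 v -> c != z0 -> subh_pt (v \o @fin_pt R) c.
Proof.
move=> fv cz0; have [Gc|nGc] := pselect (G (fin_pt c)); last first.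
  apply: (@subh_pt_near _ (fun=> 0)); last exact/harm_subh/harm_cst.
  have H := family_zero_near fv nGc.
  have FF : Filter (nbhs (c : R[i]^o)) by exact: nbhs_filter.
  have H' : \forall w \near (c : R[i]^o), v (fin_pt w) = 0 by exact: H.
  by apply: filterS H' => w /= ->.
have [fv1 _ _] := fv; split.
  apply: (filterS2 _ _ (domain_near_fin Gc) (near_neq cz0)) => w Gw wz0.
  have [] // := fv1 (fin_pt w); split => //= -[wE]; by rewrite wE eqxx in wz0.
by have [] // := fv1 (fin_pt c); split => //= -[cE]; rewrite cE eqxx in cz0.
Qed.

Lemma family_cont v (P : sphere R) : green_family G z0 v -> P <> fin_pt z0 ->
  {for P, continuous v}.
Proof.
move=> fv Pz0; have [GP|nGP] := pselect (G P).
  by have [+ _ _] := fv; move=> /(_ P)[] //; split.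
apply: (@cont_near R _ P (fun=> 0)); last exact: cont_cst.
by apply: filterS (family_zero_near fv nGP) => Q ->.
Qed.

Lemma family_intro v :
  (forall c, G (fin_pt c) -> c != z0 -> subh_pt (v \o @fin_pt R) c) ->
  (G None -> {for (None : sphere R), continuous v} /\ sub_mean_at v None) ->
  (exists K : set (sphere R), [/\ compact K, K `<=` G & forall P, ~ K P -> v P = 0]) ->
  (exists M : R, \forall z \near (z0 : R[i]^o)^', v (fin_pt z) + ln (modulus (z - z0)) <= M) ->
  green_family G z0 v.
Proof.
move=> h1 h2 h3 h4; split => // -[c|] [GP Pz]; last exact: h2.
have cz : c != z0 by apply/eqP => cE; apply: Pz; rewrite /= cE.
by have sc := h1 c GP cz; split; [exact: (subh_pt_cont sc)|exact: sc.2].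
Qed.

Lemma family_infty v : green_family G z0 v -> sub_mean_at v None.
Proof.
move=> fv; have [GN|nGN] := pselect (G None).
  by have [+ _ _] := fv; move=> /(_ None)[] //; split.
have /nbhs_infty[vN [X X0 Xv]] := family_zero_near fv nGN.
exists X; split; first exact: num_real.
move=> r Xr; have r0 : 0 <= r by lra.
rewrite vN circle_meanE (eq_mean (v := fun=> 0)) ?mean_cst// => w; rewrite subr0 => wr.
by apply: Xv; rewrite wr.
Qed.

Lemma family_large_circle v : green_family G z0 v ->
  \forall r \near +oo, [/\ 0 <= r, continuous_circle_at (v \o @fin_pt R) 0 r & v None <= circle_mean v 0 r].
Proof.
move=> fv; have [X [Xr Xv]] := family_infty fv.
exists (Num.max X (modulus z0)); split; first exact: num_real.
move=> r; rewrite gt_max => /andP[rX rz].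
split; [by have := modulus_ge0 z0; lra| |exact: Xv].
move=> w; rewrite subr0 => wr; apply: (family_cont fv) => -[wE].
by move: rz; rewrite -wr wE ltxx.
Qed.

Lemma near_dnbhs (P : R[i] -> Prop) : (\forall z \near (z0 : R[i]^o)^', P z) <->
  exists2 e, 0 < e & forall z, z != z0 -> modulus (z - z0) < e -> P z.
Proof.
split=> [|[e e0 eP]].
  move=> /nbhs_plane[e e0 eP]; exists e => // z zz zr; exact: eP.
by apply/nbhs_plane; exists e => // z ze zz; exact: eP.
Qed.

Lemma family_max v V : green_family G z0 v -> green_family G z0 V ->
  green_family G z0 (fun P => Num.max (v P) (V P)).
Proof.
move=> fv fV; have [_ [K [cK KG K0]] [M /near_dnbhs[e e0 eM]]] := fv.
have [_ [K' [cK' KG' K0']] [M' /near_dnbhs[e' e0' eM']]] := fV.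
apply: family_intro.
- move=> c Gc cz; exact: (subh_pt_max (family_subh fv cz) (family_subh fV cz)).
- move=> GN; split.
    by apply: cont_max; exact: family_cont.
  apply: (filterS2 _ _ (family_large_circle fv) (family_large_circle fV)) => r [r0 cv vm] [_ cV Vm].
  have cm : continuous_circle_at ((fun P => Num.max (v P) (V P)) \o @fin_pt R) 0 r.
    by move=> w wr; apply: cont_max; [exact: cv|exact: cV].
  rewrite ge_max; apply/andP; split.
    apply: le_trans vm _; rewrite !circle_meanE; apply: le_mean => // w _ /=.
    by rewrite le_max lexx.
  apply: le_trans Vm _; rewrite !circle_meanE; apply: le_mean => // w _ /=.
  by rewrite le_max lexx orbT.
- exists (K `|` K'); split; [exact: compactU|by move=> P [/KG|/KG']|].
  by move=> P /not_orP[/K0 -> /K0' ->]; rewrite maxxx.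
exists (Num.max M M'); apply/near_dnbhs; exists (Num.min e e'); first by rewrite lt_min e0.
move=> z zz; rewrite lt_min => /andP[ze ze']; rewrite addr_maxl ge_max.
have h1 := eM z zz ze; have h2 := eM' z zz ze'.
by rewrite !le_max h1 h2 orbT.
Qed.

Lemma family_zero : green_family G z0 (fun=> 0).
Proof.
apply: family_intro.
- by move=> c _ _; exact/harm_subh/harm_cst.
- move=> _; split; first exact: cont_cst.
  by apply: nearW => r; rewrite circle_meanE [X in _ <= X](mean_cst 0 0 r).
- by exists set0; split => //; exact: compact0.
exists 0; apply/near_dnbhs; exists 1 => // z _ z1; rewrite add0r.
exact: ln_le0 (ltW z1).
Qed.

(** Near the pole k v + ln = k (v + ln) + (1 - k) ln, and the last term is nonpositive within
    distance 1. *)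
Lemma family_scale k v : 0 <= k <= 1 -> green_family G z0 v ->
  green_family G z0 (fun P => k * v P).
Proof.
move=> /andP[k0 k1] fv; have [_ [K [cK KG K0]] [M /near_dnbhs[e e0 eM]]] := fv.
apply: family_intro.
- by move=> c Gc cz; exact: (subh_ptZ k0 (family_subh fv cz)).
- move=> GN; split.
    by apply: contM; [exact: cont_cst|exact: family_cont].
  apply: filterS (family_large_circle fv) => r [r0 cv vm].
  by rewrite circle_meanE (meanZ k r0 cv) ler_wpM2l.
- by exists K; split => // P /K0 ->; rewrite mulr0.
exists `|M|; apply/near_dnbhs; exists (Num.min e 1); first by rewrite lt_min e0 ltr01.
move=> z zz; rewrite lt_min => /andP[ze z1].
have h := eM z zz ze; have l0 : ln (modulus (z - z0)) <= 0 by exact: ln_le0 (ltW z1).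
have : k * (v (fin_pt z) + ln (modulus (z - z0))) <= k * `|M|.
  by rewrite ler_wpM2l// (le_trans h)// ler_norm.
have : 0 <= (1 - k) * - ln (modulus (z - z0)) by rewrite mulr_ge0//; lra.
have : 0 <= (1 - k) * `|M| by rewrite mulr_ge0//; lra.
lra.
Qed.

(** The factor [1 + e] gives the majorant a strictly stronger pole, so that [v - (1 + e) * psi] is
    nonpositive in a punctured disk about [z0]. With the disk removed, the maximum principle applies
    on the compact set off which [v] vanishes; then [e] tends to 0. *)
Lemma green_majorant (psi : sphere R -> R) :
  (forall P, G P -> P <> fin_pt z0 -> {for P, continuous psi} /\ 0 <= psi P) ->
  (forall c, G (fin_pt c) -> c != z0 -> harm_pt (psi \o @fin_pt R) c) ->
  (G None -> \forall r \near +oo, circle_mean psi 0 r = psi None) ->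
  (exists C, \forall z \near (z0 : R[i]^o)^', C <= psi (fin_pt z) + ln (modulus (z - z0))) ->
  forall v, green_family G z0 v -> forall P, G P -> P <> fin_pt z0 -> v P <= psi P.
Proof.
move=> psi1 psi2 psi3 [C /near_dnbhs[d d0 dC]] v fv P GP Pz.
have [_ _ [M /near_dnbhs[d' d'0 dM]]] := fv.
have [K [cK clK KG K0]] := family_off fv.
suff H e : 0 < e -> v P <= (1 + e) * psi P.
  have [_ p0] := psi1 P GP Pz; apply/ler_addgt0Pr => e e0.
  have e1 : 0 < e / (psi P + 1) by rewrite divr_gt0// ltr_wpDl.
  apply: le_trans (H _ e1) _; rewrite mulrDl mul1r lerD2l mulrAC ler_pdivrMr ?ltr_wpDl//.
  by rewrite ler_pM2l// lerDl.
move=> e0.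
pose f P := v P - (1 + e) * psi P.
(* Within [tau] the term [e * ln |z - z0|] is at most [(1 + e) * C - M] and so outweighs the two
   constants. *)
pose tau := Num.min (Num.min d d') (expR (((1 + e) * C - M) / e)).
have tau0 : 0 < tau by rewrite !lt_min d0 d'0 expR_gt0.
have f_pole z : z != z0 -> modulus (z - z0) < tau -> f (fin_pt z) <= 0.
  move=> zz; rewrite !lt_min => /andP[/andP[zd zd'] ze].
  have h1 := dC z zz zd; have h2 := dM z zz zd'.
  have zp : 0 < modulus (z - z0) by rewrite modulus_gt0 subr_eq0.
  have h3 : ln (modulus (z - z0)) <= ((1 + e) * C - M) / e.
    by rewrite -[leRHS]expRK ler_ln ?posrE ?expR_gt0// ltW.
  have h4 : e * ln (modulus (z - z0)) <= (1 + e) * C - M by rewrite mulrC -ler_pdivlMr.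
  have h5 : (1 + e) * C <= (1 + e) * (psi (fin_pt z) + ln (modulus (z - z0))).
    by rewrite ler_pM2l//; lra.
  by rewrite /f; lra.
pose U : set (sphere R) := @fin_pt R @` [set z : R[i]^o | modulus (z - z0) < tau].
have oU : open U.
  apply: (@one_point_compactification_open_some R[i]^o).
  have -> : [set z : R[i]^o | modulus (z - z0) < tau] =
      (fun z : R[i]^o => modulus (z - z0)) @^-1` [set x | x < tau] by [].
  by apply: open_comp; [move=> ? _; exact: continuous_modulusB|exact: open_lt].
pose K' := K `\` U.
have cK' : compact K'.
  by apply: (subclosed_compact _ cK); [rewrite /K' setDE; apply: closedI => //; exact: open_closedC|exact: subDsetl].
have fcont Q : G Q -> Q <> fin_pt z0 -> {for Q, continuous f}.
  move=> GQ Qz; apply: contB; first exact: family_cont.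
  by apply: contM; [exact: cont_cst|have [] := psi1 Q GQ Qz].
have Uz0 : U (fin_pt z0) by exists z0 => //=; rewrite subrr modulus0.
have K'G Q : K' Q -> G Q /\ Q <> fin_pt z0.
  by move=> [KQ nU]; split; [exact: KG|move=> QE; apply: nU; rewrite QE].
have f_off Q : G Q -> Q <> fin_pt z0 -> ~ K' Q -> f Q <= 0.
  move=> GQ Qz; have [KQ|nKQ] := pselect (K Q).
    move=> nK'; have [w /= wt wE] : U Q.
      by apply: contrapT => nU; apply: nK'; split.
    rewrite -wE; apply: f_pole => //; apply/eqP => wz; apply: Qz.
    by rewrite -wE wz.
  move=> _; rewrite /f K0// sub0r oppr_le0 mulr_ge0//; first lra.
  by have [] := psi1 Q GQ Qz.
rewrite -subr_le0 -/(f P).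
have [K'P|nK'P] := pselect (K' P); last exact: f_off.
apply: (maximum_principle cK' (q := z0)) => //.
- by move=> [_]; apply.
- by move=> Q /K'G[]; exact: fcont.
move=> Q /K'G[GQ Qz] fQ; split; last first.
  have nz : \forall Q' \near Q, Q' <> fin_pt z0.
    have c1 : closed [set fin_pt z0].
      exact: (accessible_closed_set1 (hausdorff_accessible (@hausdorff_sphere R))).
    by apply: open_nbhs_nbhs; split => //; exact: closed_openC.
  apply: filterS2 (nbhs_domain GQ) nz => Q' GQ' Q'z; split; first exact: fcont.
  have [K'Q'|nK'Q'] := pselect (K' Q'); [by left|right; exact: f_off].
case: Q GQ Qz fQ => [c|] GQ Qz fQ.
  have cz : c != z0 by apply/eqP => cE; apply: Qz; rewrite cE.
  have := subh_ptB (family_subh fv cz) (harm_ptZ (1 + e) (psi2 c GQ cz)).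
  by case.
have /nbhs_infty[_ [X X0 XG]] := nbhs_domain GQ.
have X1 : \forall r \near +oo, X < r by exists X; split; [exact: num_real|].
have X2 : \forall r \near +oo, modulus z0 < r.
  by exists (modulus z0); split; [exact: num_real|].
apply: (filterS3 _ _ (family_large_circle fv) (psi3 GQ) (filterI X1 X2)) => r [r0 cv vm] pm [Xr zr].
have cp : continuous_circle_at (psi \o @fin_pt R) 0 r.
  move=> w; rewrite subr0 => wr; have [] // := psi1 (fin_pt w).
    by apply: XG; rewrite wr.
  by move=> -[wE]; move: zr; rewrite -wr wE ltxx.
have cp' : continuous_circle_at (fun w => (1 + e) * (psi \o @fin_pt R) w) 0 r.
  by move=> w wr; apply: contM; [exact: cont_cst|exact: cp].
rewrite circle_meanE in pm vm.
rewrite circle_meanE (meanB (u := v \o @fin_pt R) (v := fun w => (1 + e) * (psi \o @fin_pt R) w) r0 cv cp').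
by rewrite meanZ// pm lerB.
Qed.

End GreenFamily.

(** * Finiteness of the Green function and lifts with an exact pole *)

Section GreenFunction.
Context (R : realType) (G : set (sphere R)) (z0 p : R[i]) (d : R).
Implicit Types (z w c : R[i]) (x y r s t e : R) (v V : sphere R -> R) (T : R[i]^o -> R).
Hypothesis oG : open G.
Hypothesis Gz0 : G (fin_pt z0).
Hypothesis d0 : 0 < d.
Hypothesis Gp : forall z, modulus (z - p) <= d -> ~ G (fin_pt z).

(** The cancellation at infinity for the charges 1 at [a] and -1 at [b]. *)
Lemma ln_ratio_infty (a b : R[i]) : forall e, 0 < e -> exists X, forall z, X < modulus z ->
  `|ln (modulus (z - a)) - ln (modulus (z - b))| <= e.
Proof.
move=> e e0; pose q (k : bool) : R := if k then 1 else -1.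
have q0 : \sum_k q k = 0 by rewrite big_bool /= subrr.
have [X HX] := @sum_ln_at_infinity R bool q (fun k => if k then a else b) q0 e e0.
by exists X => z /HX; rewrite big_bool /= mul1r mulN1r.
Qed.

(** Outside the disk of radius [d] about [p] one has |z - z0| <= (1 + |p - z0| / d) |z - p|, so the
    constant makes the function nonnegative there; at infinity it takes its limit. It bounds the
    whole family and so makes the supremum in [green] finite. *)
Definition majorant (P : sphere R) : R :=
  ln (1 + modulus (p - z0) / d) +
  (if P is Some z then ln (modulus (z - p)) - ln (modulus (z - z0)) else 0).

Lemma family_le_majorant v P : green_family G z0 v -> G P -> P <> fin_pt z0 ->
  v P <= majorant P.
Proof.
set C := ln (1 + modulus (p - z0) / d).
have q0 : 0 <= modulus (p - z0) / d by rewrite divr_ge0 ?modulus_ge0 ?ltW.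
have C0 : 0 <= C by apply: ln_ge0; lra.
have far z : G (fin_pt z) -> d < modulus (z - p).
  by move=> Gz; rewrite ltNge; apply/negP => /Gp.
have hm c : G (fin_pt c) -> c != z0 -> harm_pt (majorant \o @fin_pt R) c.
  move=> Gc cz; have cp : c != p by rewrite -subr_eq0 -modulus_gt0; exact: lt_trans d0 (far c Gc).
  by apply: harm_ptD; [exact: harm_cst|apply: harm_ptB; exact: harm_ln].
move=> fv; apply: (green_majorant oG) fv P.
- move=> [c|] GP Pz; last first.
    split; last by rewrite /majorant addr0.
    apply/continuous_infty => e e0; have e20 : 0 < e / 2 by rewrite divr_gt0.
    have [X HX] := ln_ratio_infty p z0 e20.
    exists (Num.max X 1); first by rewrite lt_max ltr01 orbT.
    move=> z; rewrite gt_max => /andP[zX _]; rewrite /majorant /= addr0 addrC addKr.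
    by apply: le_lt_trans (HX z zX) _; lra.
  have cz : c != z0 by apply/eqP => cE; apply: Pz; rewrite cE.
  split; first exact: (subh_pt_cont (harm_subh (hm c GP cz))).
  have fc := far c GP; have cz0 : 0 < modulus (c - z0) by rewrite modulus_gt0 subr_eq0.
  have cp0 : 0 < modulus (c - p) by exact: lt_trans d0 fc.
  have : ln (modulus (c - z0)) <= ln ((1 + modulus (p - z0) / d) * modulus (c - p)).
    rewrite ler_ln ?posrE ?mulr_gt0//; last lra.
    have := modulusD (c - p) (p - z0); rewrite addrA subrK => h.
    apply: le_trans h _; rewrite mulrDl mul1r lerD2l mulrAC ler_pdivlMr//.
    by rewrite ler_wpM2l ?modulus_ge0// ltW.
  rewrite lnM ?posrE//; last lra.
  by rewrite /majorant -/C; lra.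
- exact: hm.
- move=> GN; have [X1 X1z] : exists X, forall r, X < r -> modulus (0 - p) < r /\ modulus (0 - z0) < r.
    by exists (Num.max (modulus (0 - p)) (modulus (0 - z0))) => r; rewrite gt_max => /andP.
  exists X1; split; [exact: num_real|move=> r /X1z[r1 r2]].
  have r0 : 0 <= r by have := modulus_ge0 (0 - p); lra.
  have cl a : modulus (0 - a) < r -> continuous_circle_at (fun w => ln (modulus (w - a))) 0 r.
    move=> ar w; rewrite subr0 => wr; apply: continuous_ln_modulus; apply/eqP => wa.
    by move: ar; rewrite sub0r modulusN -wa wr ltxx.
  rewrite circle_meanE (_ : majorant \o @fin_pt R = fun w => C + (ln (modulus (w - p)) - ln (modulus (w - z0))))//.
  rewrite meanD//; last 2 first.
  - by move=> w _; exact: cont_cst.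
  - by apply: continuous_circleB; exact: cl.
  rewrite mean_cst meanB//; [|exact: cl|exact: cl].
  by rewrite !mean_ln_in// subrr.
exists (C + ln d); have [e e0 eG] : exists2 e, 0 < e & forall z, modulus (z - z0) < e -> G (fin_pt z).
  exact/nbhs_plane/(domain_near_fin oG Gz0).
apply/near_dnbhs; exists e => // z zz /eG/far zd.
have : ln d <= ln (modulus (z - p)) by rewrite ler_ln ?posrE ?(lt_trans d0 zd)// ltW.
by rewrite /majorant /= -/C; lra.
Qed.

Lemma green_ge v P : green_family G z0 v -> G P -> P <> fin_pt z0 -> v P <= green G z0 P.
Proof.
move=> fv GP Pz; apply: ub_le_sup; last by exists v.
by exists (majorant P) => _ [u fu <-]; exact: family_le_majorant.
Qed.

Lemma green_le (b : R) P : (forall v, green_family G z0 v -> v P <= b) -> green G z0 P <= b.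
Proof.
move=> H; apply: ge_sup; last by move=> _ [v fv <-]; exact: H.
by exists 0; exists (fun=> 0) => //; exact: family_zero.
Qed.

Lemma green_approx P e : 0 < e -> exists2 v, green_family G z0 v &
  (forall Q, 0 <= v Q) /\ green G z0 P - e < v P.
Proof.
move=> e0; have : exists2 v, green_family G z0 v & green G z0 P - e < v P.
  apply: contrapT => H; have : green G z0 P <= green G z0 P - e.
    apply: green_le => v fv; rewrite leNgt; apply/negP => h; apply: H; by exists v.
  lra.
move=> [v fv vP]; exists (fun Q => Num.max (v Q) 0).
  exact: (family_max oG fv (family_zero G z0)).
by split=> [Q|]; [rewrite le_max lexx orbT|rewrite lt_max vP].
Qed.

Variable r0 : R.
Hypothesis r0_gt0 : 0 < r0.
Hypothesis disk_sub : forall z, modulus (z - z0) <= r0 -> G (fin_pt z).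

(* Replaces v in the disk by a harmonic function with an exact logarithmic pole; the
   factor 1 - c makes the new function dominate near the pole. *)
Lemma family_lift v (c : R) e : green_family G z0 v -> (forall P, 0 <= v P) -> 0 < c < 1 -> 0 < e ->
  exists V T, [/\ green_family G z0 V,
    forall P, P <> fin_pt z0 -> (1 - c) * v P <= V P,
    exists2 b, 0 < b & forall z, z != z0 -> modulus (z - z0) < b ->
      V (fin_pt z) = T z - ln (modulus (z - z0)),
    forall z, modulus (z - z0) < r0 -> harm_pt T z &
    (1 - c) * mean (v \o @fin_pt R) z0 r0 + ln r0 - e <= T z0].
Proof.
move=> fv v0 /andP[c0 c1] e0.
have k01 : 0 <= 1 - c <= 1 by apply/andP; split; lra.
have fkv := family_scale oG k01 fv.
pose kv := fun P => (1 - c) * v P.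
have e20 : 0 < e / 2 by rewrite divr_gt0.
have circle_neq w : modulus (w - z0) = r0 -> w != z0.
  by move=> wr; rewrite -subr_eq0 -modulus_gt0 wr.
have cv : continuous_circle_at (v \o @fin_pt R) z0 r0.
  by move=> w wr; have := family_subh oG fv (circle_neq w wr); exact: subh_pt_cont.
pose phi : R[i]^o -> R := fun w => (1 - c) * v (fin_pt w) + ln r0.
have cphi : continuous_circle_at phi z0 r0.
  move=> w wr; apply: contD; last exact: cont_cst.
  by apply: contM; [exact: cont_cst|exact: cv].
have [T1 [cT1 mT1 T1phi _]] := harmonic_approximation r0_gt0 (divr_gt0 e20 (ltr0n R 2)) cphi.
(* The shift exceeds the approximation error [e / 4], so on the circle the logarithmic branch [lT]
   stays strictly below [kv], and the maximum of the two inside joins [kv] outside without a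
   jump. *)
pose T : R[i]^o -> R := fun w => T1 w - e / 2.
have hT1 := harm_pt_disk cT1 mT1.
have hT z : modulus (z - z0) < r0 -> harm_pt T z.
  by move=> zr; apply: harm_ptB; [exact: hT1|exact: harm_cst].
have cT z : modulus (z - z0) <= r0 -> {for (z : R[i]^o), continuous T}.
  by move=> zr; apply: contB; [exact: cT1|exact: cont_cst].
pose lT (z : R[i]^o) : R := T z - ln (modulus (z - z0)).
pose V (P : sphere R) := if P is Some z then
    if (modulus (z - z0) < r0) && (z != z0) then Num.max (kv P) (lT z) else kv P
  else kv P.
have V_in z : modulus (z - z0) < r0 -> z != z0 -> V (fin_pt z) = Num.max (kv (fin_pt z)) (lT z).
  by move=> zr zz; rewrite /V /fin_pt zr zz.
have V_out z : r0 <= modulus (z - z0) -> V (fin_pt z) = kv (fin_pt z).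
  by move=> zr; rewrite /V /fin_pt ltNge zr.
have V_circle w : modulus (w - z0) = r0 -> lT w < kv (fin_pt w).
  move=> wr; have := T1phi w wr; rewrite ler_norml => /andP[_].
  by rewrite /lT /T /phi /kv wr; lra.
have clT w : modulus (w - z0) <= r0 -> w != z0 -> {for (w : R[i]^o), continuous lT}.
  by move=> wr wz; apply: contB; [exact: cT|exact: continuous_ln_modulus].
have hlT w : modulus (w - z0) < r0 -> w != z0 -> harm_pt lT w.
  by move=> wr wz; apply: harm_ptB; [exact: hT|exact: harm_ln].
have sV w : w != z0 -> subh_pt (V \o @fin_pt R) w.
  move=> wz; have skv := family_subh oG fkv wz.
  have FF : Filter (nbhs (w : R[i]^o)) by exact: nbhs_filter.
  have [wr|wr|wr] := ltgtP (modulus (w - z0)) r0.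
  - apply: (@subh_pt_near _ (fun w => Num.max (kv (fin_pt w)) (lT w))); last first.
      by apply: subh_pt_max; [exact: skv|exact/harm_subh/hlT].
    have h1 : \forall w' \near (w : R[i]^o), modulus (w' - z0) < r0.
      apply/nbhs_plane; exists (r0 - modulus (w - z0)); first by rewrite subr_gt0.
      by move=> w' h; have := modulusD (w' - w) (w - z0); rewrite addrA subrK; lra.
    by apply: (filterS2 _ _ h1 (near_neq wz)) => w' h2 h3; rewrite /comp V_in.
  - apply: (@subh_pt_near _ (kv \o @fin_pt R)); last exact: skv.
    apply/nbhs_plane; exists (modulus (w - z0) - r0); first by rewrite subr_gt0.
    move=> w' h; rewrite /comp V_out//.
    have := modulus_le_dist (w - z0) (w' - z0); rewrite opprB addrA subrK (modulusB w w'); lra.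
  - apply: (@subh_pt_near _ (kv \o @fin_pt R)); last exact: skv.
    have cd : {for (w : R[i]^o), continuous (fun w : R[i]^o => kv (fin_pt w) - lT w)}.
      apply: contB; last by apply: clT => //; rewrite wr.
      exact: (subh_pt_cont skv).
    have dp : 0 < kv (fin_pt w) - lT w by rewrite subr_gt0 V_circle.
    have /continuous_plane/(_ _ dp)[b b0 bA] := cd.
    apply/nbhs_plane; exists b => // w' w'b; rewrite /comp.
    have h : lT w' < kv (fin_pt w').
      by have := bA w' w'b; rewrite ltr_norml => /andP[h _]; lra.
    have [h1|h1] := ltP (modulus (w' - z0)) r0; last by rewrite V_out.
    have [->|h2] := eqVneq w' z0; first by rewrite /V /fin_pt eqxx andbF.
    by rewrite V_in// max_l// ltW.
have [_ [K [cK KG K0]] [M /near_dnbhs[b b0 bM]]] := fv.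
have TM : exists2 m, 0 < m & forall z, modulus (z - z0) < m -> T z0 - 1 <= T z.
  have z0r : modulus (z0 - z0) <= r0 by rewrite subrr modulus0 ltW.
  have /continuous_plane/(_ _ ltr01)[m m0 mA] := cT z0 z0r.
  by exists m => // z /mA; rewrite ltr_norml => /andP[h _]; lra.
have [m m0 mT] := TM.
(* Near the pole [kv] grows at most like [- (1 - c) * ln |z - z0|]; the missing [- c * ln |z - z0|]
   puts it below [lT] within [b']. *)
pose b' := Num.min (Num.min b m) (Num.min r0 (expR ((T z0 - 1 - (1 - c) * M) / c))).
have b'0 : 0 < b' by rewrite !lt_min b0 m0 r0_gt0 expR_gt0.
have V_pole z : z != z0 -> modulus (z - z0) < b' -> V (fin_pt z) = lT z.
  move=> zz; rewrite !lt_min => /andP[/andP[zb zm] /andP[zr ze]].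
  rewrite V_in// max_r// /lT /kv.
  have h1 := bM z zz zb; have h2 := mT z zm.
  have zp : 0 < modulus (z - z0) by rewrite modulus_gt0 subr_eq0.
  have h3 : ln (modulus (z - z0)) <= (T z0 - 1 - (1 - c) * M) / c.
    by rewrite -[leRHS]expRK ler_ln ?posrE ?expR_gt0// ltW.
  have h4 : c * ln (modulus (z - z0)) <= T z0 - 1 - (1 - c) * M by rewrite mulrC -ler_pdivlMr.
  have h5 : (1 - c) * (v (fin_pt z) + ln (modulus (z - z0))) <= (1 - c) * M.
    by rewrite ler_wpM2l//; lra.
  lra.
exists V, T; split => //.
- apply: family_intro.
  + by move=> w _; exact: sV.
  + move=> GN; pose X := Num.max 1 (modulus z0 + r0).
    have X0 : 0 < X by rewrite lt_max ltr01.
    have far z : X < modulus z -> V (fin_pt z) = kv (fin_pt z).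
      rewrite gt_max => /andP[_ h]; apply: V_out.
      by have := modulus_le_dist z z0; lra.
    split.
      apply: (@cont_near R (sphere R) None kv); last exact: family_cont fkv _.
      by apply/nbhs_infty; split => //; exists X => // z /far ->.
    have X1 : \forall r \near +oo, X < r by exists X; split; [exact: num_real|].
    apply: (filterS2 _ _ (family_large_circle fkv) X1) => r [rr cc kvm] Xr.
    apply: le_trans kvm _; rewrite !circle_meanE (eq_mean (v := V \o @fin_pt R))//.
    by move=> w; rewrite subr0 => wr; rewrite /comp far ?wr.
  + exists (K `|` @fin_pt R @` cdisk z0 r0); split.
    * by apply: compactU => //; exact/compact_fin/compact_cdisk.
    * by move=> P [/KG//|[z zr <-]]; exact: disk_sub.
    * move=> P /not_orP[/K0 vP nP]; have kvP : kv P = 0 by rewrite /kv vP mulr0.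
      case: P kvP vP nP => [z|] kvP _ nP; last exact: kvP.
      rewrite -kvP; apply: V_out; rewrite leNgt; apply/negP => zr; apply: nP.
      by exists z => //; exact: ltW.
  exists (T z0 + 1).
  have z0r : modulus (z0 - z0) <= r0 by rewrite subrr modulus0 ltW.
  have /continuous_plane/(_ _ ltr01)[m' m'0 m'A] := cT z0 z0r.
  apply/near_dnbhs; exists (Num.min b' m'); first by rewrite lt_min b'0.
  move=> z zz; rewrite lt_min => /andP[zb zm]; rewrite V_pole// subrK.
  by have := m'A z zm; rewrite ltr_norml => /andP[_]; lra.
- move=> [z|] Pz //; have zz : z != z0 by apply/eqP => zE; apply: Pz; rewrite zE.
  have [zr|zr] := ltP (modulus (z - z0)) r0; last by rewrite V_out.
  by rewrite V_in// le_max lexx.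
- by exists b'.
have rr := ltW r0_gt0.
have T1z : mean T1 z0 r0 = T1 z0 by apply: mT1; rewrite // subrr modulus0 add0r.
have : mean phi z0 r0 <= mean (fun w => T1 w + e / 2 / 2) z0 r0.
  apply: le_mean => //.
    by move=> w wr; apply: contD; [apply: cT1; rewrite wr|exact: cont_cst].
  by move=> w wr; have := T1phi w wr; rewrite ler_norml => /andP[h _]; lra.
rewrite meanD ?mean_cst//; first last.
- by move=> w _; exact: cont_cst.
- by move=> w wr; apply: cT1; rewrite wr.
rewrite T1z /phi meanD ?mean_cst ?meanZ//; first last.
- by move=> w _; exact: cont_cst.
- by move=> w wr; apply: contM; [exact: cont_cst|exact: cv].
rewrite /T; lra.
Qed.

End GreenFunction.

(** * Existence of the inner radius *)

Section InnerRadius.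
Context (R : realType) (G : set (sphere R)) (z0 p : R[i]) (d r0 : R).
Implicit Types (z w : R[i]) (x y r s t e c : R) (v V : sphere R -> R) (T : R[i]^o -> R).
Hypothesis oG : open G.
Hypothesis Gz0 : G (fin_pt z0).
Hypothesis d0 : 0 < d.
Hypothesis Gp : forall z, modulus (z - p) <= d -> ~ G (fin_pt z).
Hypothesis r0_gt0 : 0 < r0.
Hypothesis disk_sub : forall z, modulus (z - z0) <= r0 -> G (fin_pt z).

(** The value at [z0] of the harmonic function in the disk whose values on the circle are those of v
    + ln |z - z0|. It replaces the constant term at the pole, which [v] need not have. *)
Definition pole_mean v : R := mean (v \o @fin_pt R) z0 r0 + ln r0.

(** The bound from [majorant] on the circle of radius [r0], with |w - p| <= |z0 - p| + r0 and the
    terms ln r0 cancelled. *)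
Definition pole_bound : R := ln (1 + modulus (p - z0) / d) + ln (modulus (z0 - p) + r0).

Lemma circle_neq w : modulus (w - z0) = r0 -> w != z0.
Proof. by move=> wr; rewrite -subr_eq0 -modulus_gt0 wr. Qed.

Lemma family_circle_cont v : green_family G z0 v -> continuous_circle_at (v \o @fin_pt R) z0 r0.
Proof. by move=> fv w wr; exact: subh_pt_cont (family_subh oG fv (circle_neq wr)). Qed.

Lemma family_pole_bound v w : green_family G z0 v -> modulus (w - z0) = r0 ->
  v (fin_pt w) + ln r0 <= pole_bound.
Proof.
move=> fv wr; have wz := circle_neq wr.
have Gw : G (fin_pt w) by apply: disk_sub; rewrite wr.
have := @family_le_majorant R G z0 p d oG Gz0 d0 Gp v (fin_pt w) fv Gw.
have fw : fin_pt w <> fin_pt z0 by move=> [wE]; rewrite wE eqxx in wz.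
move=> /(_ fw); rewrite /majorant /pole_bound /= wr.
have wp : 0 < modulus (w - p).
  by apply: lt_trans d0 _; rewrite ltNge; apply/negP => /Gp.
have : ln (modulus (w - p)) <= ln (modulus (z0 - p) + r0).
  have rp : 0 < modulus (z0 - p) + r0.
    by apply: ltr_wpDl; [exact: modulus_ge0|exact: r0_gt0].
  rewrite ler_ln ?posrE//.
  by have := modulusD (w - z0) (z0 - p); rewrite addrA subrK wr; lra.
lra.
Qed.

Lemma pole_mean_le v : green_family G z0 v -> pole_mean v <= pole_bound.
Proof.
move=> fv; rewrite -lerBrDr; apply: mean_le_cst; first exact: ltW.
  exact: family_circle_cont.
by move=> w wr; rewrite lerBrDr; exact: family_pole_bound.
Qed.

(** Harnack's inequality for a harmonic function with the nonnegative boundary values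
    [pole_bound - (v + ln r0)]. As [z] tends to [z0] the right-hand side tends to [pole_mean v], at
    a rate that can be made uniform over the nonnegative members. *)
Lemma family_upper v z : green_family G z0 v -> z != z0 -> modulus (z - z0) < r0 ->
  v (fin_pt z) + ln (modulus (z - z0)) <=
  pole_bound - (r0 - modulus (z - z0)) / (r0 + modulus (z - z0)) * (pole_bound - pole_mean v).
Proof.
move=> fv zz zr; have cv := family_circle_cont fv.
have r00 := r0_gt0; have rr := ltW r00.
set B := pole_bound; set k := (_ - _) / _.
have s0 := modulus_ge0 (z - z0).
have k0 : 0 <= k by rewrite /k divr_ge0//; lra.
have k1 : k <= 1 by rewrite /k ler_pdivrMr; lra.
apply/ler_addgt0Pr => e e0.
have e20 : 0 < e / 2 by rewrite divr_gt0.
pose phi : R[i]^o -> R := fun w => B - (v (fin_pt w) + ln r0).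
have cphi : continuous_circle_at phi z0 r0.
  move=> w wr; apply: contB; first exact: cont_cst.
  by apply: contD; [exact: cv|exact: cont_cst].
have [T [cT mT Tphi Harn]] := harmonic_approximation r00 e20 cphi.
have phi0 w : modulus (w - z0) = r0 -> 0 <= phi w.
  by move=> wr; rewrite subr_ge0; exact: family_pole_bound.
have Tz := Harn phi0 z zr.
have T0 : T z0 = mean T z0 r0 by rewrite mT// subrr modulus0 add0r.
have cTc : continuous_circle_at T z0 r0 by move=> w wr; apply: cT; rewrite wr.
have T1 : B - pole_mean v - e / 2 <= T z0.
  have : mean phi z0 r0 <= mean (fun w => T w + e / 2) z0 r0.
    apply: le_mean => //.
      by move=> w wr; apply: contD; [exact: cTc|exact: cont_cst].
    by move=> w wr; have := Tphi w wr; rewrite ler_norml => /andP[]; lra.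
  have cc x : continuous_circle_at (fun=> x) z0 r0 by move=> w _; exact: cont_cst.
  have -> : mean phi z0 r0 = B - pole_mean v.
    rewrite /phi (@meanB R (fun=> B) (fun w => v (fin_pt w) + ln r0))//.
      rewrite mean_cst (@meanD R (v \o @fin_pt R) (fun=> ln r0))//.
      by rewrite mean_cst.
    by move=> w wr; apply: contD; [exact: cv|exact: cont_cst].
  rewrite (@meanD R T (fun=> e / 2))// mean_cst T0; lra.
suff H : v (fin_pt z) + ln (modulus (z - z0)) <= B - T z + e / 2.
  apply: le_trans H _; have : k * (B - pole_mean v - e / 2) <= k * T z0 by rewrite ler_wpM2l.
  have : k * (e / 2) <= e / 2 by rewrite ler_piMl// ltW.
  rewrite -/k in Tz; lra.
(* comparison in the punctured disk, the pole being absorbed by a small multiple of the logarithm *)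
have zp : 0 < modulus (z - z0) by rewrite modulus_gt0 subr_eq0.
have L0 : 0 <= ln r0 - ln (modulus (z - z0)) by rewrite subr_ge0 ler_ln ?posrE// ltW.
suff H eta : 0 < eta -> v (fin_pt z) + ln (modulus (z - z0)) - (B - T z + e / 2) <=
    eta * (ln r0 - ln (modulus (z - z0))).
  rewrite -subr_le0; apply/ler_addgt0Pr => h h0; rewrite add0r.
  have h1 : 0 < h / (ln r0 - ln (modulus (z - z0)) + 1) by rewrite divr_gt0// ltr_wpDl.
  apply: le_trans (H _ h1) _; rewrite mulrAC ler_pdivrMr ?ltr_wpDl//.
  by rewrite ler_pM2l// lerDl.
move=> eta0.
have [_ _ [M /near_dnbhs[b b0 bM]]] := fv.
have [m mT'] : exists m, forall w, modulus (w - z0) <= r0 -> T w <= m.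
  have K0 : cdisk z0 r0 z0 by rewrite /cdisk /= subrr modulus0.
  have [|w Kw wm] := @EVT_compact R R[i]^o (cdisk z0 r0) T (ex_intro _ _ K0) (@compact_cdisk R z0 r0).
    by move=> w; exact: cT.
  by exists (T w) => w' /wm.
pose f : R[i]^o -> R := fun w => v (fin_pt w) + ln (modulus (w - z0)) - (B - T w + e / 2) -
   eta * (ln r0 - ln (modulus (w - z0))).
pose tau := Num.min (Num.min b r0) (expR ((eta * ln r0 - M + B - m) / eta)) / 2.
have tau0 : 0 < tau by rewrite divr_gt0// !lt_min b0 r00 expR_gt0.
have f_pole w : w != z0 -> modulus (w - z0) <= tau -> f w <= 0.
  move=> wz wt; have wp : 0 < modulus (w - z0) by rewrite modulus_gt0 subr_eq0.
  have : modulus (w - z0) < 2 * tau by lra.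
  rewrite /tau mulrC divfK// !lt_min => /andP[/andP[wb wr] we].
  have h1 := bM w wz wb; have h2 := mT' w (ltW wr).
  have h3 : ln (modulus (w - z0)) <= (eta * ln r0 - M + B - m) / eta.
    by rewrite -[leRHS]expRK ler_ln ?posrE ?expR_gt0// ltW.
  have h4 : eta * ln (modulus (w - z0)) <= eta * ln r0 - M + B - m by rewrite mulrC -ler_pdivlMr.
  by rewrite /f; lra.
rewrite -subr_le0 -/(f z).
have [zt|zt] := leP (modulus (z - z0)) tau; first exact: f_pole.
pose K : set R[i]^o := cdisk z0 r0 `\` [set w | modulus (w - z0) < tau].
have cK : compact K.
  apply: (subclosed_compact _ (@compact_cdisk R z0 r0)); last exact: subDsetl.
  rewrite /K setDE; apply: closedI; first exact: closed_modulus_le.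
  apply: open_closedC.
  have -> : [set w : R[i]^o | modulus (w - z0) < tau] =
      (fun w : R[i]^o => modulus (w - z0)) @^-1` [set x | x < tau] by [].
  by apply: open_comp; [move=> ? _; exact: continuous_modulusB|exact: open_lt].
have KE w : K w -> modulus (w - z0) <= r0 /\ w != z0.
  move=> [h1 /= h2]; split => //; apply/eqP => wE; apply: h2.
  by rewrite wE subrr modulus0.
have cf w : modulus (w - z0) <= r0 -> w != z0 -> {for (w : R[i]^o), continuous f}.
  move=> wr wz; have c1 := subh_pt_cont (family_subh oG fv wz).
  have c2 := continuous_ln_modulus wz; have c3 := cT w wr.
  apply: contB; first apply: contB.
  - exact: contD.
  - by apply: contD; [apply: contB; [exact: cont_cst|]|exact: cont_cst].
  by apply: contM; [exact: cont_cst|apply: contB; [exact: cont_cst|]].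
apply: (plane_maximum_principle cK); last by split => //=; [exact: ltW|rewrite ltNge (ltW zt)].
  by move=> w /KE[]; exact: cf.
move=> w Kw fw; have [wr wz] := KE w Kw.
have {}wr : modulus (w - z0) < r0.
  rewrite lt_neqAle wr andbT; apply/eqP => wr'; move: fw; rewrite ltNge => /negP; apply.
  have := Tphi w wr'; rewrite ler_norml => /andP[_ h].
  by rewrite /f wr' /phi in h *; lra.
split.
  apply: subh_ptB; first apply: subh_ptB.
  - have sv := family_subh oG fv wz.
    by apply: (@subh_ptD _ (v \o @fin_pt R)); [exact: sv|exact/harm_subh/harm_ln].
  - apply: harm_ptD; last exact: harm_cst.
    by apply: harm_ptB; [exact: harm_cst|exact: (harm_pt_disk cT mT)].
  by apply: harm_ptZ; apply: harm_ptB; [exact: harm_cst|exact: harm_ln].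
have h1 : \forall w' \near (w : R[i]^o), modulus (w' - z0) < r0.
  apply/nbhs_plane; exists (r0 - modulus (w - z0)); first by rewrite subr_gt0.
  by move=> w' h; have := modulusD (w' - w) (w - z0); rewrite addrA subrK; lra.
have FF : Filter (nbhs (w : R[i]^o)) by exact: nbhs_filter.
apply: (filterS2 _ _ h1 (near_neq wz)) => w' w'r w'z.
have [h|h] := ltP (modulus (w' - z0)) tau; first by right; apply: f_pole => //; exact: ltW.
by left; split => /=; [exact: ltW|rewrite ltNge h].
Qed.

(** [L] is the supremum of [pole_mean] over the nonnegative members. The lift of a nearly optimal
    member bounds the Green function below near the pole; the Harnack bound, in which [pole_mean] is
    at most [L], bounds it above. *)
Lemma inner_radius_exists : exists L,
  [/\ green G z0 (fin_pt z) + ln (modulus (z - z0)) @[z --> (z0 : R[i]^o)^'] --> L,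
      inner_radius G z0 = expR L &
      forall e, 0 < e -> exists v, [/\ green_family G z0 v, forall P, 0 <= v P & L - e < pole_mean v]].
Proof.
pose S := [set pole_mean v | v in [set v | green_family G z0 v /\ forall P, 0 <= v P]].
have S0 : S !=set0 by exists (pole_mean (fun=> 0)); exists (fun=> 0) => //; split => //; exact: family_zero.
have Sub : ubound S pole_bound by move=> _ [v [fv _] <-]; exact: pole_mean_le.
have hS : has_sup S by split => //; exists pole_bound.
pose L := sup S.
have Lapp e : 0 < e -> exists v, [/\ green_family G z0 v, forall P, 0 <= v P & L - e < pole_mean v].
  by move=> e0; have [_ [v [fv v0] <-] vL] := sup_adherent e0 hS; exists v.
have LB : L <= pole_bound by apply: ge_sup.
have Lge v : green_family G z0 v -> (forall P, 0 <= v P) -> pole_mean v <= L.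
  by move=> fv v0; apply: ub_le_sup; [exists pole_bound|exists v].
have FF : ProperFilter ((z0 : R[i]^o)^') by exact: Proper_dnbhs_numFieldType.
have cvgL : green G z0 (fin_pt z) + ln (modulus (z - z0)) @[z --> (z0 : R[i]^o)^'] --> L.
  apply/(@cvgrPdist_le _ _ _ ((z0 : R[i]^o)^')) => e e0.
  have e40 : 0 < e / 4 by rewrite divr_gt0.
  have [v [fv v0 vL]] := Lapp _ e40.
  have m0 : 0 <= mean (v \o @fin_pt R) z0 r0.
    by apply: cst_le_mean; [exact: ltW|exact: family_circle_cont|move=> w _; exact: v0].
  (* Limits to [e / 4] the part of the circle mean lost through the factor [1 - c] of the lift. *)
  pose c := Num.min (1 / 2) (e / 4 / (mean (v \o @fin_pt R) z0 r0 + 1)).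
  have c0 : 0 < c by rewrite lt_min !divr_gt0//= ltr_wpDl.
  have c2 : c <= 1 / 2 by rewrite ge_min lexx.
  have c1 : 0 < c < 1 by rewrite c0 /=; lra.
  have cm : c * mean (v \o @fin_pt R) z0 r0 <= e / 4.
    apply: (@le_trans _ _ (c * (mean (v \o @fin_pt R) z0 r0 + 1))); first by rewrite ler_pM2l// lerDl.
    by rewrite -ler_pdivlMr ?ltr_wpDl// ge_min lexx orbT.
  have [V [T [fV _ [b b0 VT] hT Tz0]]] := family_lift oG r0_gt0 disk_sub fv v0 c1 e40.
  have z0r : modulus (z0 - z0) < r0 by rewrite subrr modulus0.
  have /continuous_plane/(_ _ e40)[b' b'0 b'T] := subh_pt_cont (harm_subh (hT z0 z0r)).
  have LB1 : 0 <= pole_bound - L by rewrite subr_ge0.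
  (* The Harnack factor [k] satisfies [1 - k <= 2 * |z - z0| / r0], so within [b3] the excess
     [(1 - k) * (pole_bound - L)] is at most [e]. *)
  pose b3 := e * r0 / (2 * (pole_bound - L + 1)).
  have b30 : 0 < b3 by rewrite divr_gt0 ?mulr_gt0// ltr_wpDl.
  apply/near_dnbhs; exists (Num.min (Num.min b b') (Num.min r0 b3)).
    by rewrite !lt_min b0 b'0 r0_gt0.
  move=> z zz; rewrite !lt_min => /andP[/andP[zb zb'] /andP[zr zb3]].
  have Gz : G (fin_pt z) by apply: disk_sub; exact: ltW.
  have zP : fin_pt z <> fin_pt z0 by move=> [zE]; rewrite zE eqxx in zz.
  have lower : L - e <= green G z0 (fin_pt z) + ln (modulus (z - z0)).
    have := green_ge oG Gz0 d0 Gp fV Gz zP; rewrite (VT z zz zb).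
    have := b'T z zb'; rewrite ltr_norml => /andP[h _].
    rewrite /pole_mean in vL; lra.
  have s0 := modulus_ge0 (z - z0).
  have r00 := r0_gt0.
  have upper : green G z0 (fin_pt z) <= L + e - ln (modulus (z - z0)).
    apply: green_le => u fu.
    pose u' := fun P => Num.max (u P) 0.
    have fu' : green_family G z0 u' by exact: (family_max oG fu (family_zero G z0)).
    have u'0 P : 0 <= u' P by rewrite le_max lexx orbT.
    apply: (@le_trans _ _ (u' (fin_pt z))); first by rewrite le_max lexx.
    have := family_upper fu' zz zr; set k := _ / _ => H.
    have k0 : 0 <= k by rewrite /k divr_ge0//; lra.
    have k1 : 1 - k <= 2 * modulus (z - z0) / r0.
      have rs : 0 < r0 + modulus (z - z0) by lra.
      have -> : 1 - k = 2 * modulus (z - z0) / (r0 + modulus (z - z0)).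
        by rewrite /k; field; rewrite gt_eqF.
      by rewrite ler_wpM2l// ?mulr_ge0// lef_pV2 ?posrE//; lra.
    have h1 : k * (pole_bound - L) <= k * (pole_bound - pole_mean u').
      by rewrite ler_wpM2l// lerD2l lerN2 Lge.
    have h2 : (1 - k) * (pole_bound - L) <= 2 * modulus (z - z0) / r0 * (pole_bound - L).
      by rewrite ler_wpM2r.
    have h3 : 2 * modulus (z - z0) / r0 * (pole_bound - L) <= e.
      rewrite mulrAC ler_pdivrMr//.
      have h3 : modulus (z - z0) * (2 * (pole_bound - L + 1)) <= e * r0.
        by rewrite -ler_pdivlMr ?mulr_gt0 ?ltr_wpDl// ltW.
      lra.
    lra.
  by rewrite ler_norml; apply/andP; split; lra.
exists L; split => //.
by rewrite /inner_radius; congr expR; apply: cvg_lim => //; exact: Rhausdorff.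
Qed.

End InnerRadius.

(** * From members of a Perron family to potentials on the whole plane *)

Section PotentialOfFamily.
Context (R : realType) (G : set (sphere R)) (z0 p : R[i]) (d r0 : R).
Implicit Types (z w : R[i]) (x y r s t e c : R) (v V : sphere R -> R) (T : R[i]^o -> R).
Hypothesis oG : open G.
Hypothesis Gz0 : G (fin_pt z0).
Hypothesis d0 : 0 < d.
Hypothesis Gp : forall z, modulus (z - p) <= d -> ~ G (fin_pt z).
Hypothesis r0_gt0 : 0 < r0.
Hypothesis disk_sub : forall z, modulus (z - z0) <= r0 -> G (fin_pt z).

Lemma lcut_ge_ln z : z != p -> ln (modulus (z - p)) <= lcut p d z.
Proof.
move=> zp; have zp0 : 0 < modulus (z - p) by rewrite modulus_gt0 subr_eq0.
by rewrite /lcut ler_ln ?posrE ?lt_max ?zp0// le_max lexx.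
Qed.

Lemma lcut_ge_cst z : ln d <= lcut p d z.
Proof. by rewrite /lcut ler_ln ?posrE ?lt_max ?d0 ?orbT// le_max lexx orbT. Qed.

Lemma harm_lcut z : d < modulus (z - p) -> harm_pt (lcut p d) z.
Proof.
move=> zd; have zp : z != p by rewrite -subr_eq0 -modulus_gt0 (lt_trans d0).
have N : \forall w \near (z : R[i]^o), ln (modulus (w - p)) = lcut p d w.
  apply/nbhs_plane; exists (modulus (z - p) - d); first by rewrite subr_gt0.
  move=> w h; rewrite lcut_far//.
  have := modulus_le_dist (z - p) (w - p); rewrite opprB addrA subrK (modulusB z w); lra.
have hl := harm_ln zp.
split; first by apply: filterS (fun w _ => @continuous_lcut R p d d0 w) hl.1.
apply: (filterS2 _ _ (near_circle N) (harm_pt_circle hl)) => r [r_ge0 h] [_ cl lm].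
rewrite -(h z); last by rewrite subrr modulus0.
by rewrite -lm; apply: eq_mean => // w wr; rewrite h// wr.
Qed.

(* The lift of v is cut off near infinity by subtracting a small multiple of the
   logarithm with pole at p outside G. *)
Lemma potential_of_family (S : seq R[i]) v e :
  green_family G z0 v -> (forall P, 0 <= v P) -> 0 < e ->
  exists (f : R[i]^o -> R) (Y : R) (A : set R[i]^o),
    [/\ continuous f, forall z, subh_pt f z,
        forall z, Y < modulus z -> f z = ln (modulus (z - z0)),
        forall z, z != z0 -> ln (modulus (z - z0)) <= f z & compact A] /\
    [/\ forall z, z = z0 \/ f z <> ln (modulus (z - z0)) -> A z,
        forall z, A z -> G (fin_pt z),
        pole_mean z0 r0 v - e <= f z0 &
        forall z, z \in S -> z != z0 -> v (fin_pt z) + ln (modulus (z - z0)) - e <= f z].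
Proof.
move=> fv v0 e0.
have e40 : 0 < e / 4 by rewrite divr_gt0.
pose mv := mean (v \o @fin_pt R) z0 r0.
have mv0 : 0 <= mv.
  apply: cst_le_mean; [exact: ltW| |by move=> w _; exact: v0].
  exact: (family_circle_cont oG r0_gt0 fv).
(* [Mx] bounds at once the circle mean and all values of [v] on [S], so that one [c] controls the
   loss of the lift at the pole and at these points. [Lx] below does the same for the cut-off. *)
pose Mx := mv + \sum_(z <- S) v (fin_pt z).
have Sv0 : 0 <= \sum_(z <- S) v (fin_pt z) by apply: sumr_ge0 => z _; exact: v0.
have Mx0 : 0 <= Mx by rewrite addr_ge0.
have in_sum (F : R[i] -> R) z : (forall w, 0 <= F w) -> z \in S -> F z <= \sum_(w <- S) F w.
  move=> F0; elim: S {Mx Sv0 Mx0} => // w S ih; rewrite in_cons big_cons => /orP[/eqP->|/ih h].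
    by rewrite lerDl sumr_ge0.
  by apply: le_trans h _; rewrite lerDr.
pose c := Num.min (1 / 2) (e / 4 / (Mx + 1)).
have c0 : 0 < c by rewrite lt_min !divr_gt0//= ltr_wpDl.
have c2 : c <= 1 / 2 by rewrite ge_min lexx.
have c1 : 0 < c < 1 by rewrite c0 /=; lra.
have cM x : x <= Mx -> c * x <= e / 4.
  move=> xM; apply: (@le_trans _ _ (c * (Mx + 1))); first by rewrite ler_pM2l//; lra.
  by rewrite -ler_pdivlMr ?ltr_wpDl// ge_min lexx orbT.
have [V [T [fV vV [b b0 VT] hT Tz0]]] := family_lift oG r0_gt0 disk_sub fv v0 c1 e40.
pose lam : R[i]^o -> R := fun z => lcut p d z - ln d.
have lam0 z : 0 <= lam z by rewrite subr_ge0; exact: lcut_ge_cst.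
pose Lx := lam z0 + \sum_(z <- S) lam z.
have Lx0 : 0 <= Lx by rewrite addr_ge0// sumr_ge0.
pose eps := e / 4 / (Lx + 1).
have eps0 : 0 < eps by rewrite divr_gt0// ltr_wpDl.
have epsL x : x <= Lx -> eps * x <= e / 4.
  move=> xL; apply: (@le_trans _ _ (eps * (Lx + 1))); first by rewrite ler_pM2l//; lra.
  by rewrite divfK// gt_eqF// ltr_wpDl.
have clam : continuous lam.
  by move=> z; exact: (contB (@continuous_lcut R p d d0 z) (@cont_cst R R[i]^o z (ln d))).
have hlam z : d < modulus (z - p) -> harm_pt lam z.
  by move=> zd; apply: harm_ptB; [exact: harm_lcut|exact: harm_cst].
(* [lam] tends to infinity with |z| while [V] stays bounded there, so the maximum with 0 vanishes
   far out; it also keeps [f] above the logarithm. *)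
pose W : R[i]^o -> R := fun z => Num.max (V (fin_pt z) - eps * lam z) 0.
have W0 z : 0 <= W z by rewrite le_max lexx orbT.
pose f : R[i]^o -> R := fun z => if z == z0 then T z0 - eps * lam z0 else W z + ln (modulus (z - z0)).
have [K [cK clK KG K0]] := family_off fV.
have V_None : {for (None : sphere R), continuous V} by apply: (family_cont fV).
have /continuous_infty/(_ _ ltr01)[X1 X10 X1V] := V_None.
pose Y := Num.max (Num.max X1 (modulus z0)) (modulus p + expR (`|V None + 1| / eps + ln d)).
have W_far z : Y < modulus z -> W z = 0.
  rewrite !gt_max => /andP[/andP[zX _] zp].
  have h1 := X1V z zX; have VB : V (fin_pt z) <= `|V None + 1|.
    by rewrite ltr_norml in h1; case/andP: h1 => _ h1; apply: le_trans (ler_norm _); lra.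
  have zpE : expR (`|V None + 1| / eps + ln d) < modulus (z - p).
    by have := modulus_le_dist z p; lra.
  have zp0 : 0 < modulus (z - p) by apply: lt_trans zpE; exact: expR_gt0.
  have zpn : z != p by rewrite -subr_eq0 -modulus_gt0.
  have h2 : `|V None + 1| / eps <= lam z.
    rewrite /lam lerBrDr; apply: le_trans (lcut_ge_ln zpn).
    by rewrite -[leLHS]expRK ler_ln ?posrE ?expR_gt0// ltW.
  by rewrite /W max_r// subr_le0 mulrC -ler_pdivrMr// (le_trans _ h2)// ler_pM2r ?invr_gt0.
have far z : G (fin_pt z) -> d < modulus (z - p).
  by move=> Gz; rewrite ltNge; apply/negP => /Gp.
have sW z : z != z0 -> subh_pt W z.
  move=> zz; have sV := family_subh oG fV zz.
  have [zd|zd] := ltP d (modulus (z - p)).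
    apply: subh_pt_max; last exact/harm_subh/harm_cst.
    by apply: (@subh_ptB _ (V \o @fin_pt R)) => //; apply: harm_ptZ; exact: hlam.
  apply: (@subh_pt_near _ (fun=> 0)); last exact/harm_subh/harm_cst.
  have N : \forall w \near (z : R[i]^o), V (fin_pt w) = 0.
    exact: (family_zero_near fV (Gp zd)).
  have FF : Filter (nbhs (z : R[i]^o)) by exact: nbhs_filter.
  apply: (filterS _ N) => w Vw; rewrite /W Vw sub0r max_r//.
  by rewrite oppr_le0 mulr_ge0// ltW.
have fE z : z != z0 -> f z = W z + ln (modulus (z - z0)) by move=> zz; rewrite /f (negPf zz).
have z0r : modulus (z0 - z0) < r0 by rewrite subrr modulus0.
have hT0 := hT z0 z0r.
(* Close to [z0] the maximum with 0 is inactive and the logarithms cancel, leaving the harmonic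
   function [T - eps * lam]: the singularity is removable, and the value assigned at [z0] is the
   right one. *)
have f_pole : \forall z \near (z0 : R[i]^o), T z - eps * lam z = f z.
  pose g : R[i]^o -> R := fun z => T z - eps * lam z.
  have cg : {for (z0 : R[i]^o), continuous g}.
    apply: contB; first exact: (subh_pt_cont (harm_subh hT0)).
    by apply: contM; [exact: cont_cst|exact: clam].
  have /continuous_plane/(_ _ ltr01)[m m0 mA] := cg.
  apply/nbhs_plane; exists (Num.min (Num.min b m) (expR (g z0 - 1))).
    by rewrite !lt_min b0 m0 expR_gt0.
  move=> z; rewrite !lt_min => /andP[/andP[zb zm] ze].
  have [->|zz] := eqVneq z z0; first by rewrite /f eqxx.
  have zp : 0 < modulus (z - z0) by rewrite modulus_gt0 subr_eq0.
  rewrite fE// /W VT//.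
  have h3 : ln (modulus (z - z0)) <= g z0 - 1.
    by rewrite -[leRHS]expRK ler_ln ?posrE ?expR_gt0// ltW.
  have := mA z zm; rewrite /g in h3 *; rewrite ltr_norml => /andP[h4 _].
  by rewrite max_l; lra.
have sf z : subh_pt f z.
  have FF : Filter (nbhs (z : R[i]^o)) by exact: nbhs_filter.
  have [->|zz] := eqVneq z z0.
    apply: (subh_pt_near f_pole); apply: harm_subh; apply: harm_ptB => //.
    by apply: harm_ptZ; apply: hlam; exact: far.
  apply: (@subh_pt_near _ (fun z => W z + ln (modulus (z - z0)))).
    by apply: (filterS _ (near_neq zz)) => w wz; rewrite fE.
  by apply: subh_ptD; [exact: sW|exact/harm_subh/harm_ln].
have f_far z : Y < modulus z -> f z = ln (modulus (z - z0)).
  move=> zY; rewrite fE ?W_far ?add0r//.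
  by apply/eqP => zE; move: zY; rewrite zE !gt_max ltxx !andbF.
(* Away from the pole [f] differs from the logarithm only inside [K], where [V] may be nonzero, and
   only within [Y]; with the pole added this is a compact part of [G]. *)
exists f, Y, ((@fin_pt R @^-1` K `&` cdisk 0 Y) `|` [set z0]); split; split => //.
- by move=> z; exact: subh_pt_cont (sf z).
- by move=> z zz; rewrite fE// lerDr.
- apply: compactU; last exact: compact_set1.
  apply: (subclosed_compact _ (@compact_cdisk R 0 Y)); last exact: subIsetr.
  apply: closedI; last exact: closed_modulus_le.
  by apply: closed_comp => // z _; exact: continuous_fin_pt.
- move=> z; have [->|zz] := eqVneq z z0; first by right.
  move=> [zE|fz]; first by rewrite zE eqxx in zz.
  left; split; last first.
    by rewrite /cdisk /= subr0 leNgt; apply/negP => /f_far.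
  apply: contrapT => nK; apply: fz; rewrite fE// /W K0// sub0r max_r ?add0r//.
  by rewrite oppr_le0 mulr_ge0// ltW.
- by move=> z [[/KG]|->].
- rewrite /f eqxx; have h1 := cM mv; have h2 := epsL (lam z0).
  have : mv <= Mx by rewrite lerDl.
  have : lam z0 <= Lx by rewrite lerDl sumr_ge0.
  move=> /h2 h3 /h1 h4; rewrite /pole_mean -/mv; rewrite -/mv in Tz0; lra.
move=> z zS zz; rewrite fE//.
have zP : fin_pt z <> fin_pt z0 by move=> [zE]; rewrite zE eqxx in zz.
have h1 := vV _ zP.
have h2 : c * v (fin_pt z) <= e / 4.
  apply: cM; apply: le_trans (in_sum (fun z => v (fin_pt z)) z (fun w => v0 _) zS) _.
  by rewrite lerDr.
have h3 : eps * lam z <= e / 4.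
  by apply: epsL; apply: le_trans (in_sum lam z lam0 zS) _; rewrite lerDr.
have : V (fin_pt z) - eps * lam z <= W z by rewrite le_max lexx.
lra.
Qed.

End PotentialOfFamily.

(** * Products of differences of points on equally spaced rays *)

Section RootsOfUnity.
Context (R : realType).
Implicit Types (z w : R[i]) (x y r s t a b : R).

Lemma cis_neq1 (N m : nat) : (0 < m < N)%N -> cis (2 * pi * m%:R / N%:R) != 1 :> R[i].
Proof.
move=> mN; have H := sum_roots_of_unity R mN; have [m0 mN'] := andP mN.
apply/eqP => h.
have h' : cis (- (2 * pi * m%:R / N%:R)) = 1 :> R[i].
  by rewrite -cis_conj h rmorph1.
move: H; rewrite h'; under eq_bigr do rewrite expr1n.
rewrite sumr_const card_ord => /eqP; rewrite pnatr_eq0 => /eqP N0.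
by rewrite N0 ltn0 in mN'.
Qed.

Lemma primitive_cis (N : nat) : (0 < N)%N -> N.-primitive_root (cis (2 * pi / N%:R) : R[i]).
Proof.
move=> N0; have NR : N%:R != 0 :> R by rewrite pnatr_eq0 -lt0n.
have E k : (cis (2 * pi / N%:R) : R[i]) ^+ k = cis (2 * pi * k%:R / N%:R).
  by rewrite cisX; congr cis; rewrite mulrC mulrAC.
apply/andP; split => //; apply/forallP => i; rewrite unity_rootE E; apply/eqP.
have [iN|iN] := eqVneq i.+1 N.
  rewrite iN mulfK// -[2 * pi]add0r cis_periodic cis0; exact: eqxx.
apply/negbTE/cis_neq1; rewrite /= ltn_neqAle iN /=; exact: ltn_ord.
Qed.

(** The derivative of X^N - 1 at one of its roots is, on one side, the product of the differences
    and, on the other, N times a number of modulus 1. The shift of all indices by one multiplies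
    each difference by a root of unity. *)
Lemma prod_root_differences (N : nat) (k : 'I_N) :
  \prod_(l < N | l != k) modulus (cis (2 * pi * k.+1%:R / N%:R) - cis (2 * pi * l.+1%:R / N%:R))
  = N%:R :> R.
Proof.
have N0 : (0 < N)%N by apply: leq_ltn_trans (ltn_ord k).
set om := cis (2 * pi / N%:R) : R[i].
have E j : cis (2 * pi * j.+1%:R / N%:R) = om * om ^+ j.
  by rewrite -exprS cisX; congr cis; rewrite [in RHS]mulrC mulrAC.
have P := factor_Xn_sub_1 (primitive_cis N0); rewrite -/om in P.
rewrite big_mkord (bigD1 k)//= in P.
set Q := \prod_(i < N | i != k) _ in P.
have : (('X - (om ^+ k)%:P) * Q)^`().[om ^+ k] = ('X^N - 1)^`().[om ^+ k] by rewrite P.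
rewrite derivM derivB derivX derivC subr0 mul1r derivB derivXn derivC subr0.
rewrite !hornerE subrr mul0r addr0 hornerMn hornerXn => QE.
have mom : modulus om = 1 by exact: modulus_cis.
have -> : \prod_(l < N | l != k) modulus (cis (2 * pi * k.+1%:R / N%:R) - cis (2 * pi * l.+1%:R / N%:R))
   = modulus Q.[om ^+ k].
  rewrite /Q horner_prod (big_morph _ (@modulusM R) (modulus1 R)).
  by apply: eq_bigr => l _; rewrite !E -mulrBr modulusM mom mul1r !hornerE.
rewrite QE -mulr_natr modulusM !modulusX mom !expr1n mul1r.
by rewrite -(rmorph_nat (real_complex R)) modulus_real ger0_norm.
Qed.

(** The difference of the two sides is (a - b)^2. *)
Lemma modulus_polar_diff a b s t : 0 <= a -> 0 <= b ->
  a * b * modulus (cis s - cis t) ^+ 2 <= modulus (a%:C * cis s - b%:C * cis t) ^+ 2.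
Proof.
move=> a0 b0.
have e1 := cos2Dsin2 s; have e2 := cos2Dsin2 t.
have -> : a%:C * cis s - b%:C * cis t = (a * cos s - b * cos t) +i* (a * sin s - b * sin t).
  by rewrite /cis; simpc.
have -> : cis s - cis t = (cos s - cos t) +i* (sin s - sin t) by rewrite /cis; simpc.
rewrite !modulus_sqr /=.
have -> : (cos s - cos t) ^+ 2 + (sin s - sin t) ^+ 2 = 2 - 2 * (cos s * cos t + sin s * sin t).
  transitivity ((cos s ^+ 2 + sin s ^+ 2) + (cos t ^+ 2 + sin t ^+ 2) - 2 * (cos s * cos t + sin s * sin t)).
    by ring.
  by rewrite e1 e2.
have -> : (a * cos s - b * cos t) ^+ 2 + (a * sin s - b * sin t) ^+ 2 =
   a ^+ 2 + b ^+ 2 - 2 * (a * b) * (cos s * cos t + sin s * sin t).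
  transitivity (a ^+ 2 * (cos s ^+ 2 + sin s ^+ 2) + b ^+ 2 * (cos t ^+ 2 + sin t ^+ 2) -
     2 * (a * b) * (cos s * cos t + sin s * sin t)).
    by ring.
  by rewrite e1 e2 !mulr1.
have := sqr_ge0 (a - b); rewrite sqrrB; lra.
Qed.

Lemma sum_pairs (N : nat) (h : 'I_N -> 'I_N -> R) :
  \sum_(k < N) \sum_(l < N) (if (k <= l)%N then h k l else h l k) =
  \sum_(k < N) h k k + 2 * \sum_(k < N) \sum_(l < N | (k < l)%N) h k l.
Proof.
have E (k : 'I_N) : \sum_(l < N) (if (k <= l)%N then h k l else h l k) =
    h k k + \sum_(l < N | (k < l)%N) h k l + \sum_(l < N | (l < k)%N) h l k.
  rewrite (bigD1 k)//= leqnn -addrA; congr (_ + _).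
  rewrite (bigID (fun l : 'I_N => (k < l)%N))/=; congr (_ + _).
    apply: eq_big => [l|l /andP[_ kl]]; last by rewrite ltnW.
    by case: eqVneq => [->|]//=; rewrite ltnn.
  apply: eq_big => [l|l /andP[lk kl]].
    case: eqVneq => [->|lk]/=; first by rewrite ltnn.
    by rewrite -leqNgt ltn_neqAle (inj_eq val_inj) lk.
  rewrite -leqNgt in kl; case: ifPn => // kl'.
  have /val_inj lkE : (l : nat) = k by apply/eqP; rewrite eqn_leq kl kl'.
  by rewrite lkE eqxx in lk.
under eq_bigr do rewrite E.
rewrite !big_split /= -addrA; congr (_ + _); rewrite mulr_natl mulr2n; congr (_ + _).
by rewrite (exchange_big_dep predT)//=.
Qed.

Lemma sum_pairs_neq (N : nat) (h : 'I_N -> 'I_N -> R) : (forall k l, h k l = h l k) ->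
  2 * \sum_(k < N) \sum_(l < N | (k < l)%N) h k l = \sum_(k < N) \sum_(l < N | l != k) h k l.
Proof.
move=> hs; have := sum_pairs h; rewrite addrC => /eqP; rewrite -subr_eq => /eqP <-.
rewrite -sumrB; apply: eq_bigr => k _.
rewrite (bigD1 k)//= leqnn addrAC subrr add0r; apply: eq_bigr => l _.
by case: ifP.
Qed.

(** Over the ordered pairs each ln |z_k| occurs 2 (N - 1) times with weight 1/2, and for each k the
    differences of roots of unity contribute ln N. The same lower bound for |z_k - z_l| shows that
    the points are distinct. *)
Lemma sum_ln_differences (N : nat) (z : 'I_N -> R[i]) : (0 < N)%N ->
  (forall k, z k != 0 /\ z k = (modulus (z k))%:C * cis (2 * pi * k.+1%:R / N%:R)) ->
  (forall k l, k != l -> z k != z l) /\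
  (N.-1)%:R * \sum_(k < N) ln (modulus (z k)) + N%:R * ln N%:R <=
  2 * \sum_(k < N) \sum_(l < N | (k < l)%N) ln (modulus (z l - z k)).
Proof.
move=> N0 hz; pose ze (k : 'I_N) : R[i] := cis (2 * pi * k.+1%:R / N%:R).
have NR : 0 < N%:R :> R by rewrite ltr0n.
have m0 k : 0 < modulus (z k) by rewrite modulus_gt0; case: (hz k).
have ze0 k l : l != k -> 0 < modulus (ze k - ze l).
  move=> lk; rewrite lt0r modulus_ge0 andbT.
  have : \prod_(i < N | i != k) modulus (ze k - ze i) != 0.
    by rewrite (prod_root_differences k) gt_eqF.
  by move=> /prodf_neq0 /(_ l lk).
have D k l : modulus (z k) * modulus (z l) * modulus (ze k - ze l) ^+ 2 <= modulus (z k - z l) ^+ 2.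
  have [_ ->] := hz k; have [_ ->] := hz l.
  rewrite !modulusM !modulus_cis !mulr1 !modulus_real !(ger0_norm (modulus_ge0 _)).
  by apply: modulus_polar_diff; exact: modulus_ge0.
have Dp k l : l != k -> 0 < modulus (z k - z l).
  move=> lk; rewrite lt0r modulus_ge0 andbT; apply/eqP => h.
  have := D k l; rewrite h expr0n leNgt => /negP; apply.
  by apply: mulr_gt0; [exact: mulr_gt0|apply/exprn_gt0/ze0].
split.
  move=> k l kl; rewrite -subr_eq0 -modulus_gt0; apply: Dp; by rewrite eq_sym.
rewrite sum_pairs_neq; last by move=> k l; rewrite modulusB.
have L (k l : 'I_N) : l != k -> (ln (modulus (z k)) + ln (modulus (z l))) / 2 + ln (modulus (ze k - ze l)) <=
    ln (modulus (z l - z k)).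
  move=> lk; have := D k l; have ze1 := ze0 _ _ lk; have zk1 := Dp _ _ lk.
  have p1 : 0 < modulus (z k) * modulus (z l) by apply: mulr_gt0.
  have p2 : 0 < modulus (ze k - ze l) ^+ 2 by apply: exprn_gt0.
  rewrite -ler_ln ?posrE; [|exact: mulr_gt0|exact: exprn_gt0].
  rewrite lnM ?posrE// lnM ?posrE// !lnXn// (modulusB (z l)) !mulr2n.
  generalize (ln (modulus (ze k - ze l))) (ln (modulus (z k - z l))) => u v.
  rewrite -[1 + 1]/(2%:R : R); lra.
apply: (@le_trans _ _ (\sum_(k < N) \sum_(l < N | l != k)
   ((ln (modulus (z k)) + ln (modulus (z l))) / 2 + ln (modulus (ze k - ze l))))); last first.
  by apply: ler_sum => k _; apply: ler_sum => l; exact: L.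
have cardN (k : 'I_N) (x : R) : \sum_(l < N | l != k) x = (N.-1)%:R * x.
  by rewrite sumr_const mulr_natl; congr (_ *+ _); rewrite cardC1 card_ord.
have S1 (k : 'I_N) : \sum_(l < N | l != k) ln (modulus (ze k - ze l)) = ln N%:R.
  rewrite -(prod_root_differences k).
  suff : 0 < \prod_(l < N | l != k) modulus (ze k - ze l) /\
     \sum_(l < N | l != k) ln (modulus (ze k - ze l)) = ln (\prod_(l < N | l != k) modulus (ze k - ze l)) by case.
  elim/big_rec2: _ => [|l x y lk [x0 ->]]; first by rewrite ln1.
  by rewrite mulr_gt0 ?ze0// lnM ?posrE ?ze0.
have -> : \sum_(k < N) \sum_(l < N | l != k)
   ((ln (modulus (z k)) + ln (modulus (z l))) / 2 + ln (modulus (ze k - ze l))) =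
   \sum_(k < N) ((N.-1)%:R * (ln (modulus (z k)) / 2) + \sum_(l < N | l != k) ln (modulus (z l)) / 2 + ln N%:R).
  apply: eq_bigr => k _; rewrite big_split/= S1; congr (_ + _).
  by rewrite -(cardN k) -big_split/=; apply: eq_bigr => l _; rewrite mulrDl.
rewrite !big_split/= sumr_const card_ord -[ln _ *+ N]mulr_natl lerD2r.
have -> : \sum_(k < N) \sum_(l < N | l != k) ln (modulus (z l)) / 2 =
   \sum_(k < N) (N.-1)%:R * (ln (modulus (z k)) / 2).
  rewrite (exchange_big_dep predT)//=; apply: eq_bigr => l _.
  by rewrite -(cardN l); apply: eq_bigl => k; rewrite eq_sym.
rewrite -big_split/= mulr_sumr; apply: ler_sum => k _.
by rewrite -mulrDr -splitr.
Qed.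

End RootsOfUnity.

(** * Components, distances and comparison of nested domains *)

Section FamilyComparison.
Context (R : realType).
Implicit Types (z c : R[i]) (x y r s t d e : R) (v V : sphere R -> R) (G : set (sphere R)).

(** A component contains every connected [D j] that it meets, and each [D j] is open. *)
Lemma open_component_bigcup (T : topologicalType) (I : Type) (P : set I) (D : I -> set T) (a : T) :
  (forall j, P j -> open (D j)) -> (forall j, P j -> connected (D j)) ->
  open (connected_component (\bigcup_(j in P) D j) a).
Proof.
move=> oD cD; rewrite openE => b ab; have [j Pj Djb] := connected_component_sub ab.
rewrite (same_connected_component ab).
apply: filterS (_ : nbhs b (D j)); last by apply: open_nbhs_nbhs; split => //; exact: oD.
apply: connected_component_max => //; [exact: bigcup_sup|exact: cD].
Qed.

(** The distance attains a positive minimum on the product; half of it gives the strict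
    inequality. *)
Lemma compact_distance (A B : set R[i]^o) : compact A -> compact B -> A `&` B = set0 ->
  exists2 r, 0 < r & forall a b, A a -> B b -> r < modulus (a - b).
Proof.
move=> cA cB AB; have [|/set0P] := eqVneq (A `*` B) set0.
  move=> AB0; exists 1 => // a b Aa Bb; exfalso.
  suff : (A `*` B) (a, b) by rewrite AB0.
  by [].
move=> AB0; pose g (ab : R[i]^o * R[i]^o) : R := - modulus (ab.1 - ab.2).
have cg : continuous g.
  move=> [a b]; apply/(@cvgrPdist_lt R R^o) => e e0; have e20 : 0 < e / 2 by lra.
  exists ([set w | modulus (w - a) < e / 2], [set w | modulus (w - b) < e / 2]).
    by split; apply/nbhs_plane; exists (e / 2).
  move=> [a' b'] [/= ha hb]; rewrite /g /= opprK addrC.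
  have E : (a' - b') - (a - b) = (a' - a) - (b' - b) :> R[i] by ring.
  have := modulus_lip (a' - b') (a - b); rewrite E.
  have := modulusD (a' - a) (- (b' - b)); rewrite modulusN; lra.
have [[a b] [/= Aa Bb] abM] := EVT_compact AB0 (compact_setX cA cB) (fun p _ => cg p).
have ab0 : 0 < modulus (a - b).
  rewrite modulus_gt0 subr_eq0; apply/eqP => abE.
  suff : (A `&` B) a by rewrite AB.
  by split => //; rewrite abE.
exists (modulus (a - b) / 2) => [|a' b' Aa' Bb']; first lra.
by have := abM (a', b') (conj Aa' Bb'); rewrite lerN2 /=; lra.
Qed.

Lemma open_closed_disk G c : open G -> G (fin_pt c) ->
  exists2 d, 0 < d & forall z, modulus (z - c) <= d -> G (fin_pt z).
Proof.
move=> oG /(domain_near_fin oG)/nbhs_plane[e e0 eG]; exists (e / 2); first lra.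
by move=> z zc; apply: eG; lra.
Qed.

(** A member vanishes near every point outside [G], so it is subharmonic at the points gained in [H]
    as well. *)
Lemma family_mono G (H : set (sphere R)) z0 v : open G -> open H -> G `<=` H ->
  green_family G z0 v -> green_family H z0 v.
Proof.
move=> oG oH GH fv; have [_ [K [cK KG K0]] [M Mv]] := fv; apply: family_intro => //.
- by move=> c _ cz0; exact: (family_subh oG fv).
- by move=> _; split; [exact: (family_cont fv)|exact: (family_infty fv)].
- by exists K; split => //; exact: subset_trans GH.
by exists M.
Qed.

Lemma family_seq_max G z0 (I : eqType) (s : seq I) (u : I -> sphere R -> R) : open G ->
  (forall i, green_family G z0 (u i)) -> (forall i P, 0 <= u i P) ->
  exists w, [/\ green_family G z0 w, forall P, 0 <= w P &
    forall i P, i \in s -> u i P <= w P].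
Proof.
move=> oG fu u0; elim: s => [|i s [w [fw w0 uw]]].
  by exists (fun=> 0); split => //; exact: family_zero.
exists (fun P => Num.max (u i P) (w P)); split.
- exact: (family_max oG).
- by move=> P; rewrite le_max w0 orbT.
move=> j P; rewrite inE => /orP[/eqP ->|js]; rewrite le_max ?lexx//.
by rewrite uw ?orbT.
Qed.

(** What the energy inequality asks of a single potential, with the set where it differs from the
    logarithm enclosed in a compact part of [G]: disjoint domains then give potentials at positive
    distance. *)
Definition log_potential G (c : R[i]) (f : R[i]^o -> R) : Prop :=
  [/\ continuous f, forall z, subh_pt f z,
      exists Y, forall z, Y < modulus z -> f z = ln (modulus (z - c)),
      forall z, z != c -> ln (modulus (z - c)) <= f z &
      exists A : set R[i]^o, [/\ compact A,
        forall z, z = c \/ f z <> ln (modulus (z - c)) -> A z &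
        forall z, A z -> G (fin_pt z)]].

(* One potential approximates at once the inner radius of [D] and finitely many
   values of the Green function of the larger domain [G]. *)
Lemma green_potential (D G : set (sphere R)) (z0 p : R[i]) d r0 (S : seq R[i]) :
  open D -> open G -> D `<=` G ->
  0 < d -> (forall z, modulus (z - p) <= d -> ~ G (fin_pt z)) ->
  0 < r0 -> (forall z, modulus (z - z0) <= r0 -> D (fin_pt z)) ->
  exists L, inner_radius D z0 = expR L /\ forall e, 0 < e ->
  exists f : R[i]^o -> R, [/\ log_potential G z0 f, L - e <= f z0 &
      forall z, z \in S -> z != z0 ->
        (if fin_pt z \in G then green G z0 (fin_pt z) else 0) + ln (modulus (z - z0)) - e <= f z].
Proof.
move=> oD oG DG d0 Gp r00 Dr.
have Dz0 : D (fin_pt z0) by apply: Dr; rewrite subrr modulus0 ltW.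
have Gz0 := DG _ Dz0.
have Dp z : modulus (z - p) <= d -> ~ D (fin_pt z) by move=> /Gp + /DG.
have Gr z : modulus (z - z0) <= r0 -> G (fin_pt z) by move=> /Dr/DG.
have [L [_ LE Lv]] := inner_radius_exists oD Dz0 d0 Dp r00 Dr.
exists L; split => // e e0; have e20 : 0 < e / 2 by lra.
have [v0 [fv0 v00 Lv0]] := Lv _ e20.
have fv0' := family_mono oD oG DG fv0.
have ex_u z : exists u : sphere R -> R,
    [/\ green_family G z0 u, forall P, 0 <= u P & green G z0 (fin_pt z) - e / 2 < u (fin_pt z)].
  by have [v fv [v1 v2]] := green_approx z0 oG (fin_pt z) e20; exists v.
have [u hu] := boolp.choice ex_u.
have [w0 [fw0 w00 uw0]] : exists w, [/\ green_family G z0 w, forall P, 0 <= w P &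
    forall z P, z \in S -> u z P <= w P].
  by apply: family_seq_max => // z; case: (hu z).
(* [v0] is nearly optimal for the radius of [D], and [w0] dominates nearly optimal members for all
   the points of [S]; their maximum serves both purposes. *)
pose w P := Num.max (v0 P) (w0 P).
have fw : green_family G z0 w := family_max oG fv0' fw0.
have w_ge0 P : 0 <= w P by rewrite le_max v00.
have mw : pole_mean z0 r0 v0 <= pole_mean z0 r0 w.
  rewrite /pole_mean lerD2r; apply: le_mean; first exact: ltW.
  - exact: (family_circle_cont oG r00 fv0').
  - exact: (family_circle_cont oG r00 fw).
  by move=> z _; rewrite /= le_max lexx.
have [f [Y [A [[f1 f2 f3 f4 cA] [A1 A2 A3 A4]]]]] :=
  potential_of_family oG Gz0 d0 Gp r00 Gr S fw w_ge0 e20.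
exists f; split; [|lra|].
  by split => //; [exists Y|exists A].
move=> z zS zz0; case: ifPn => [|_]; last by have := f4 _ zz0; lra.
have := A4 _ zS zz0; have [_ _ uz] := hu z; have := uw0 z (fin_pt z) zS.
have : w0 (fin_pt z) <= w (fin_pt z) by rewrite le_max lexx orbT.
lra.
Qed.

End FamilyComparison.

(** * The energy of the charge n at the origin and -1 at each z_k *)

Section Assembly.
Context (R : realType) (N : nat).
Implicit Types (x y r s t d e : R) (G : set (sphere R)).

Lemma big_option (I : finType) (F : option I -> R) :
  \sum_i F i = F None + \sum_i F (Some i).
Proof.
rewrite (bigD1 None)//= (reindex_omap Some id) => [|[i|]]//=.
by congr (_ + _); apply: eq_bigl => i; rewrite eqxx.
Qed.

Lemma star_energy (D0 : set (sphere R)) (C : 'I_N -> set (sphere R)) (z : 'I_N -> R[i])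
    (f0 : R[i]^o -> R) (f : 'I_N -> R[i]^o -> R) :
  log_potential D0 0 f0 -> (forall k, log_potential (C k) (z k) (f k)) ->
  (forall k, D0 `&` C k = set0) -> D0 (fin_pt 0) -> (forall k, C k (fin_pt (z k))) ->
  (forall k l, k != l -> z k != z l) ->
  (N ^ 2)%:R * f0 0 + \sum_(k < N) \sum_(l < N) (if (k <= l)%N then f k (z l) else f l (z k)) <=
  2 * N%:R * \sum_k ln (modulus (z k)).
Proof.
move=> [c0 s0 [Y0 far0] ge0 [A0 [cA0 suppA0 A0D]]] hf dis D00 Cz zinj.
have Cnot k w : C k (fin_pt w) -> D0 (fin_pt w) -> False.
  move=> Ckw Dw; suff : (D0 `&` C k) (fin_pt w) by rewrite dis.
  by [].
have zk0 k : z k != 0 by apply/eqP => h; apply: (Cnot k 0); rewrite // -h.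
pose q (i : option 'I_N) : R := if i is Some _ then -1 else N%:R.
pose p (i : option 'I_N) : R[i] := if i is Some k then z k else 0.
pose F (i : option 'I_N) : R[i]^o -> R := if i is Some k then f k else f0.
have q0 : \sum_i q i = 0 by rewrite big_option /= sumr_const card_ord mulNrn subrr.
have Fc i : continuous (F i) by case: i => [k|] //=; case: (hf k).
have Fs i w : subh_pt (F i) w by case: i => [k|] //=; case: (hf k).
have [Y hY] := boolp.choice (fun k => let: And5 _ _ h _ _ := hf k in h).
have [A hA] := boolp.choice (fun k => let: And5 _ _ _ _ h := hf k in h).
pose Ym := Num.max Y0 (\big[Num.max/0]_k Y k).
have far i w : Ym < modulus w -> F i w = ln (modulus (w - p i)).
  rewrite gt_max => /andP[h0 h]; case: i => [k|] /=; last exact: far0.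
  by apply: hY; apply: le_lt_trans h; exact: le_bigmax.
have Fge i w : w != p i -> ln (modulus (w - p i)) <= F i w.
  by case: i => [k|] /=; [case: (hf k) => _ _ _ h _; exact: h|exact: ge0].
have [r r_gt0 rA] : exists2 r, 0 < r & forall k a b, A0 a -> A k b -> r < modulus (a - b).
  have dk k : exists r, 0 < r /\ forall a b, A0 a -> A k b -> r < modulus (a - b).
    have [cAk _ AkC] := hA k.
    have [r rr rd] : exists2 r, 0 < r & forall a b, A0 a -> A k b -> r < modulus (a - b).
      apply: compact_distance => //; rewrite -subset0 => w [/A0D Dw /AkC Cw].
      exact: (Cnot k w).
    by exists r.
  have [rr hr] := boolp.choice dk.
  exists (\big[Num.min/1]_k rr k).
    by apply: lt_bigmin => // k _; case: (hr k).
  move=> k a b Aa Ab; have [_ /(_ a b Aa Ab)] := hr k; apply: le_lt_trans.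
  exact: bigmin_le.
have Fdisj i j : q i * q j < 0 -> forall w w',
    potential_supp p F i w -> potential_supp p F j w' -> r < modulus (w - w').
  have supp k w : potential_supp p F (Some k) w -> A k w by case: (hA k) => _ h _; exact: h.
  case: i j => [k|] [l|] /=.
  - by rewrite mulrNN mulr1 ltr10.
  - move=> _ w w' /supp Aw /suppA0 Aw'; rewrite modulusB; exact: (rA k).
  - move=> _ w w' /suppA0 Aw /supp Aw'; exact: (rA l).
  by rewrite ltNge mulr_ge0.
have pinj i j : i != j -> p i != p j.
  case: i j => [k|] [l|] //= kl; [exact: zinj|by rewrite eq_sym].
(* In the pairs formed by the origin and some [z k] the value taken is always [f0 (z k)], which is
   exactly ln |z k| because [z k] lies outside [D0]. Among the [z k] the potential with the smaller
   index is evaluated. *)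
pose s (i j : option 'I_N) :=
  match i, j with Some k, Some l => (k <= l)%N | Some _, None => false | None, _ => true end.
have := energy_inequality q0 Fc Fs far Fge r_gt0 Fdisj pinj s.
have f0z k : f0 (z k) = ln (modulus (z k)).
  have [//|fz] := eqVneq (f0 (z k)) (ln (modulus (z k))).
  exfalso; apply: (Cnot k (z k)); [exact: Cz|apply/A0D/suppA0; right].
  by rewrite subr0; apply/eqP.
rewrite big_option big_option /=.
under eq_bigr do rewrite f0z.
under [X in _ + X <= _]eq_bigr => k _.
  rewrite big_option /= f0z.
  under eq_bigr do rewrite mulrNN mulr1 mul1r.
  over.
rewrite big_split /= -!mulr_sumr natrX expr2.
move: (\sum_k \sum_l _) (\sum_k ln _) (f0 0) => a b c.
lra.
Qed.

End Assembly.

(** * The inequality for radii and Green functions *)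

Section RadiiProductBound.
Context (R : realType) (N : nat).
Implicit Types (x y r s t d e : R) (G : set (sphere R)).

(** Potentials that account for each radius and each Green value up to [e] are inserted into
    [star_energy], and [e] tends to 0. *)
Lemma star_green_inequality (D0 : set (sphere R)) (D C : 'I_N -> set (sphere R))
    (z : 'I_N -> R[i]) : (0 < N)%N ->
  open D0 -> (forall k, open (D k)) -> (forall k, open (C k)) ->
  (forall k, D k `<=` C k) -> D0 (fin_pt 0) -> (forall k, D k (fin_pt (z k))) ->
  (forall k, D0 `&` C k = set0) -> (forall k l, k != l -> z k != z l) ->
  exists (L0 : R) (L : 'I_N -> R), [/\ inner_radius D0 0 = expR L0,
    forall k, inner_radius (D k) (z k) = expR (L k) &
    (N ^ 2)%:R * L0 + \sum_k L k + 2 * \sum_(k < N) \sum_(l < N | (k < l)%N)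
      ((if fin_pt (z l) \in C k then green (C k) (z k) (fin_pt (z l)) else 0) +
        ln (modulus (z l - z k))) <= 2 * N%:R * \sum_k ln (modulus (z k))].
Proof.
move=> N0 oD0 oD oC DC D00 Dz dis zinj.
have Cnot k w : C k (fin_pt w) -> D0 (fin_pt w) -> False.
  move=> Ckw Dw; suff : (D0 `&` C k) (fin_pt w) by rewrite dis.
  by [].
have [d0 d00 dD0] := open_closed_disk oD0 D00.
have dk k : exists d, 0 < d /\ forall w, modulus (w - z k) <= d -> D k (fin_pt w).
  by have [d ? ?] := open_closed_disk (oD k) (Dz k); exists d.
have [d hd] := boolp.choice dk.
pose k0 : 'I_N := Ordinal N0.
have [L0 [L0E L0P]] : exists L, inner_radius D0 0 = expR L /\ forall e, 0 < e ->
    exists f, log_potential D0 0 f /\ L - e <= f 0.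
  (* The disk that [D0] must omit is found in [D k0]; the sets [C k] in turn omit a disk about 0
     contained in [D0]. *)
  have [dk00 dDk0] := hd k0.
  have Dd w : modulus (w - z k0) <= d k0 -> ~ D0 (fin_pt w).
    by move=> /dDk0/DC Cw Dw; exact: (Cnot k0 w).
  have [L [LE LP]] := green_potential [::] oD0 oD0 (@subset_refl _ D0) dk00 Dd d00 dD0.
  by exists L; split => // e /LP[f [h1 h2 _]]; exists f.
have LkP k : exists L, inner_radius (D k) (z k) = expR L /\ forall e, 0 < e ->
    exists f, [/\ log_potential (C k) (z k) f, L - e <= f (z k) &
      forall l, l != k -> (if fin_pt (z l) \in C k then green (C k) (z k) (fin_pt (z l)) else 0) +
        ln (modulus (z l - z k)) - e <= f (z l)].
  have [dk00 dDk0] := hd k.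
  have Cd w : modulus (w - 0) <= d0 -> ~ C k (fin_pt w) by move=> /dD0 Dw Cw; exact: (Cnot k w).
  have [L [LE LP]] := green_potential (map z (enum 'I_N)) (oD k) (oC k) (DC k) d00 Cd dk00 dDk0.
  exists L; split => // e /LP[f [h1 h2 h3]]; exists f; split => // l lk.
  by apply: h3; [apply: map_f; rewrite mem_enum|exact: zinj].
have [L hL] := boolp.choice LkP.
exists L0, L; split => //; first by move=> k; case: (hL k).
pose g k l := (if fin_pt (z l) \in C k then green (C k) (z k) (fin_pt (z l)) else 0) +
        ln (modulus (z l - z k)).
set pairs := \sum_(k < N) \sum_(l < N | (k < l)%N) 1 : R.
have pairs0 : 0 <= pairs by apply: sumr_ge0 => k _; apply: sumr_ge0.
(* The approximations counted with their weights: [N ^ 2] for the origin, one for each of the [N]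
   radii, two for each pair. *)
pose K := (N ^ 2)%:R + N%:R + 2 * pairs.
have K0 : 0 <= K by rewrite !addr_ge0// mulr_ge0.
have M e : 0 < e -> (N ^ 2)%:R * L0 + \sum_k L k + 2 * \sum_(k < N) \sum_(l < N | (k < l)%N) g k l
    <= 2 * N%:R * \sum_k ln (modulus (z k)) + K * e.
  move=> e0; have [f0 [f0P L0f]] := L0P e e0.
  have fk k := (hL k).2 e e0.
  have [f hf] := boolp.choice fk.
  have fP k : log_potential (C k) (z k) (f k) by case: (hf k).
  have := star_energy f0P fP dis D00 (fun k => DC k _ (Dz k)) zinj.
  rewrite (sum_pairs (fun k l => f k (z l))) /=.
  have h1 : \sum_k L k - N%:R * e <= \sum_k f k (z k).
    rewrite mulr_natl -[X in _ *+ X]card_ord -sumr_const -sumrB.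
    by apply: ler_sum => k _; case: (hf k).
  have h2 : \sum_(k < N) \sum_(l < N | (k < l)%N) g k l - pairs * e <=
      \sum_(k < N) \sum_(l < N | (k < l)%N) f k (z l).
    rewrite /pairs mulr_suml -sumrB; apply: ler_sum => k _.
    rewrite mulr_suml -sumrB; apply: ler_sum => l kl; rewrite mul1r.
    by have [_ _ ->//] := hf k; apply: contraTneq kl => ->; rewrite ltnn.
  have h0 : (N ^ 2)%:R * L0 - (N ^ 2)%:R * e <= (N ^ 2)%:R * f0 0.
    by rewrite -mulrBr ler_wpM2l.
  have -> : K * e = (N ^ 2)%:R * e + N%:R * e + 2 * (pairs * e) by rewrite /K mulrDl mulrDl mulrA.
  move: h0 h1 h2.
  move: ((N ^ 2)%:R * L0) ((N ^ 2)%:R * e) ((N ^ 2)%:R * f0 0) (\sum_k L k) (N%:R * e)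
    (\sum_k f k (z k)) (\sum_(k < N) \sum_(l < N | (k < l)%N) g k l) (pairs * e)
    (\sum_(k < N) \sum_(l < N | (k < l)%N) f k (z l)) (2 * N%:R * \sum_k ln (modulus (z k))).
  move=> a1 a2 a3 a4 a5 a6 a7 a8 a9 a10; lra.
apply/ler_addgt0Pr => e e0; have K1 : 0 < K + 1 by rewrite ltr_wpDl.
apply: le_trans (M (e / (K + 1)) (divr_gt0 e0 K1)) _.
rewrite lerD2l mulrA ler_pdivrMr// mulrC ler_pM2l// lerDl; exact: ler01.
Qed.

(** After taking logarithms, the sum of ln |z_l - z_k| over pairs is bounded below by
    [sum_ln_differences], and 2 N - (N - 1) = N + 1 is the exponent of |z_k|. *)
Lemma radii_product_le (D0 : set (sphere R)) (D : 'I_N -> set (sphere R)) (z : 'I_N -> R[i]) :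
  (0 < N)%N -> admissible D0 D z -> radii_product D0 D z <= bound z.
Proof.
move=> N0 [[[_ oD0 _] D00] hD dis hz].
have oD k : open (D k) by case: (hD k) => -[].
have cD k : connected (D k) by case: (hD k) => -[].
have Dz k : D k (fin_pt (z k)) by case: (hD k).
have oC k : open (component D z k) by apply: open_component_bigcup.
have DC k : D k `<=` component D z k.
  by apply: connected_component_max => //; apply: bigcup_sup.
have disC k : D0 `&` component D z k = set0.
  rewrite -subset0 => P [D0P /connected_component_sub[j _ DjP]].
  by have := dis j; rewrite -subset0; apply; split; [exact: D0P|exact: DjP].
have [zinj sumln] := sum_ln_differences N0 hz.
have [L0 [L [L0E LE M]]] := star_green_inequality N0 oD0 oD oC DC D00 Dz disC zinj.
have m0 k : 0 < modulus (z k) by rewrite modulus_gt0; case: (hz k).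
have NR : 0 < N%:R :> R by rewrite ltr0n.
have boundE : bound z = expR (N.+1%:R * \sum_k ln (modulus (z k)) - N%:R * ln N%:R).
  rewrite expRD mulrC /bound expRN expRM_natl lnK ?posrE//; congr (_ * _).
  rewrite mulr_sumr expR_sum; apply: eq_bigr => k _.
  by rewrite expRM_natl lnK ?posrE.
have radiiE : radii_product D0 D z = expR (2 * \sum_(k < N) \sum_(l < N | (k < l)%N)
    green_ext D z k (fin_pt (z l)) + (N ^ 2)%:R * L0 + \sum_k L k).
  rewrite /radii_product L0E !expRD expR_sum; congr (_ * _ * _); first by rewrite expRM_natl.
  by apply: eq_bigr => k _; rewrite LE.
rewrite boundE radiiE ler_expR.
have E : \sum_(k < N) \sum_(l < N | (k < l)%N)
      ((if fin_pt (z l) \in component D z k then green (component D z k) (z k) (fin_pt (z l)) else 0) +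
        ln (modulus (z l - z k))) =
    \sum_(k < N) \sum_(l < N | (k < l)%N) green_ext D z k (fin_pt (z l)) +
    \sum_(k < N) \sum_(l < N | (k < l)%N) ln (modulus (z l - z k)).
  by rewrite -big_split; apply: eq_bigr => k _; rewrite -big_split.
move: M; rewrite {}E; move: sumln.
have -> : N.+1%:R = N%:R + 1 :> R by rewrite natr1.
have -> : N.-1%:R = N%:R - 1 :> R by rewrite -[in RHS](prednK N0) -natr1 addrK.
move: (\sum_(k < N) ln _) (\sum_(k < N) \sum_(l < N | (k < l)%N) ln _) (\sum_(k < N) L k)
  (\sum_(k < N) \sum_(l < N | (k < l)%N) green_ext _ _ _ _) (N%:R : R) (ln (N%:R : R)) ((N ^ 2)%:R * L0).
move=> a b c d m1 m2 m3.
have -> : (m1 - 1) * a = m1 * a - a by ring.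
have -> : (m1 + 1) * a = m1 * a + a by ring.
rewrite -(mulrA 2 m1); move: (m1 * a) (m1 * m2) => m4 m5; lra.
Qed.

End RadiiProductBound.

(** * Domains with an explicit Green function *)

Lemma harm_pt_near (R : realType) (u v : R[i]^o -> R) (z : R[i]) :
  (\forall w \near (z : R[i]^o), u w = v w) -> harm_pt u z -> harm_pt v z.
Proof.
move=> uv hu; have su := subh_pt_near uv (harm_subh hu); split; first exact: su.1.
apply: filterS2 (near_circle uv) hu.2 => r [r0 h] um.
rewrite -(h z); last by rewrite subrr modulus0.
by rewrite -um; symmetry; apply: eq_mean => // w wr; apply: h; rewrite wr.
Qed.

Section ExplicitGreenFunction.
Context (R : realType) (G : set (sphere R)) (z0 : R[i]) (psi h : R[i]^o -> R).
Implicit Types (z w c : R[i]) (x y r s t e : R) (v : sphere R -> R).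
Hypothesis oG : open G.
Hypothesis Gz0 : G (fin_pt z0).
Hypothesis G_finite : ~ G None.
Hypothesis psi_harm : forall z, G (fin_pt z) -> z != z0 -> harm_pt psi z /\ 0 <= psi z.
Hypothesis psi_boundary : forall e, 0 < e -> exists K : set R[i]^o,
  [/\ compact K, forall z, K z -> G (fin_pt z) & forall z, G (fin_pt z) -> ~ K z -> psi z <= e].
Hypothesis h_cont : {for (z0 : R[i]^o), continuous h}.
Hypothesis psi_pole : \forall z \near (z0 : R[i]^o)^', psi z + ln (modulus (z - z0)) = h z.

Let ext (u : R[i]^o -> R) (P : sphere R) : R :=
  if P is Some z then if P \in G then u z else 0 else 0.

Let ext_near u c : G (fin_pt c) -> \forall w \near (c : R[i]^o), ext u (fin_pt w) = u w.
Proof.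
move=> Gc; have FF : Filter (nbhs (c : R[i]^o)) by exact: nbhs_filter.
apply: (filterS _ (domain_near_fin oG Gc)) => w Gw.
by rewrite /ext /fin_pt /= mem_set.
Qed.

Lemma pole_near : exists2 d, 0 < d & forall z, z != z0 -> modulus (z - z0) < d ->
  G (fin_pt z) /\ `|psi z + ln (modulus (z - z0)) - h z0| < 1.
Proof.
have [d1 d10 H1] := (near_dnbhs z0 _).1 psi_pole.
have [d2 d20 H2] := (continuous_plane h z0).1 h_cont 1 ltr01.
have /nbhs_plane[d3 d30 H3] := domain_near_fin oG Gz0.
exists (Num.min d1 (Num.min d2 d3)); first by rewrite !lt_min d10 d20.
move=> z zz; rewrite !lt_min => /and3P[h1 h2 h3]; split; first exact: H3.
by rewrite H1//; exact: H2.
Qed.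

(** [psi] itself need not vanish off a compact part of [G]; lowered by [e] and cut at 0 it does. *)
Lemma truncated_in_family e : 0 < e -> green_family G z0 (ext (fun z => Num.max (psi z - e) 0)).
Proof.
move=> e0; apply: family_intro => //.
- move=> c Gc cz0; have [hc _] := psi_harm Gc cz0.
  apply: (@subh_pt_near _ (fun z => Num.max (psi z - e) 0)).
    have FF : Filter (nbhs (c : R[i]^o)) by exact: nbhs_filter.
    by apply: (filterS _ (ext_near (fun z => Num.max (psi z - e) 0) Gc)) => w /= ->.
  apply: subh_pt_max; last exact/harm_subh/harm_cst.
  by apply/harm_subh/harm_ptB => //; exact: harm_cst.
- have [K [cK KG Ke]] := psi_boundary e0.
  exists (@fin_pt R @` K); split; first exact: compact_fin.
    by move=> _ [z Kz <-]; exact: KG.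
  move=> [z|]//= nK; case: ifPn => // /set_mem Gz; apply/max_idPr.
  rewrite subr_le0; apply: Ke => // Kz; apply: nK; by exists z.
have [d d0 dH] := pole_near.
exists (`|h z0| + 1); apply/near_dnbhs; exists (Num.min d 1); first by rewrite lt_min d0 ltr01.
move=> z zz; rewrite lt_min => /andP[zd z1]; have [Gz] := dH z zz zd.
rewrite ltr_norml => /andP[_ hz]; rewrite /ext /fin_pt /= mem_set//.
have l0 : ln (modulus (z - z0)) <= 0 by exact: ln_le0 (ltW z1).
have := ler_norm (h z0); have := normr_ge0 (h z0).
by case: (leP (psi z - e) 0) => _; lra.
Qed.

(** [psi], extended by 0, majorises the family, and its truncations, which belong to the family,
    come within [e] of it. *)
Lemma green_explicit z : G (fin_pt z) -> z != z0 -> green G z0 (fin_pt z) = psi z.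
Proof.
move=> Gz zz0; have [d d0 dH] := pole_near.
have le_psi v : green_family G z0 v -> v (fin_pt z) <= psi z.
  move=> fv; have -> : psi z = ext psi (fin_pt z) by rewrite /ext /fin_pt /= mem_set.
  apply: (green_majorant oG _ _ _ _ fv Gz) => //.
  - move=> [c|]// Gc cz0; have cz : c != z0 by apply/eqP => cE; apply: cz0; rewrite cE.
    have [hc pc] := psi_harm Gc cz; split; last by rewrite /ext mem_set.
    apply/continuous_fin.
    apply: (@cont_near _ _ _ psi); last exact: (subh_pt_cont (harm_subh hc)).
    have FF : Filter (nbhs (c : R[i]^o)) by exact: nbhs_filter.
    by apply: (filterS _ (ext_near psi Gc)) => w /= ->.
  - move=> c Gc cz; apply: (harm_pt_near _ (psi_harm Gc cz).1).
    have FF : Filter (nbhs (c : R[i]^o)) by exact: nbhs_filter.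
    by apply: (filterS _ (ext_near psi Gc)) => w /= ->.
  - exists (h z0 - 1); apply/near_dnbhs; exists d => // w wz wd.
    have [Gw] := dH w wz wd; rewrite ltr_norml => /andP[hz _].
    by rewrite /ext /fin_pt /= mem_set//; lra.
  by case=> zE; rewrite zE eqxx in zz0.
apply/eqP; rewrite eq_le; apply/andP; split; first exact: green_le.
apply/ler_addgt0Pr => e e0; rewrite -lerBlDr.
apply: (@le_trans _ _ (ext (fun z => Num.max (psi z - e) 0) (fin_pt z))).
  by rewrite /ext /fin_pt /= mem_set// le_max lexx.
apply: ub_le_sup; first by exists (psi z) => _ [v fv <-]; exact: le_psi.
by exists (ext (fun z => Num.max (psi z - e) 0)) => //; exact: truncated_in_family.
Qed.

Lemma inner_radius_explicit : inner_radius G z0 = expR (h z0).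
Proof.
rewrite /inner_radius; congr expR.
have FF : ProperFilter ((z0 : R[i]^o)^') by exact: Proper_dnbhs_numFieldType.
apply: cvg_lim; first exact: Rhausdorff.
apply/(@cvgrPdist_le _ _ _ ((z0 : R[i]^o)^')) => e e0.
have [d1 d10 H1] := (near_dnbhs z0 _).1 psi_pole.
have [d2 d20 H2] := (continuous_plane h z0).1 h_cont e e0.
have /nbhs_plane[d3 d30 H3] := domain_near_fin oG Gz0.
apply/near_dnbhs; exists (Num.min d1 (Num.min d2 d3)); first by rewrite !lt_min d10 d20.
move=> z zz; rewrite !lt_min => /and3P[h1 h2 h3].
by rewrite (green_explicit (H3 z h3) zz) H1// distrC ltW// H2.
Qed.

End ExplicitGreenFunction.

(** * Connected and compact sets described by inequalities *)

Section Star.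
Context (R : realType).
Implicit Types (z w c : R[i]) (x y r s t e : R) (A : set R[i]).

Lemma open_fin A : (forall z, A z -> exists2 e, 0 < e & forall w, modulus (w - z) < e -> A w) ->
  open (@fin_pt R @` A).
Proof.
move=> hA; rewrite openE => _ [z Az <-]; apply/nbhs_fin; have [e e0 eA] := hA z Az.
by exists e => // w /eA Aw; exists w.
Qed.

Lemma open_fin_lt (u v : R[i]^o -> R) : continuous u -> continuous v ->
  open (@fin_pt R @` [set z | u z < v z]).
Proof.
move=> cu cv; apply: open_fin => z uv; have e0 : 0 < (v z - u z) / 2 by rewrite /= in uv; lra.
have [d1 d10 H1] := (continuous_plane u z).1 (cu z) _ e0.
have [d2 d20 H2] := (continuous_plane v z).1 (cv z) _ e0.
exists (Num.min d1 d2); first by rewrite lt_min d10.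
move=> w; rewrite lt_min => /andP[/H1 + /H2]; rewrite !ltr_norml /= => /andP[_ h1] /andP[h2 _].
lra.
Qed.

(** The set is the union of the segments from [c] to its points, all of which contain [c]. *)
Lemma star_connected A c : A c ->
  (forall z t, A z -> 0 <= t <= 1 -> A (c + t%:C * (z - c))) -> connected (@fin_pt R @` A).
Proof.
move=> Ac As; pose seg z t := fin_pt (c + t%:C * (z - c)).
have -> : @fin_pt R @` A = \bigcup_(z in A) (seg z @` `[0, 1]).
  apply/seteqP; split=> [_ [z Az <-]|P [z Az [t]]]; rewrite /= ?in_itv/=.
    exists z => //; exists 1; first by rewrite /= in_itv/= ler01 lexx.
    by rewrite /seg mul1r addrC subrK.
  by move=> t01 <-; exists (c + t%:C * (z - c)) => //; exact: As.
apply: bigcup_connected.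
  exists (fin_pt c) => z Az; exists 0; first by rewrite /= in_itv/= ler01 lexx.
  by rewrite /seg mul0r addr0.
move=> z Az; apply: connected_continuous_connected; first exact: segment_connected.
apply: continuous_subspaceT => t.
apply: (@continuous_comp _ R[i]^o _ (fun t : R => c + t%:C * (z - c) : R[i]^o)); last exact: continuous_fin_pt.
have -> : (fun t : R => c + t%:C * (z - c) : R[i]^o) =
    (fun t => (complex.Re c + t * complex.Re (z - c)) +i* (complex.Im c + t * complex.Im (z - c))).
  by apply/funext => s; case: (c) => cr ci; case: (z) => zr zi; simpc.
apply: continuous_Complex.
  by apply: contD; [exact: cont_cst|apply: contM; [exact: cvg_id|exact: cont_cst]].
by apply: contD; [exact: cont_cst|apply: contM; [exact: cvg_id|exact: cont_cst]].
Qed.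

(** An open part of the plane is a union of disks, which are open and connected. *)
Lemma open_component_fin A P : open (@fin_pt R @` A) ->
  open (connected_component (@fin_pt R @` A) P).
Proof.
move=> oA; pose D (j : R[i] * R) := @fin_pt R @` [set z | modulus (z - j.1) < j.2].
pose I := [set j | 0 < j.2 /\ D j `<=` @fin_pt R @` A].
have -> : @fin_pt R @` A = \bigcup_(j in I) D j.
  apply/seteqP; split; last by move=> Q [j [_ DA] /DA].
  move=> _ [z Az <-]; have /nbhs_fin[e e0 eA] : nbhs (fin_pt z) (@fin_pt R @` A).
    by apply: open_nbhs_nbhs; split => //; exists z.
  exists (z, e); last by exists z => //=; rewrite subrr modulus0.
  by split => // _ [w we <-]; exact: eA.
apply: open_component_bigcup => j [j0 _].
  apply: (@open_fin_lt (fun z => modulus (z - j.1)) (fun=> j.2)) => z; first exact: continuous_modulusB.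
  exact: cont_cst.
apply: (@star_connected _ j.1); first by rewrite /= subrr modulus0.
move=> z t /= zj /andP[t0 t1]; rewrite addrC addKr modulusM modulus_real ger0_norm//.
by apply: le_lt_trans zj; rewrite ler_piMl// modulus_ge0.
Qed.

Lemma connected_separation (B : set (sphere R)) (u v : R[i]^o -> R) z w : continuous u -> continuous v ->
  connected B -> B `<=` @fin_pt R @` [set z | u z != v z] -> B (fin_pt z) -> B (fin_pt w) ->
  u z < v z -> v w < u w -> False.
Proof.
move=> cu cv cB BU Bz Bw uvz uvw.
pose U := @fin_pt R @` [set z | u z < v z]; pose V := @fin_pt R @` [set z | v z < u z].
have oU : open U by exact: open_fin_lt.
have oV : open V by exact: open_fin_lt.
have UV P : U P -> V P -> False.
  by move=> [a h <-] [b h' [E]]; rewrite E /= in h'; have := lt_trans h h'; rewrite ltxx.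
have sep : separated U V.
  split; rewrite -subset0 => P [].
    move=> clU VP; have [Q [UQ VQ]] := clU V (open_nbhs_nbhs (conj oV VP)).
    exact: (UV Q).
  move=> UP clV; have [Q [VQ UQ]] := clV U (open_nbhs_nbhs (conj oU UP)).
  exact: (UV Q).
have BUV : B `<=` U `|` V.
  by move=> P /BU[a /= h <-]; move: h; rewrite neq_lt => /orP[h|h]; [left|right]; exists a.
have [/(_ _ Bw)|/(_ _ Bz)] := connected_subset sep BUV cB => h.
  by apply: (UV (fin_pt w)) => //; exists w.
by apply: (UV (fin_pt z)) => //; exists z.
Qed.

Lemma compact_sublevel (u v : R[i]^o -> R) r : continuous u -> continuous v ->
  (forall z, u z <= v z -> modulus z <= r) -> compact [set z : R[i]^o | u z <= v z].
Proof.
move=> cu cv uvr; suff cl : closed [set z : R[i]^o | u z <= v z].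
  apply: (subclosed_compact cl (@compact_cdisk R 0 r)).
  by move=> z /= /uvr; rewrite /cdisk /= subr0.
have -> : [set z : R[i]^o | u z <= v z] = ~` ((@fin_pt R : R[i]^o -> sphere R) @^-1` (@fin_pt R @` [set z | v z < u z])).
  apply/seteqP; split=> z /=.
    by move=> uv [w h [E]]; rewrite E ltNge uv in h.
  by move=> h; rewrite leNgt; apply/negP => h'; apply: h; exists z.
apply: open_closedC; apply: open_comp; last exact: open_fin_lt.
by move=> z _; exact: continuous_fin_pt.
Qed.

Lemma cont_prod (I : Type) (s : seq I) (F : I -> R[i]^o -> R) : (forall i, continuous (F i)) ->
  continuous (fun z : R[i]^o => \prod_(i <- s) F i z).
Proof.
move=> cF z; elim: s => [|i s IH].
  by under eq_fun do rewrite big_nil; exact: cont_cst.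
by under eq_fun do rewrite big_cons; apply: contM => //; exact: cF.
Qed.

End Star.

Lemma prod_gt0_ln (R : realType) (I : Type) (s : seq I) (P : pred I) (F : I -> R) :
  (forall i, P i -> 0 < F i) ->
  0 < \prod_(i <- s | P i) F i /\ ln (\prod_(i <- s | P i) F i) = \sum_(i <- s | P i) ln (F i).
Proof.
move=> F0; elim/big_rec2: _ => [|i x y Pi [x0 xE]]; first by rewrite ln1.
by rewrite mulr_gt0 ?F0// lnM ?posrE ?F0// xE.
Qed.

(** * Geometry of the extremal domains *)

Section ExtremalConfiguration.
Context (R : realType) (n : nat) (rho : R).
Implicit Types (z w c : R[i]) (x y r s t e : R).
Hypothesis n0 : (0 < n)%N.
Hypothesis rho0 : 0 < rho.
Let zs : 'I_n -> R[i] := zstar rho.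
Let prod_dist (z : R[i]^o) : R := \prod_(k < n) modulus (z - zs k).

Lemma nR_gt0 : 0 < n%:R :> R. Proof. by rewrite ltr0n. Qed.

Lemma modulus_zstar k : modulus (zs k) = rho.
Proof. by rewrite /zs /zstar modulusM modulus_cis mulr1 modulus_real ger0_norm// ltW. Qed.

Lemma zstar_neq0 k : zs k != 0.
Proof. by rewrite -modulus_gt0 modulus_zstar. Qed.

Lemma cis_2pi_nat m : cis (2 * pi * m%:R) = 1 :> R[i].
Proof. by rewrite mulrC -cisX -[2 * pi]add0r cis_periodic cis0 expr1n. Qed.

Lemma zstarX k : zs k ^+ n = (rho ^+ n)%:C.
Proof.
rewrite /zs /zstar exprMn cisX mulrC [n%:R * _]mulrC divfK ?gt_eqF ?nR_gt0//.
by rewrite cis_2pi_nat mul1r rmorphXn.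
Qed.

(** The factorisation of X^n - 1 rescaled to the circle of radius [rho]. As [zs k] has argument 2 pi
    (k + 1) / n, the variable is also divided by the root of unity [om], whose n-th power is 1. *)
Lemma prod_zstar z : \prod_(k < n) (z - zs k) = z ^+ n - (rho ^+ n)%:C.
Proof.
set om := cis (2 * pi / n%:R) : R[i].
have P := factor_Xn_sub_1 (primitive_cis R n0); rewrite -/om big_mkord in P.
have rom0 : rho%:C * om != 0 by rewrite mulf_neq0 ?cis_neq0// -modulus_gt0 modulus_real normr_gt0 gt_eqF.
have omn : om ^+ n = 1.
  by rewrite cisX mulrC divfK ?gt_eqF ?nR_gt0// -[2 * pi]add0r cis_periodic cis0.
have := congr1 (fun p : {poly R[i]} => (rho%:C * om) ^+ n * p.[z / (rho%:C * om)]) P.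
rewrite horner_prod hornerD hornerN hornerXn -polyC1 hornerC mulrBr -exprMn mulrCA divff// !mulr1.
rewrite exprMn omn mulr1 -rmorphXn => <-.
transitivity (\prod_(k < n) (rho%:C * om) * \prod_(k < n) ('X - (om ^+ k)%:P).[z / (rho%:C * om)]); last first.
  by congr (_ * _); rewrite prodr_const card_ord exprMn omn mulr1 -rmorphXn.
rewrite -big_split /=.
apply: eq_bigr => k _; rewrite !hornerE mulrBr mulrCA divff// mulr1; congr (_ - _).
rewrite -mulrA -exprS cisX; congr (_ * cis _).
by rewrite [RHS]mulrC mulrAC.
Qed.

Lemma prod_distE z : prod_dist z = modulus (z ^+ n - (rho ^+ n)%:C).
Proof. by rewrite -prod_zstar (big_morph _ (@modulusM R) (modulus1 R)). Qed.

(** The two sides of the perpendicular bisector of 0 and [x]. With w = z^n and x = rho^n they become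
    comparisons of |z|^n with the product of the distances to the [zs k]. *)
Lemma half_plane w x : 0 < x ->
  (modulus w < modulus (w - x%:C)) = (complex.Re w < x / 2) /\
  (modulus (w - x%:C) < modulus w) = (x / 2 < complex.Re w).
Proof.
move=> x0.
have E : modulus (w - x%:C) ^+ 2 = modulus w ^+ 2 + 2 * x * (x / 2 - complex.Re w).
  by rewrite !modulus_sqr; case: w => a b /=; rewrite subr0; field.
have p0 : 0 < 2 * x by lra.
split; rewrite -(@ltr_pXn2r _ 2) ?nnegrE ?modulus_ge0// E.
  by rewrite ltrDl pmulr_rgt0// subr_gt0.
by rewrite gtrDl pmulr_rlt0// subr_lt0.
Qed.

Lemma inner_half z : (complex.Re (z ^+ n) < rho ^+ n / 2) = (modulus z ^+ n < prod_dist z).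
Proof. by rewrite prod_distE -modulusX (half_plane _ (exprn_gt0 n rho0)).1. Qed.

Lemma outer_half z : (rho ^+ n / 2 < complex.Re (z ^+ n)) = (prod_dist z < modulus z ^+ n).
Proof. by rewrite prod_distE -modulusX (half_plane _ (exprn_gt0 n rho0)).2. Qed.

Lemma continuous_prod_dist : continuous prod_dist.
Proof. by apply: cont_prod => k; exact: continuous_modulusB. Qed.

Lemma continuous_modulusX : continuous (fun z : R[i]^o => modulus z ^+ n).
Proof.
have -> : (fun z : R[i]^o => modulus z ^+ n) = fun z : R[i]^o => \prod_(k < n) modulus z.
  by apply/funext => z; rewrite prodr_const card_ord.
by apply: cont_prod => k; exact: continuous_modulus.
Qed.

Lemma D0starE : D0star n rho = @fin_pt R @` [set z | modulus z ^+ n < prod_dist z].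
Proof. by congr image; apply/funext => z /=; rewrite inner_half. Qed.

Lemma DstarE k : @Dstar R n rho k =
  connected_component (@fin_pt R @` [set z | prod_dist z < modulus z ^+ n]) (fin_pt (zs k)).
Proof.
by congr connected_component; congr image; apply/funext => z /=; rewrite outer_half.
Qed.

Lemma zstar_outer k : prod_dist (zs k) < modulus (zs k) ^+ n.
Proof. by rewrite prod_distE zstarX subrr modulus0 modulus_zstar exprn_gt0. Qed.

Lemma open_D0star : open (D0star n rho).
Proof. rewrite D0starE; exact: (open_fin_lt continuous_modulusX continuous_prod_dist). Qed.

Lemma open_Dstar k : open (@Dstar R n rho k).
Proof.
rewrite DstarE; apply: open_component_fin.
exact: (open_fin_lt continuous_prod_dist continuous_modulusX).
Qed.

Lemma D0star_0 : D0star n rho (fin_pt 0).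
Proof.
by exists 0 => //=; rewrite expr0n gtn_eqF//= divr_gt0// exprn_gt0.
Qed.

Lemma Dstar_zstar k : @Dstar R n rho k (fin_pt (zs k)).
Proof.
by rewrite DstarE; apply: connected_component_refl; exists (zs k) => //; exact: zstar_outer.
Qed.

(** The domain is star-shaped about 0: scaling z by t multiplies Re z^n by t^n <= 1, and the
    threshold is positive. *)
Lemma connected_D0star : connected (D0star n rho).
Proof.
apply: (@star_connected _ _ 0).
  by have [z h [zE]] := D0star_0; rewrite -zE.
move=> z t /= h /andP[t0 t1]; rewrite add0r subr0 exprMn -rmorphXn.
have -> : complex.Re ((t ^+ n)%:C * z ^+ n) = t ^+ n * complex.Re (z ^+ n).
  by case: (z ^+ n) => a b /=; rewrite mul0r subr0.
have tn0 : 0 <= t ^+ n by exact: exprn_ge0.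
have tn1 : t ^+ n <= 1 by exact: exprn_ile1.
have a0 : 0 < rho ^+ n / 2 by rewrite divr_gt0// exprn_gt0.
have [c0|c0] := leP (complex.Re (z ^+ n)) 0.
  by apply: le_lt_trans a0; rewrite mulr_ge0_le0.
by apply: le_lt_trans h; rewrite ler_piMl// ltW.
Qed.

Lemma zstar_polar k : zs k = (modulus (zs k))%:C * cis (2 * pi * k.+1%:R / n%:R).
Proof. by rewrite modulus_zstar. Qed.

Lemma zstar_admissible : admissible (D0star n rho) (@Dstar R n rho) zs.
Proof.
split.
- split; last exact: D0star_0.
  by split; [exists (fin_pt 0); exact: D0star_0|exact: open_D0star|exact: connected_D0star].
- move=> k; split; last exact: Dstar_zstar.
  split; [by exists (fin_pt (zs k)); exact: Dstar_zstar|exact: open_Dstar|exact: component_connected].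
- move=> k; rewrite -subset0 => P [[z h <-]] /connected_component_sub[w h' [wz]].
  by rewrite /= wz in h'; have := lt_trans h h'; rewrite ltxx.
by move=> k; split; [exact: zstar_neq0|exact: zstar_polar].
Qed.

End ExtremalConfiguration.

(** * Separation of the extremal domains by rays *)

Section ExtremalRadii.
Context (R : realType) (n : nat) (rho : R).
Implicit Types (z w c : R[i]) (x y r s t e : R).
Hypothesis n0 : (0 < n)%N.
Hypothesis rho0 : 0 < rho.
Let zs : 'I_n -> R[i] := zstar rho.
Let prod_dist (z : R[i]^o) : R := \prod_(k < n) modulus (z - zs k).

Lemma harm_sum (I : Type) (s : seq I) (F : I -> R[i]^o -> R) z :
  (forall i, harm_pt (F i) z) -> harm_pt (fun w => \sum_(i <- s) F i w) z.
Proof.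
move=> hF; elim: s => [|i s IH].
  by under eq_fun do rewrite big_nil; exact: harm_cst.
by under eq_fun do rewrite big_cons; apply: harm_ptD.
Qed.

(** By the symmetry m -> N - m one may assume 2 m <= N; then both angles lie in [0, pi], where the
    cosine decreases, and 2 m > 1. *)
Lemma cos_root_lt (N m : nat) : (0 < m < N)%N -> cos (2 * pi * m%:R / N%:R) < cos (pi / N%:R) :> R.
Proof.
have pi0 : 0 < pi :> R by exact: pi_gt0.
suff H (m' : nat) : (0 < m' < N)%N -> (2 * m' <= N)%N ->
    cos (2 * pi * m'%:R / N%:R) < cos (pi / N%:R) :> R.
  move=> /andP[m0 mN]; have [h|h] := leqP (2 * m) N; first by apply: H => //; rewrite m0.
  have NR : 0 < N%:R :> R by rewrite ltr0n; lia.
  have -> : cos (2 * pi * m%:R / N%:R) = cos (2 * pi * (N - m)%:R / N%:R) :> R.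
    have -> : 2 * pi * (N - m)%:R / N%:R = - (2 * pi * m%:R / N%:R) + 2 * pi :> R.
      by rewrite natrB 1?ltnW//; field; rewrite gt_eqF.
    have := congr1 (@complex.Re R) (cis_periodic (- (2 * pi * m%:R / N%:R) : R)).
    by rewrite /cis /= => ->; rewrite cosN.
  by apply: H; lia.
move=> /andP[m0 mN] mN2; have NR : 0 < N%:R :> R by rewrite ltr0n; lia.
have m1 : 1 <= m'%:R :> R by rewrite ler1n.
have m2 : 2 * m'%:R <= N%:R :> R by rewrite -natrM ler_nat.
have p1 : pi <= pi * m'%:R :> R by rewrite ler_peMr// ltW.
have p2 : pi * (2 * m'%:R) <= pi * N%:R :> R by rewrite ler_pM2l.
have pi1 := ltW pi0; have NR0 := ltW NR.
have I1 : (pi / N%:R : R) \in `[0, pi].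
  rewrite in_itv/= divr_ge0//= ler_pdivrMr// ler_peMr//; lra.
have I2 : (2 * pi * m'%:R / N%:R : R) \in `[0, pi].
  rewrite in_itv/= divr_ge0//=; last by rewrite -mulrA mulr_ge0// mulr_ge0//; lra.
  by rewrite ler_pdivrMr// -mulrA mulrCA.
rewrite ltr_cos// ltr_pM2r ?invr_gt0// -mulrA; lra.
Qed.

(* On the two rays bounding the sector about zeta_k one has z^n = - |z|^n. *)
Lemma sector_boundary k z : complex.Re (z * (cis (2 * pi * (k : 'I_n).+1%:R / n%:R))^*) = modulus z * cos (pi / n%:R) ->
  complex.Re (z ^+ n) <= 0.
Proof.
set om := cis _; set al := pi / n%:R; move=> yr; pose y := z * om^*.
have nR : n%:R != 0 :> R by rewrite pnatr_eq0 -lt0n.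
have omn : om^* ^+ n = 1.
  rewrite -rmorphXn /om cisX mulrC divfK// cis_2pi_nat. by rewrite rmorph1.
have yn : y ^+ n = z ^+ n by rewrite exprMn omn mulr1.
have my : modulus y = modulus z by rewrite modulusM modulus_conj modulus_cis mulr1.
have yi : (complex.Im y) ^+ 2 = (modulus z * sin al) ^+ 2.
  have yr' : complex.Re y = modulus z * cos al := yr.
  have := modulus_sqr y; rewrite my yr' !exprMn; have := cos2Dsin2 al.
  move: (modulus z ^+ 2) (cos al ^+ 2) (sin al ^+ 2) (complex.Im y ^+ 2) => a b c d.
  move=> bc ad; have E : a * b + a * c = a by rewrite -mulrDr bc mulr1.
  lra.
have [b yb] : exists b, [/\ y = (modulus z)%:C * cis b & cos (n%:R * b) = -1].
  have E : n%:R * al = pi by rewrite mulrC divfK.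
  move: yi => /eqP; rewrite eqf_sqr => /orP[/eqP yi|/eqP yi].
    exists al; rewrite E cospi; split => //.
    by move: yr yi; rewrite -/y; case: (y) => a b /= -> ->; rewrite /cis; simpc.
  exists (- al); rewrite mulrN E cosN cospi; split => //.
  by move: yr yi; rewrite -/y; case: (y) => a b /= -> ->; rewrite /cis cosN sinN; simpc.
have [yE cb] := yb; rewrite -yn yE exprMn cisX -rmorphXn /cis /= cb mul0r subr0 mulrN1 oppr_le0.
by rewrite exprn_ge0// modulus_ge0.
Qed.

(** The sector about zeta_k is where Re (z conj zeta_k) exceeds |z| cos (pi / n). Its boundary rays
    avoid the set Re z^n > rho^n / 2, so a connected part of that set cannot contain both [zs k] and
    a point [zs l] outside the sector. *)
Lemma zstar_separated (B : set (sphere R)) (k l : 'I_n) : connected B ->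
  B `<=` @fin_pt R @` [set z | prod_dist z < modulus z ^+ n] ->
  B (fin_pt (zs k)) -> B (fin_pt (zs l)) -> k = l.
Proof.
move=> cB BH Bk Bl; apply/eqP/negPn/negP => kl.
pose om := cis (2 * pi * k.+1%:R / n%:R) : R[i].
have n1 : (1 < n)%N by move: (ltn_ord k) (ltn_ord l) kl; rewrite -(inj_eq val_inj) /=; lia.
pose u (z : R[i]^o) := modulus z * cos (pi / n%:R) : R.
pose v (z : R[i]^o) := complex.Re (z * om^*).
have cu : continuous u.
  by move=> z; apply: contM; [exact: continuous_modulus|exact: cont_cst].
have cv : continuous v.
  have -> : v = fun z : R[i]^o => complex.Re z * complex.Re om^* - complex.Im z * complex.Im om^*.
    by apply/funext => -[a b]; rewrite /v /om /cis.
  have c1 x : continuous (fun z : R[i]^o => complex.Re z * x).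
    by move=> z; apply: contM; [exact: continuous_Re|exact: cont_cst].
  have c2 x : continuous (fun z : R[i]^o => complex.Im z * x).
    by move=> z; apply: contM; [exact: continuous_Im|exact: cont_cst].
  by move=> z; exact: (contB (c1 _ z) (c2 _ z)).
have vz (j : 'I_n) : v (zs j) = rho * cos (2 * pi * j.+1%:R / n%:R - 2 * pi * k.+1%:R / n%:R).
  rewrite /v /om /zs /zstar cis_conj -(mulrA rho%:C) -cisD.
  by rewrite /cis /= mul0r subr0.
have uz (j : 'I_n) : u (zs j) = rho * cos (pi / n%:R) by rewrite /u modulus_zstar.
have BU : B `<=` @fin_pt R @` [set z | u z != v z].
  move=> P /BH[z /= h <-]; exists z => //=; apply/eqP => /esym /(@sector_boundary k).
  apply/negP; rewrite -ltNge; apply: le_lt_trans (_ : rho ^+ n / 2 < _).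
    by rewrite divr_ge0// exprn_ge0// ltW.
  by rewrite outer_half.
apply: (connected_separation cu cv cB BU Bk Bl).
  rewrite uz vz subrr cos0 ltr_pM2l//.
  have NR : 0 < n%:R :> R by rewrite ltr0n.
  have N1 : 1 <= n%:R :> R by rewrite ler1n.
  have I0 : (0 : R) \in `[0, pi] by rewrite in_itv/= lexx pi_ge0.
  have I1 : (pi / n%:R : R) \in `[0, pi].
    by rewrite in_itv/= divr_ge0 ?pi_ge0 ?(ltW NR)//= ler_pdivrMr// ler_peMr// pi_ge0.
  by rewrite -[X in _ < X]cos0 ltr_cos// divr_gt0// pi_gt0.
rewrite uz vz ltr_pM2l//.
have E (i j : 'I_n) : (j < i)%N -> 2 * pi * i.+1%:R / n%:R - 2 * pi * j.+1%:R / n%:R = 2 * pi * (i - j)%:R / n%:R :> R.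
  by move=> ji; rewrite -subSS natrB ?mulrBr ?mulrBl// ltnS ltnW.
have [kl'|kl'|/val_inj kl'] := ltngtP k l; last by rewrite kl' eqxx in kl.
  by rewrite E// cos_root_lt// subn_gt0 kl' /=; apply: leq_ltn_trans (leq_subr _ _) (ltn_ord l).
rewrite -opprB cosN E// cos_root_lt// subn_gt0 kl' /=; exact: leq_ltn_trans (leq_subr _ _) (ltn_ord k).
Qed.

End ExtremalRadii.

(** * Inner radii of the extremal domains and the case of equality *)

Section ExtremalEquality.
Context (R : realType) (n : nat) (rho : R).
Implicit Types (z w c : R[i]) (x y r s t e : R).
Hypothesis n0 : (0 < n)%N.
Hypothesis rho0 : 0 < rho.
Let zs : 'I_n -> R[i] := zstar rho.
Let prod_dist (z : R[i]^o) : R := \prod_(k < n) modulus (z - zs k).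

Let prod_dist_bounds z : modulus z ^+ n - rho ^+ n <= prod_dist z <= modulus z ^+ n + rho ^+ n.
Proof.
have rn : 0 <= rho ^+ n by rewrite exprn_ge0// ltW.
rewrite /prod_dist prod_distE// -modulusX.
have := modulus_le_dist (z ^+ n) (rho ^+ n)%:C.
have := modulusD (z ^+ n) (- (rho ^+ n)%:C); rewrite modulusN modulus_real ger0_norm// => h1 h2.
by apply/andP; split; lra.
Qed.

Let modulus_bound z x : 0 <= x -> modulus z ^+ n <= x -> modulus z <= x + 1.
Proof.
move=> x0 zx; rewrite leNgt; apply/negP => h.
have z1 : 1 <= modulus z by lra.
have := ler_eXnr n0 z1; lra.
Qed.

Let ln_prod_dist z : (forall k, z != zs k) ->
  0 < prod_dist z /\ ln (prod_dist z) = \sum_(k < n) ln (modulus (z - zs k)).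
Proof. by move=> zz; apply: prod_gt0_ln => k _; rewrite modulus_gt0 subr_eq0. Qed.

Let prod_dist_neq z : 0 < prod_dist z -> forall k, z != zs k.
Proof.
move=> p k; apply: contraTneq p => ->.
by rewrite /prod_dist prod_distE// zstarX// subrr modulus0 ltxx.
Qed.

Lemma inner_radius_D0star : inner_radius (D0star n rho) 0 = rho.
Proof.
have nR := nR_gt0 R n0.
have nV : 0 < n%:R^-1 :> R by rewrite invr_gt0.
pose h z := n%:R^-1 * \sum_(k < n) ln (modulus (z - zs k)).
pose psi z := h z - ln (modulus (z - 0)).
have far z : D0star n rho (fin_pt z) -> modulus z ^+ n < prod_dist z.
  by rewrite D0starE// => -[w hw [<-]].
have pos z : D0star n rho (fin_pt z) -> 0 < prod_dist z.
  by move=> /far; apply: le_lt_trans; rewrite exprn_ge0// modulus_ge0.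
have psiE z : z != 0 -> 0 < prod_dist z -> psi z = n%:R^-1 * (ln (prod_dist z) - ln (modulus z ^+ n)).
  move=> zz p; rewrite /psi /h subr0 -(ln_prod_dist (prod_dist_neq p)).2 mulrBr lnXn ?modulus_gt0//.
  by rewrite -(mulr_natl (ln _)) mulKf// gt_eqF.
have hE : expR (h 0) = rho.
  rewrite /h (eq_bigr (fun=> ln rho)); last by move=> k _; rewrite sub0r modulusN modulus_zstar.
  by rewrite sumr_const card_ord -(mulr_natl (ln _)) mulKf ?gt_eqF// lnK// posrE.
rewrite -[RHS]hE; apply: (@inner_radius_explicit _ _ _ psi h).
- exact: open_D0star.
- exact: D0star_0.
- by move=> [z _]; discriminate.
- move=> z Gz zz; split.
    apply: harm_ptB; last exact: harm_ln.
    apply: harm_ptZ; rewrite /prod_dist.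
    by apply: harm_sum => k; apply: harm_ln; exact: (prod_dist_neq (pos z Gz)).
  rewrite psiE//; last exact: pos.
  rewrite mulr_ge0 ?(ltW nV)// subr_ge0 ler_ln ?posrE ?exprn_gt0 ?modulus_gt0//; last exact: pos.
  exact/ltW/far.
- move=> e e0; pose E := expR (n%:R * e).
  have E1 : 1 < E by rewrite -expR0 ltr_expR mulr_gt0.
  have cE : continuous (fun z : R[i]^o => E * modulus z ^+ n).
    by move=> z; refine (@contM R R[i]^o z (fun=> E) (fun z => modulus z ^+ n) _ _); [exact: cont_cst|exact: continuous_modulusX].
  (* This set is bounded because E |z|^n <= |z|^n + rho^n on it, so the decay of [psi] at infinity
     is covered by the same condition as its boundary values. *)
  exists [set z | E * modulus z ^+ n <= prod_dist z]; split.
  + apply: (@compact_sublevel _ _ _ (rho ^+ n / (E - 1) + 1)).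
    * exact: cE.
    * exact: continuous_prod_dist.
    move=> z zE; apply: modulus_bound; first by rewrite divr_ge0 ?exprn_ge0 ?(ltW rho0)//; lra.
    rewrite ler_pdivlMr; last by lra.
    have /andP[_ h2] := prod_dist_bounds z.
    by rewrite mulrBr mulr1 mulrC; move: zE h2; rewrite /prod_dist; lra.
  + move=> z zE; rewrite D0starE//; exists z => //=.
    have [->|zz] := eqVneq z 0.
      rewrite modulus0 expr0n gtn_eqF//= prod_distE// expr0n gtn_eqF//= sub0r modulusN modulus_real.
      by rewrite normr_gt0 gt_eqF// exprn_gt0.
    by apply: lt_le_trans zE; rewrite ltr_pMl// exprn_gt0// modulus_gt0.
  move=> z Gz /negP; rewrite -ltNge => zE; have p := pos z Gz.
  have zn : 0 < modulus z ^+ n.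
    by have := lt_trans p zE; rewrite pmulr_rgt0// expR_gt0.
  have zz : z != 0 by apply: contraTneq zn => ->; rewrite modulus0 expr0n gtn_eqF//= ltxx.
  rewrite psiE// ler_pdivrMl// lerBlDr -[n%:R * e]expRK -lnM ?posrE ?expR_gt0//.
  by rewrite ler_ln ?posrE ?mulr_gt0 ?expR_gt0// ltW.
- apply: contM; first exact: cont_cst.
  apply: cont_sum => k; apply: continuous_ln_modulus.
  by rewrite eq_sym zstar_neq0.
by apply: nearW => z; rewrite /psi subrK.
Qed.

(** At [zs k] the regular part [h] is n ln rho minus the sum of ln |zs k - zs l| over l <> k, and
    the product of these distances is n rho^(n-1), whence rho / n. *)
Lemma inner_radius_Dstar k : inner_radius (@Dstar R n rho k) (zs k) = rho / n%:R.
Proof.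
have nR := nR_gt0 R n0.
pose h z := n%:R * ln (modulus (z - 0)) - \sum_(l < n) (if l != k then ln (modulus (z - zs l)) else 0).
pose psi z := n%:R * ln (modulus (z - 0)) - \sum_(l < n) ln (modulus (z - zs l)).
pose H := @fin_pt R @` [set z | prod_dist z < modulus z ^+ n].
have oH : open H.
  exact: (@open_fin_lt R prod_dist (fun z => modulus z ^+ n) (@continuous_prod_dist R n rho) (@continuous_modulusX R n)).
have DE : @Dstar R n rho k = connected_component H (fin_pt (zs k)) by exact: DstarE.
have far z : @Dstar R n rho k (fin_pt z) -> prod_dist z < modulus z ^+ n.
  by rewrite DE => /connected_component_sub[w hw [<-]].
have pd0 z : 0 <= prod_dist z by apply: prodr_ge0 => l _; exact: modulus_ge0.
have zn0 z : @Dstar R n rho k (fin_pt z) -> 0 < modulus z ^+ n.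
  by move=> /far; apply: le_lt_trans.
have neq0 z : 0 < modulus z ^+ n -> z != 0.
  by apply: contraTneq => ->; rewrite modulus0 expr0n gtn_eqF//= ltxx.
have neq z : @Dstar R n rho k (fin_pt z) -> z != zs k -> forall l, z != zs l.
  move=> Gz zk l; have [lk|lk] := eqVneq l k; first by rewrite lk.
  apply/eqP => zE; move/eqP: lk; apply; symmetry.
  apply: (@zstar_separated R n rho n0 rho0 (@Dstar R n rho k)).
  - exact: component_connected.
  - by rewrite DE; exact: connected_component_sub.
  - exact: Dstar_zstar.
  by rewrite -/zs -zE.
have psiE z : 0 < modulus z ^+ n -> 0 < prod_dist z -> psi z = ln (modulus z ^+ n) - ln (prod_dist z).
  move=> zz p; rewrite /psi subr0 -(ln_prod_dist (prod_dist_neq p)).2 lnXn ?modulus_gt0 ?neq0//.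
  by rewrite mulr_natl.
have hE : expR (h (zs k)) = rho / n%:R.
  rewrite /h subr0 modulus_zstar// -big_mkcond /=.
  have F0 (l : 'I_n) : l != k -> 0 < modulus (zs k - zs l).
    move=> lk; rewrite modulus_gt0 subr_eq0; apply: contraNneq lk => E.
    apply/eqP; symmetry; apply: (@zstar_separated R n rho n0 rho0 (@Dstar R n rho k)).
    - exact: component_connected.
    - by rewrite DE; exact: connected_component_sub.
    - exact: Dstar_zstar.
    by rewrite -/zs -E; exact: Dstar_zstar.
  rewrite -(prod_gt0_ln (index_enum _) F0).2.
  have -> : \prod_(l < n | l != k) modulus (zs k - zs l) = rho ^+ n.-1 * n%:R.
    rewrite -(prod_root_differences R k) -[in rho ^+ _](card_ord n) -(cardC1 k) -prodr_const -big_split /=.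
    apply: eq_bigr => l _; rewrite /zs /zstar -mulrBr modulusM modulus_real ger0_norm// ltW//.
  rewrite lnM ?posrE ?exprn_gt0// lnXn// -(mulr_natl (ln rho)) opprD addrA -mulrBl -natrB ?leq_pred//.
  have -> : (n - n.-1)%N = 1%N by rewrite -[X in (X - _)%N](prednK n0) subSn// subnn.
  by rewrite mul1r expRD expRN !lnK ?posrE.
rewrite -[RHS]hE; apply: (@inner_radius_explicit _ _ _ psi h).
- exact: open_Dstar.
- exact: Dstar_zstar.
- by rewrite DE => /connected_component_sub[z _]; discriminate.
- move=> z Gz zz; have zl := neq z Gz zz; split.
    apply: harm_ptB.
      by apply: harm_ptZ; apply: harm_ln; exact/neq0/zn0.
    by apply: harm_sum => l; apply: harm_ln.
  have p := (ln_prod_dist zl).1.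
  rewrite psiE//; last exact: zn0.
  by rewrite subr_ge0 ler_ln ?posrE ?zn0//; exact/ltW/far.
- move=> e e0; pose E := expR e.
  have E1 : 1 < E by rewrite -expR0 ltr_expR.
  pose S := [set z : R[i]^o | E * prod_dist z <= modulus z ^+ n].
  have cE : continuous (fun z : R[i]^o => E * prod_dist z).
    by move=> z; refine (@contM R R[i]^o z (fun=> E) prod_dist _ _); [exact: cont_cst|exact: continuous_prod_dist].
  have cS : compact S.
    apply: (@compact_sublevel _ _ _ (E * rho ^+ n / (E - 1) + 1)).
    + exact: cE.
    + exact: continuous_modulusX.
    move=> z zE; have rn : 0 < rho ^+ n by exact: exprn_gt0.
    apply: modulus_bound; first by rewrite divr_ge0 ?mulr_ge0 ?(ltW rn)//; lra.
    rewrite ler_pdivlMr; last by lra.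
    have /andP[h1 _] := prod_dist_bounds z.
    have : E * (modulus z ^+ n - rho ^+ n) <= modulus z ^+ n.
      by apply: le_trans zE; rewrite ler_pM2l//; lra.
    by rewrite mulrBr mulrBr mulr1 (mulrC E (modulus z ^+ n)); lra.
  have SH z : S z -> H (fin_pt z).
    move=> zE; exists z => //=; have := pd0 z; rewrite le_eqVlt => /orP[/eqP p|p]; last first.
      by apply: lt_le_trans zE; rewrite ltr_pMl.
    rewrite -p lt0r exprn_ge0 ?modulus_ge0// andbT; apply/eqP => zn.
    have /andP[_ h2] := prod_dist_bounds z; move: p; rewrite /prod_dist prod_distE//.
    have -> : z = 0.
      by apply/eqP; rewrite -modulus_eq0; move/eqP: zn; rewrite expf_eq0 => /andP[].
    rewrite expr0n gtn_eqF//= sub0r modulusN modulus_real => /esym/eqP.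
    by rewrite normr_eq0 gt_eqF// exprn_gt0.
  (* [S] may extend into every component of [H]. Removing the components other than [Dstar k], a
     union of open sets, keeps it compact and leaves exactly its part in that domain. *)
  pose U := \bigcup_(P in H `\` @Dstar R n rho k) connected_component H P.
  have oU : open U by apply: bigcup_open => P _; exact: open_component_fin.
  exists (S `&` ~` ((@fin_pt R : R[i]^o -> sphere R) @^-1` U)); split.
  + apply: compact_closedI => //; apply: open_closedC; apply: open_comp => // z _.
    exact: continuous_fin_pt.
  + move=> z [Sz nU]; apply: contrapT => nG; apply: nU.
    exists (fin_pt z); first by split => //; exact: SH.
    by apply: connected_component_refl; exact: SH.
  move=> z Gz nK; have p : ~ S z.
    move=> Sz; apply: nK; split => // -[P [HP nGP] Pz]; apply: nGP.
    move: Gz; rewrite DE => Gz; apply: connected_component_trans Gz _.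
    exact: connected_component_sym.
  move/negP: p; rewrite -ltNge => zE.
  have pz : 0 < prod_dist z.
    by have := lt_trans (zn0 z Gz) zE; rewrite pmulr_rgt0// expR_gt0.
  rewrite psiE ?zn0// lerBlDr -[e]expRK -lnM ?posrE ?expR_gt0//.
  by rewrite ler_ln ?posrE ?mulr_gt0 ?expR_gt0// ?zn0// ltW.
- apply: contB.
    by apply: contM; [exact: cont_cst|apply: continuous_ln_modulus; exact: zstar_neq0].
  apply: cont_sum => l; case: (eqVneq l k) => [_|lk] /=; first exact: cont_cst.
  apply: continuous_ln_modulus; apply: contraNneq lk => E.
  apply/eqP; symmetry; apply: (@zstar_separated R n rho n0 rho0 (@Dstar R n rho k)).
  + exact: component_connected.
  + by rewrite DE; exact: connected_component_sub.
  + exact: Dstar_zstar.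
  by rewrite -/zs -E; exact: Dstar_zstar.
apply: nearW => z; rewrite /psi /h (bigD1 k)//= -big_mkcond /=; lra.
Qed.

(** The component of the union that contains [zs k] lies in the set Re z^n > rho^n / 2 and so
    contains no other [zs l]: all Green terms vanish. What remains is rho^(n^2) (rho / n)^n = n^(-n)
    rho^(n (n + 1)). *)
Lemma zstar_equality : radii_product (D0star n rho) (@Dstar R n rho) zs = bound zs.
Proof.
have g0 (k l : 'I_n) : (k < l)%N -> green_ext (@Dstar R n rho) zs k (fin_pt (zs l)) = 0.
  move=> kl; rewrite /green_ext; case: ifPn => // /set_mem Cl; exfalso.
  suff E : k = l by rewrite E ltnn in kl.
  apply: (@zstar_separated R n rho n0 rho0 (component (@Dstar R n rho) zs k)) => //.
  - exact: component_connected.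
  - move=> P /connected_component_sub[j _]; rewrite DstarE//; exact: connected_component_sub.
  by apply: connected_component_refl; exists k => //; exact: Dstar_zstar.
rewrite /radii_product big1; last by move=> k _; apply: big1 => l; exact: g0.
rewrite mulr0 expR0 mul1r inner_radius_D0star.
rewrite (eq_bigr (fun=> rho / n%:R)); last by move=> k _; exact: inner_radius_Dstar.
have -> : bound zs = n%:R ^- n * \prod_(k < n) rho ^+ n.+1.
  by congr (_ * _); apply: eq_bigr => k _; rewrite modulus_zstar.
rewrite !prodr_const card_ord -exprM mulSn exprD exprMn exprVn mulnn.
by rewrite mulrA mulrC [rho ^+ n * _]mulrC.
Qed.

End ExtremalEquality.

Local Close Scope complex_scope.

Theorem theorem4 (R : realType) (n : nat) (hn : (1 <= n)%N) :
  (forall (D0 : set (sphere R)) (D : 'I_n -> set (sphere R))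
          (z : 'I_n -> R[i]%C),
     admissible D0 D z -> radii_product D0 D z <= bound z) /\
  (forall rho : R, 0 < rho ->
     admissible (D0star n rho) (@Dstar R n rho) (zstar rho) /\
     radii_product (D0star n rho) (@Dstar R n rho) (zstar rho)
       = bound (zstar rho : 'I_n -> R[i]%C)).
Proof.
split=> [D0 D z|rho rho0]; first exact: radii_product_le.
by split; [exact: zstar_admissible|exact: zstar_equality].
Qed.
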